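(* Let $N\ge 1$ be an odd integer and $T>0$. The Dirac operator on the lens space $\mathcal{L}_N=SU(2)/\mathbb{Z}_N$ equipped with the Berger metric corresponding to the parameter $T$ and the trivial spin structure has the following spectrum: (1) for every pair $(n,m)$ such that either ($n\in 2\mathbb{N}+1$ and $m\in2\mathbb{Z}$) or ($n\in2\mathbb{N}$ and $m\in2\mathbb{Z}+1$), and such that $-n\le mN-1<n$, the two eigenvalues $$-\frac T2 \pm\sqrt{(1+n)^2+m^2N^2\left(\frac1{T^2}-1\right)},$$ each with multiplicity $n+1$; (2) for every $m\in\mathbb{N}$, the eigenvalue $-\frac T2-\frac{mN}{T}$ with multiplicity $2mN$. Here the spectrum is understood as a multiset: the multiplicity of a real number $\lambda$ is the sum of the contributions of all parameter values listed that yield $\lambda$.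
   Context: $\mathbb{N}=\{0,1,2,\dots\}$ (a contribution with multiplicity $0$ contributes nothing). In $\mathfrak{su}(2)$ let $I=\begin{pmatrix} i&0\\0&-i\end{pmatrix}$, $J=\begin{pmatrix}0&1\\-1&0\end{pmatrix}$, $K=\begin{pmatrix}0&i\\i&0\end{pmatrix}$. For $T>0$ the Berger metric with parameter $T$ on $SU(2)$ is the left-invariant metric for which $X_1=\frac1T I,\ X_2=J,\ X_3=K$ is an orthonormal basis ($T=1$ is the round metric). Let $\mathbb{Z}_N\subset SU(2)$ be the cyclic group of order $N$ generated by $\mathrm{diag}(e^{2\pi i/N},e^{-2\pi i/N})$; the Berger metric descends to $\mathcal{L}_N=SU(2)/\mathbb{Z}_N=\{g\mathbb{Z}_N\}$. The trivial spin structure is the one corresponding to the lift of the isotropy representation $\mathbb{Z}_N\to SO(3)$ given by the inclusion $\iota:\mathbb{Z}_N\to SU(2)\cong\mathrm{Spin}(3)$, i.e. the principal bundle $SU(2)\times_\iota \mathrm{Spin}(3)$. Concretely, spinor fields are the functions $\psi:SU(2)\to\mathbb{C}^2$ with $\psi(g\gamma)=\gamma^{-1}\psi(g)$ for all $\gamma\in\mathbb{Z}_N$, and the Dirac operator is $$D\psi = I\,(X_1\psi)+J\,(X_2\psi)+K\,(X_3\psi)-\left(\tfrac T2+\tfrac1T\right)\psi,$$ where $(X\psi)(g)=\frac{d}{dt}\big|_{t=0}\psi(g\exp(tX))$ and $I,J,K$ act as matrices on $\mathbb{C}^2$. *)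

(* Defs.v *)
From HB Require Import structures.
From mathcomp Require Import all_boot all_order all_algebra.
From mathcomp Require Import complex spectral.
From mathcomp Require Import all_classical all_reals all_analysis.
From mathcomp Require Import ring lra.

Set Implicit Arguments.
Unset Strict Implicit.
Unset Printing Implicit Defensive.

Import Order.TTheory GRing.Theory Num.Theory.
Import numFieldNormedType.Exports.

Local Open Scope classical_set_scope.
Local Open Scope complex_scope.
Local Open Scope sesquilinear_scope.
Local Open Scope ring_scope.

Set Warnings "-redundant-canonical-projection".
(* The usual topology and norm of the complex numbers, as for any numFieldType. *)
HB.instance Definition _ (R : realType) := NormedModule.copy R[i] (R[i])^o.
Set Warnings "redundant-canonical-projection".

Definition mx22 (K : Type) (a b c d : K) : 'M[K]_2 :=
  \matrix_(i, j) if i == 0 then (if j == 0 then a else b)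
                 else (if j == 0 then c else d).

Section Matrices.
Variable R : realType.
Local Notation C := R[i].
Implicit Types (X A B : 'M[C]_2) (a b c t : R).

Definition mxI : 'M[C]_2 := mx22 (0 +i* 1) 0 0 (0 +i* (- 1)).
Definition mxJ : 'M[C]_2 := mx22 0 1 (- 1) 0.
Definition mxK : 'M[C]_2 := mx22 0 (0 +i* 1) (0 +i* 1) 0.

Definition expmx (A : 'M[C]_2) : 'M[C]_2 :=
  lim (series (fun k => (k`!%:R)^-1 *: A ^+ k) @ \oo).

Definition su2 := [qualify X : 'M[C]_2 | (X^t* == - X) && (\tr X == 0)].

Lemma mx22P (K : Type) (A B : 'M[K]_2) :
  A 0 0 = B 0 0 -> A 0 1 = B 0 1 -> A 1 0 = B 1 0 -> A 1 1 = B 1 1 -> A = B.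
Proof.
move=> h00 h01 h10 h11; apply/matrixP => i j.
have o2 (k : 'I_2) : k = 0 \/ k = 1.
  by case: k => [[|[|k]] lk] //; [left|right]; apply/val_inj.
by case: (o2 i) => ->; case: (o2 j) => ->.
Qed.

Lemma mx_combE a b c : a%:C *: mxI + b%:C *: mxJ + c%:C *: mxK =
  mx22 (0 +i* a) (b +i* c) ((- b) +i* c) (0 +i* (- a)).
Proof.
by apply: mx22P; rewrite !mxE /=; apply/eqP; rewrite eq_complex /=;
  apply/andP; split; apply/eqP => /=; ring.
Qed.

Lemma su2P X : X \is su2 ->
  exists a b c, X = a%:C *: mxI + b%:C *: mxJ + c%:C *: mxK.
Proof.
move=> /andP[/eqP/matrixP hX /eqP tX].
have := hX 0 0; have := hX 0 1; have := hX 1 1.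
move: tX; rewrite /mxtrace big_ord_recl big_ord1 !mxE /=.
have -> : lift ord0 ord0 = 1 :> 'I_2 by apply/val_inj.
case e00 : (X 0 0) => [x00 y00]; case e01 : (X 0 1) => [x01 y01].
case e10 : (X 1 0) => [x10 y10]; case e11 : (X 1 1) => [x11 y11].
simpc => /eqP; rewrite eq_complex /= => /andP[/eqP h1 /eqP h2].
move=> [h3] [h5 h6] [h7].
exists y00, x01, y01; rewrite mx_combE; apply: mx22P;
  rewrite !mxE /= ?e00 ?e01 ?e10 ?e11; congr (_ +i* _); lra.
Qed.

Lemma su2_comb a b c : a%:C *: mxI + b%:C *: mxJ + c%:C *: mxK \is su2.
Proof.
rewrite mx_combE; apply/andP; split; apply/eqP.
  by apply: mx22P; rewrite !mxE /=; simpc; congr (_ +i* _); ring.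
rewrite /mxtrace big_ord_recl big_ord1 !mxE /=; simpc.
by apply/eqP; rewrite eq_complex /=; apply/andP; split; apply/eqP; ring.
Qed.

Lemma mxI_su2 : mxI \is su2.
Proof.
by have := su2_comb 1 0 0; rewrite scale1r !scale0r !addr0.
Qed.

Lemma mxJ_su2 : mxJ \is su2.
Proof.
by have := su2_comb 0 1 0; rewrite scale1r !scale0r addr0 add0r.
Qed.

Lemma mxK_su2 : mxK \is su2.
Proof.
by have := su2_comb 0 0 1; rewrite scale1r !scale0r !add0r.
Qed.

Lemma su2Z t X : X \is su2 -> t%:C *: X \is su2.
Proof.
move=> /su2P[a [b [c ->]]].
have -> : t%:C *: (a%:C *: mxI + b%:C *: mxJ + c%:C *: mxK) =
  (t * a)%:C *: mxI + (t * b)%:C *: mxJ + (t * c)%:C *: mxK.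
  by rewrite !scalerDr !scalerA -!rmorphM.
exact: su2_comb.
Qed.

Lemma cvg_real_complex (u : nat -> R) (l : R) :
  u n @[n --> \oo] --> l -> (u n)%:C @[n --> \oo] --> l%:C.
Proof.
move=> ul; apply/cvgrPdist_lt => -[e e'] /=.
rewrite ltcE /= => /andP[/eqP -> e0].
near=> n.
rewrite -rmorphB normc_def /= expr0n /= addr0 sqrtr_sqr ltcR.
by near: n; move/cvgrPdist_lt: ul; exact.
Unshelve. all: by end_near. Qed.

Lemma cvg_comb (u v : nat -> R) (x y : R) A B :
  u n @[n --> \oo] --> x -> v n @[n --> \oo] --> y ->
  (u n)%:C *: A + (v n)%:C *: B @[n --> \oo] --> x%:C *: A + y%:C *: B.
Proof.
move=> /cvg_real_complex ux /cvg_real_complex vy.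
apply: cvgD.
apply: (cvgZr_tmp ux).
exact: (cvgZr_tmp vy).
Qed.

Lemma expmx_unit B t : B *m B = - 1%:M ->
  expmx (t%:C *: B) = (cos t)%:C%:M + (sin t)%:C *: B.
Proof.
move=> BB.
have BX k : B ^+ k = (-1) ^+ k./2 *: (if odd k then B else 1).
  elim: k => [|k IH]; first by rewrite expr0 scale1r.
  rewrite exprS IH /= uphalf_half; case: (odd k) => /=.
    by rewrite -scalerAr -[B * B]/(B *m B) BB scalerN add1n exprS mulN1r scaleNr.
  by rewrite -scalerAr mulr1 add0n.
have termE : (fun k => (k`!%:R)^-1 *: (t%:C *: B) ^+ k) =
    (fun k => (cos_coeff t k)%:C *: (1%:M : 'M[C]_2) + (sin_coeff t k)%:C *: B).
  apply/funext => k; rewrite exprZn BX /cos_coeff /sin_coeff /=.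
  rewrite !scalerA -!rmorphXn /=.
  have -> : ((-1) ^+ k./2 : C) = ((-1) ^+ k./2)%:C.
    by rewrite rmorphXn rmorphN1.
  have -> : ((k`!%:R)^-1 : C) = ((k`!%:R)^-1)%:C.
    by rewrite fmorphV rmorph_nat.
  rewrite -!rmorphM.
  case ok : (odd k) => /=.
    rewrite !mul0r rmorph0 scale0r add0r; congr (_%:C *: _).
    have -> : (k.-1)./2 = k./2.
      rewrite -[in RHS](odd_double_half k) -[in LHS](odd_double_half k) ok.
      by rewrite add1n /= uphalf_double doubleK.
    by ring.
  rewrite !mul0r rmorph0 scale0r addr0; congr (_%:C *: _).
  by rewrite -exprnP; ring.
rewrite /expmx termE; apply: cvg_lim => //.
have -> : series (fun k => (cos_coeff t k)%:C *: (1%:M : 'M[C]_2)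
                           + (sin_coeff t k)%:C *: B) =
    (fun n => (series (cos_coeff t) n)%:C *: 1%:M
              + (series (sin_coeff t) n)%:C *: B).
  apply/funext => n; rewrite /series /= big_split /= -!scaler_suml.
  by rewrite !raddf_sum.
have cc : series (cos_coeff t) n @[n --> \oo] --> cos t.
  by rewrite unlock; exact: is_cvg_series_cos_coeff.
have cs : series (sin_coeff t) n @[n --> \oo] --> sin t.
  by rewrite unlock; exact: is_cvg_series_sin_coeff.
by rewrite -[(cos t)%:C%:M]scalemx1; exact: cvg_comb cc cs.
Qed.

Lemma su2_unit X : X \is su2 ->
  exists t B, [/\ X = t%:C *: B, B \is su2 & B *m B = - 1%:M].
Proof.
have sq a b c : (a%:C *: mxI + b%:C *: mxJ + c%:C *: mxK) *m
    (a%:C *: mxI + b%:C *: mxJ + c%:C *: mxK) =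
    (- (a ^+ 2 + b ^+ 2 + c ^+ 2))%:C%:M.
  rewrite mx_combE; apply: mx22P; rewrite !mxE !big_ord_recl big_ord0 !mxE /=;
    by simpc; congr (_ +i* _); ring.
move=> /su2P[a [b [c ->]]].
pose r := Num.sqrt (a ^+ 2 + b ^+ 2 + c ^+ 2).
have s0 : 0 <= a ^+ 2 + b ^+ 2 + c ^+ 2 by rewrite !addr_ge0 ?sqr_ge0.
have r2 : r ^+ 2 = a ^+ 2 + b ^+ 2 + c ^+ 2 by rewrite sqr_sqrtr.
have [r0|rN0] := eqVneq r 0.
  have : a ^+ 2 + b ^+ 2 + c ^+ 2 == 0 by rewrite -r2 r0 expr0n.
  rewrite !paddr_eq0 ?addr_ge0 ?sqr_ge0 // !sqrf_eq0.
  move=> /andP[/andP[/eqP -> /eqP ->] /eqP ->].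
  exists 0, mxI; rewrite !scale0r !addr0; split=> //; first exact: mxI_su2.
  have := sq 1 0 0; rewrite scale1r !scale0r !addr0 => ->.
  by rewrite expr0n expr1n /= !addr0 rmorphN1 raddfN.
exists r, ((a / r)%:C *: mxI + (b / r)%:C *: mxJ + (c / r)%:C *: mxK); split.
- rewrite !scalerDr !scalerA -!rmorphM.
  by rewrite ![r * (_ / r)]mulrC !divfK.
- exact: su2_comb.
- rewrite sq !expr_div_n -!mulrDl -r2 divff ?expf_neq0 //.
  by rewrite rmorphN1 raddfN.
Qed.

Lemma det_mx22 A : \det A = A 0 0 * A 1 1 - A 0 1 * A 1 0.
Proof.
rewrite (expand_det_row _ 0) !big_ord_recl big_ord0 /cofactor !det_mx11 !mxE /=.
rewrite -[(0 + bump 0 0)%N]/1%N expr0 expr1 mul1r mulN1r mulrN addr0.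
by congr (A _ _ * A _ _ - A _ _ * A _ _); apply/val_inj.
Qed.

Lemma mx22_SU2 (x y z w : R) : x ^+ 2 = 1 - y ^+ 2 - z ^+ 2 - w ^+ 2 ->
  let M : 'M[C]_2 :=
    mx22 (x +i* y) (z +i* w) ((- z) +i* w) (x +i* (- y)) in
  (M \is unitarymx) && (\det M == 1).
Proof.
move=> h; cbv zeta; apply/andP; split.
  apply/unitarymxP; apply: mx22P;
    rewrite !mxE !big_ord_recl big_ord0 !mxE /=;
    apply/eqP; rewrite eq_complex /=; apply/andP; split; apply/eqP => /=;
    ring: h.
by rewrite det_mx22 !mxE eq_complex /=; apply/andP; split; apply/eqP; ring: h.
Qed.

Lemma expmx_su2 X : X \is su2 ->
  (expmx X \is unitarymx) && (\det (expmx X) == 1).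
Proof.
move=> /su2_unit[t [B [-> Bsu BB]]]; rewrite expmx_unit //.
have [a [b [c defB]]] := su2P Bsu.
have abc : a ^+ 2 = 1 - b ^+ 2 - c ^+ 2.
  have := congr1 (fun M : 'M[C]_2 => complex.Re (M 0 0)) BB.
  rewrite defB mx_combE !mxE !big_ord_recl big_ord0 !mxE /=; simpc => /= h.
  lra.
have cs : cos t ^+ 2 = 1 - sin t ^+ 2.
  by rewrite -(cos2Dsin2 t) addrK.
have -> : (cos t)%:C%:M + (sin t)%:C *: B =
    mx22 (cos t +i* (sin t * a)) (sin t * b +i* (sin t * c))
         ((- (sin t * b)) +i* (sin t * c)) (cos t +i* (- (sin t * a))).
  rewrite defB mx_combE; apply: mx22P; rewrite !mxE /=;
    apply/eqP; rewrite eq_complex /=; apply/andP; split; apply/eqP => /=; ring.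
by apply: mx22_SU2; ring: abc cs.
Qed.

End Matrices.

Section SUmx.
Variables (K : numClosedFieldType) (n : nat).
Implicit Types A B : 'M[K]_n.
Let SU A := (A \is unitarymx) && (\det A == 1).

Lemma SUmx1 : SU 1%:M.
Proof.
rewrite /SU det1 eqxx andbT; apply/unitarymxP.
by rewrite trmx1 map_mx1 mulmx1.
Qed.

Lemma SUmxM A B : SU A -> SU B -> SU (A *m B).
Proof.
move=> /andP[AU /eqP A1] /andP[BU /eqP B1].
by rewrite /SU mul_unitarymx // det_mulmx A1 B1 mulr1 eqxx.
Qed.

Lemma SUmxV A : SU A -> SU (invmx A).
Proof.
move=> /andP[AU /eqP A1].
by rewrite /SU det_inv A1 invr1 eqxx andbT invmx_unitary // trmxC_unitary.
Qed.

End SUmx.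

Record SU2 (R : realType) := MkSU2 {
  SU2val :> 'M[R[i]]_2;
  SU2_subproof : (SU2val \is unitarymx) && (\det SU2val == 1) }.

HB.instance Definition _ (R : realType) := [isSub for @SU2val R].
HB.instance Definition _ (R : realType) := [Choice of SU2 R by <:].
HB.instance Definition _ (R : realType) :=
  Topological.copy (SU2 R) (initial_topology (@SU2val R)).

Section SU2Group.
Variable R : realType.
Implicit Types g h : SU2 R.

Lemma SU2_1_subproof :
  ((1%:M : 'M[R[i]]_2) \is unitarymx) && (\det (1%:M : 'M[R[i]]_2) == 1).
Proof. exact: SUmx1. Qed.

Lemma SU2_mul_subproof g h :
  (SU2val g *m SU2val h \is unitarymx) && (\det (SU2val g *m SU2val h) == 1).
Proof. exact: SUmxM (SU2_subproof g) (SU2_subproof h). Qed.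

Lemma SU2_inv_subproof g :
  (invmx (SU2val g) \is unitarymx) && (\det (invmx (SU2val g)) == 1).
Proof. exact: SUmxV (SU2_subproof g). Qed.

Definition SU2_one : SU2 R := MkSU2 SU2_1_subproof.
Definition SU2_mul g h : SU2 R := MkSU2 (SU2_mul_subproof g h).
Definition SU2_inv g : SU2 R := MkSU2 (SU2_inv_subproof g).

Lemma SU2_unit g : SU2val g \in unitmx.
Proof. by have /andP[gU _] := SU2_subproof g; exact: unitarymx_unit. Qed.

Lemma SU2_mulA : associative SU2_mul.
Proof. by move=> g h k; apply/val_inj; rewrite /= mulmxA. Qed.
Lemma SU2_mul1 : left_id SU2_one SU2_mul.
Proof. by move=> g; apply/val_inj; rewrite /= mul1mx. Qed.
Lemma SU2_mulr1 : right_id SU2_one SU2_mul.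
Proof. by move=> g; apply/val_inj; rewrite /= mulmx1. Qed.
Lemma SU2_mulV : left_inverse SU2_one SU2_inv SU2_mul.
Proof. by move=> g; apply/val_inj; rewrite /= mulVmx // SU2_unit. Qed.
Lemma SU2_mulrV : right_inverse SU2_one SU2_inv SU2_mul.
Proof. by move=> g; apply/val_inj; rewrite /= mulmxV // SU2_unit. Qed.

HB.instance Definition _ := isGroup.Build (SU2 R)
  SU2_mulA SU2_mul1 SU2_mulr1 SU2_mulV SU2_mulrV.

End SU2Group.

Section Dirac.
Variable R : realType.
Local Notation C := R[i].
Implicit Types (X : 'M[C]_2) (T : R) (g : SU2 R) (psi : SU2 R -> 'cV[C]_2).

(* The default value 1 is never used on su(2), see [expSU2E]. *)
Definition expSU2 X : SU2 R := insubd (1%g : SU2 R) (expmx X).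

Lemma expSU2E X : X \is su2 R -> SU2val (expSU2 X) = expmx X.
Proof.
move=> Xsu; rewrite -[LHS]/(val (expSU2 X)) /expSU2 val_insubd.
by case: ifP => // /negP []; exact: expmx_su2.
Qed.

(* psi(g exp(tX)) - psi(g) over t; [lie_der] is its limit as the real number t
   tends to 0, meaningful when [lie_derivable] holds. *)
Definition lie_quot X psi g (t : R) : 'cV[C]_2 :=
  (t^-1)%:C *: (psi (g * expSU2 (t%:C *: X))%g - psi g).
Definition lie_derivable X psi := forall g, cvg (lie_quot X psi g t @[t --> 0^']).
Definition lie_der X psi : SU2 R -> 'cV[C]_2 :=
  fun g => lim (lie_quot X psi g t @[t --> 0^']).

(* The left-invariant fields trivialize the tangent bundle of SU(2), so that
   being C^k can be tested on iterated derivatives along them. *)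
Fixpoint isCk (k : nat) psi : Prop :=
  if k is k'.+1 then
    continuous psi /\
    forall X, X \is su2 R -> lie_derivable X psi /\ isCk k' (lie_der X psi)
  else continuous psi.
Definition smooth psi := forall k, isCk k psi.

Definition expi (theta : R) : C := cos theta +i* sin theta.

Definition ZN_gen_mx (N : nat) : 'M[C]_2 :=
  mx22 (expi (2 * pi / N%:R)) 0 0 (expi (- (2 * pi / N%:R))).

Lemma ZN_gen_subproof N :
  (ZN_gen_mx N \is unitarymx) && (\det (ZN_gen_mx N) == 1).
Proof.
rewrite /ZN_gen_mx /expi cosN sinN.
have := @mx22_SU2 R (cos (2 * pi / N%:R)) (sin (2 * pi / N%:R)) 0 0.
rewrite oppr0 expr0n /= !subr0; apply.
by have := cos2Dsin2 (2 * pi / N%:R : R); lra.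
Qed.

Definition ZN_gen (N : nat) : SU2 R := MkSU2 (ZN_gen_subproof N).
Definition ZN (N : nat) : set (SU2 R) :=
  [set gamma | exists k : nat, gamma = (ZN_gen N ^+ k)%g].

(* Spinor fields on SU(2)/Z_N: sections of the bundle associated with the lift
   Z_N -> SU(2) = Spin(3) given by the inclusion (trivial spin structure). *)
Definition spinor (N : nat) psi :=
  smooth psi /\
  forall g gamma, ZN N gamma ->
    psi (g * gamma)%g = SU2val (gamma^-1)%g *m psi g.

(* The Berger metric with parameter T has the orthonormal left-invariant frame
   X_1 = I / T, X_2 = J, X_3 = K, which trivializes the spinor bundle; the zeroth
   order term comes from the Levi-Civita connection in this frame. *)
Definition Dirac T psi : SU2 R -> 'cV[C]_2 := fun g =>
  mxI R *m lie_der ((T^-1)%:C *: mxI R) psi g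
  + mxJ R *m lie_der (mxJ R) psi g
  + mxK R *m lie_der (mxK R) psi g
  - (T / 2 + T^-1)%:C *: psi g.

Definition eigenspinors (N : nat) T (lambda : C) : set (SU2 R -> 'cV[C]_2) :=
  [set psi | spinor N psi /\ Dirac T psi = lambda *: psi].

End Dirac.

Definition has_dim (K : fieldType) (V : lmodType K) (E : set V) (d : nat) :=
  exists b : 'I_d -> V,
    (forall c : 'I_d -> K, \sum_(i < d) c i *: b i = 0 -> forall i, c i = 0) /\
    E = [set \sum_(i < d) c i *: b i | c in [set: 'I_d -> K]].

Section Spectrum.
Variable R : realType.
Implicit Types (N n : nat) (m : int) (s : bool) (T : R) (lambda : R[i]).

Definition admissible N n m :=
  (odd n && (2 %| m)%Z || ~~ odd n && ~~ (2 %| m)%Z)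
  && (- n%:Z <= m * N%:Z - 1 < n%:Z).

(* The boolean is the sign in front of the square root, true meaning minus. *)
Definition eigenvalue1 N T (p : nat * int * bool) : R :=
  let: (n, m, s) := p in
  - (T / 2) + (-1) ^+ s *
    Num.sqrt ((1 + n%:R) ^+ 2 + m%:~R ^+ 2 * N%:R ^+ 2 * (T ^- 2 - 1)).

Definition eigenvalue2 N T (m : nat) : R := - (T / 2) - m%:R * N%:R / T.

Definition params1 N T lambda : set (nat * int * bool) :=
  [set p | admissible N p.1.1 p.1.2 /\ (eigenvalue1 N T p)%:C = lambda].

Definition params2 N T lambda : set nat :=
  [set m | (eigenvalue2 N T m)%:C = lambda].

Definition spectral_multiplicity N T lambda : nat :=
  (\big[addn/0]_(p \in params1 N T lambda) (p.1.1).+1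
   + \big[addn/0]_(m \in params2 N T lambda) (2 * m * N))%N.

End Spectrum.

(* Main.v *)
From HB Require Import structures.
Require Import Defs.
From mathcomp Require Import all_boot all_order all_algebra.
From mathcomp Require Import complex spectral.
From mathcomp Require Import all_classical all_reals all_analysis.
From mathcomp Require Import ring lra zify.

Set Implicit Arguments.
Unset Strict Implicit.
Unset Printing Implicit Defensive.

Import Order.TTheory GRing.Theory Num.Theory.
Import numFieldNormedType.Exports.

Local Open Scope classical_set_scope.
Local Open Scope complex_scope.
Local Open Scope sesquilinear_scope.
Local Open Scope ring_scope.

(* Split a spinor into its Fourier components under the right flow of I. On the
   component of weights (k - 1, k + 1) the Dirac equation becomes A h = a f,
   B f = b h, where a, b = lambda + T/2 +- k/T and A = d_J + i d_K, B = - d_J + i d_K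
   lower and raise the weight by 2; a nonzero component satisfying the
   equivariance condition forces k = m N.
   Hence AB f = ab f. As AB is, up to a shift, the sub-Laplacian
   - d_J^2 - d_K^2, a maximum principle bounds the weights occurring for a given
   eigenvalue, so B^j f is a highest weight vector for some j. Such vectors are
   the homogeneous polynomials of degree n in the first column of the matrix g,
   so f ranges over the (n + 1)-dimensional space A^j(polynomials), and
   ab = (n + 1)^2 - k^2 is the equation for lambda of the first family. The case
   ab = 0, in which one of f, h vanishes and the other one is extremal, gives the
   second family. Neither the Haar measure nor the Peter-Weyl theorem is needed. *)

(** * Quaternionic coordinates and one-parameter subgroups *)

(** [smooth] only provides iterated limits along left-invariant fields; linearity of the derivative
    in X and the relation between mixed derivatives are not part of it. Both are derived from
    one-variable calculus along the subgroups exp(tX) of the unit quaternions: linearity by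
    Trotter's product formula, the bracket relations [X, Y] = 2Z by moving one flow past another and
    exchanging mixed derivatives. Averaging over the circle uses the same linearity, since a
    derivative moved past the flow of I becomes a rotated one. Self-adjointness is never invoked:
    [lambda] is complex, and its reality comes out of the equations for a and b. For fixed [lambda]
    each weight k carries at most one case: (n + 1)^2 = ab + k^2 determines n, and a nonzero square
    root determines the sign, so the multiplicities of distinct parameters add. The 2mN of the
    second family is mN at k = mN, where a = 0 and f is a polynomial of degree mN - 1, plus mN at k
    = - mN, where b = 0 and h is a lowest weight vector. As N is odd, k = mN and m have equal
    parity, which turns the parity conditions into k - 1 = n - 2j. *)

HB.lock Definition q0 (R : realType) (g : SU2 R) : R := complex.Re (SU2val g 0 0).
HB.lock Definition q1 (R : realType) (g : SU2 R) : R := complex.Im (SU2val g 0 0).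
HB.lock Definition q2 (R : realType) (g : SU2 R) : R := complex.Re (SU2val g 0 1).
HB.lock Definition q3 (R : realType) (g : SU2 R) : R := complex.Im (SU2val g 0 1).

HB.lock Definition su2v (R : realType) (a b c : R) : 'M[R[i]]_2 :=
  a%:C *: mxI R + b%:C *: mxJ R + c%:C *: mxK R.

HB.lock Definition flow (R : realType) (X : 'M[R[i]]_2) (t : R) : SU2 R :=
  expSU2 (t%:C *: X).

Section Quaternions.
Variable R : realType.
Local Notation C := R[i].
Local Notation G := (SU2 R).
Implicit Types (g h k : G) (a b c r s t u v w : R).

(** In SU(2) the inverse is both the conjugate transpose and the adjugate, so the upper row
    determines the lower one. *)
Lemma SU2valE g : SU2val g =
  mx22 (q0 g +i* q1 g) (q2 g +i* q3 g) (- q2 g +i* q3 g) (q0 g +i* - q1 g).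
Proof.
rewrite q0.unlock q1.unlock q2.unlock q3.unlock; case: g => M /= /andP[/unitarymxP MU /eqP].
rewrite det_mx22.
have := congr1 (fun A : 'M[C]_2 => A 0 0) MU.
have := congr1 (fun A : 'M[C]_2 => A 0 1) MU.
rewrite !mxE !big_ord_recl !big_ord0 !mxE /=.
have -> : lift ord0 ord0 = 1 :> 'I_2 by apply/val_inj.
case e00 : (M 0 0) => [a0 a1]; case e01 : (M 0 1) => [b0 b1].
case e10 : (M 1 0) => [c0 c1]; case e11 : (M 1 1) => [d0 d1].
simpc => -[h1 h2] [h3 h4] [h5 h6].
(* Multiplying the orthogonality, norm and determinant relations by matrix entries supplies the
   monomials with which the lower row, times the squared norm 1 of the upper row, becomes a linear
   consequence. *)
have m (u v p q : R) : p = q -> u * p = u * q /\ v * p = v * q by move=> ->.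
have [h1a h1b] := m a0 a1 _ _ h1; have [h2a h2b] := m a0 a1 _ _ h2.
have [h1c h1d] := m b0 b1 _ _ h1; have [h2c h2d] := m b0 b1 _ _ h2.
have [h3a h3b] := m c0 c1 _ _ h3; have [h5a h5b] := m b0 b1 _ _ h5.
have [h3c h3d] := m d0 d1 _ _ h3; have [h5c h5d] := m a0 a1 _ _ h5.
have [h6a h6b] := m b0 b1 _ _ h6; have [h6c h6d] := m a0 a1 _ _ h6.
by apply: mx22P; rewrite !mxE /= ?e00 ?e01 ?e10 ?e11 //; congr (_ +i* _); lra.
Qed.

Lemma q_norm g : q0 g ^+ 2 + q1 g ^+ 2 + q2 g ^+ 2 + q3 g ^+ 2 = 1.
Proof.
have /andP[_ /eqP] := SU2_subproof g.
rewrite det_mx22 SU2valE !mxE /=; simpc => -[h _]; lra.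
Qed.

Lemma SU2_ext g h : q0 g = q0 h -> q1 g = q1 h -> q2 g = q2 h -> q3 g = q3 h ->
  g = h.
Proof.
by move=> e0 e1 e2 e3; apply/val_inj; rewrite /= [LHS]SU2valE [RHS]SU2valE e0 e1 e2 e3.
Qed.

(** Hamilton's product for q0 + q1 I + q2 J + q3 K, with IJ = K. *)
Lemma q_mul g h : [/\
  q0 (g * h)%g = q0 g * q0 h - q1 g * q1 h - q2 g * q2 h - q3 g * q3 h,
  q1 (g * h)%g = q0 g * q1 h + q1 g * q0 h + q2 g * q3 h - q3 g * q2 h,
  q2 (g * h)%g = q0 g * q2 h - q1 g * q3 h + q2 g * q0 h + q3 g * q1 h &
  q3 (g * h)%g = q0 g * q3 h + q1 g * q2 h - q2 g * q1 h + q3 g * q0 h].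
Proof.
have E i j : SU2val (g * h)%g i j = SU2val g i 0 * SU2val h 0 j + SU2val g i 1 * SU2val h 1 j.
  rewrite [SU2val _]/(SU2val g *m SU2val h) mxE !big_ord_recl big_ord0 addr0.
  by have -> : lift ord0 ord0 = 1 :> 'I_2 by apply/val_inj.
rewrite q0.unlock q1.unlock q2.unlock q3.unlock !E !(SU2valE g) !(SU2valE h) !mxE /=.
by split; ring.
Qed.

Lemma q_one : [/\ q0 (1%g : G) = 1, q1 (1%g : G) = 0, q2 (1%g : G) = 0 &
  q3 (1%g : G) = 0].
Proof. by rewrite q0.unlock q1.unlock q2.unlock q3.unlock /= !mxE. Qed.

Lemma mkq_subproof (a b c d : R) : a ^+ 2 + b ^+ 2 + c ^+ 2 + d ^+ 2 = 1 ->
  (mx22 (a +i* b) (c +i* d) (- c +i* d) (a +i* - b) \is unitarymx) &&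
  (\det (mx22 (a +i* b) (c +i* d) (- c +i* d) (a +i* - b)) == 1).
Proof. by move=> h; apply: mx22_SU2; lra. Qed.

Lemma flow_unit a b c t : a ^+ 2 + b ^+ 2 + c ^+ 2 = 1 ->
  [/\ q0 (flow (su2v a b c) t) = cos t, q1 (flow (su2v a b c) t) = sin t * a,
      q2 (flow (su2v a b c) t) = sin t * b & q3 (flow (su2v a b c) t) = sin t * c].
Proof.
move=> h; rewrite q0.unlock q1.unlock q2.unlock q3.unlock flow.unlock su2v.unlock expSU2E; last exact/su2Z/su2_comb.
rewrite expmx_unit; first by rewrite mx_combE !mxE /=; simpc; split=> //=; ring.
rewrite mx_combE; apply: mx22P; rewrite !mxE !big_ord_recl big_ord0 !mxE /=; simpc;
 apply/eqP; rewrite eq_complex /=; apply/andP; split; apply/eqP => /=; try ring; lra.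
Qed.

Lemma su2v_polar (a b c : R) : exists r u v w : R, [/\ u ^+ 2 + v ^+ 2 + w ^+ 2 = 1,
  a = r * u, b = r * v & c = r * w].
Proof.
pose r := Num.sqrt (a ^+ 2 + b ^+ 2 + c ^+ 2).
have s0 : 0 <= a ^+ 2 + b ^+ 2 + c ^+ 2 by rewrite !addr_ge0 ?sqr_ge0.
have r2 : r ^+ 2 = a ^+ 2 + b ^+ 2 + c ^+ 2 by rewrite sqr_sqrtr.
have [r0|rN0] := eqVneq r 0.
  have : a ^+ 2 + b ^+ 2 + c ^+ 2 == 0 by rewrite -r2 r0 expr0n.
  rewrite !paddr_eq0 ?addr_ge0 ?sqr_ge0 // !sqrf_eq0.
  move=> /andP[/andP[/eqP -> /eqP ->] /eqP ->].
  by exists 0, 1, 0, 0; rewrite !mul0r !expr0n /= expr1n !addr0.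
exists r, (a / r), (b / r), (c / r).
split; [|by field..].
by rewrite !expr_div_n -!mulrDl -r2 divff ?expf_neq0.
Qed.

Lemma su2vZ t a b c : t%:C *: su2v a b c = su2v (t * a) (t * b) (t * c).
Proof. by rewrite su2v.unlock !scalerDr !scalerA -!rmorphM. Qed.

Lemma sphereE (u v w : R) : u ^+ 2 + v ^+ 2 + w ^+ 2 = 1 ->
  u ^+ 2 = 1 - v ^+ 2 - w ^+ 2.
Proof. by move=> h; lra. Qed.

(** The exponential is an explicit cosine and sine only on unit vectors of su(2). A general flow is
    a unit flow run at speed r; for the zero vector r = 0 and the direction is arbitrary. *)
Lemma flow_polar a b c : exists r u v w : R, [/\ u ^+ 2 + v ^+ 2 + w ^+ 2 = 1,
  a = r * u, b = r * v, c = r * w &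
  forall t, flow (su2v a b c) t = flow (su2v u v w) (r * t)].
Proof.
have [r [u [v [w [h -> -> ->]]]]] := su2v_polar a b c.
exists r, u, v, w; split; [exact: h|by []..|move=> t].
by rewrite flow.unlock !su2vZ !mulrA [t * r]mulrC.
Qed.

Lemma flowD_unit u v w s t : u ^+ 2 + v ^+ 2 + w ^+ 2 = 1 ->
  flow (su2v u v w) (s + t) = (flow (su2v u v w) s * flow (su2v u v w) t)%g.
Proof.
move=> h; have h' := sphereE h.
have [a0 a1 a2 a3] := flow_unit (s + t) h.
have [b0 b1 b2 b3] := flow_unit s h; have [c0 c1 c2 c3] := flow_unit t h.
have [d0 d1 d2 d3] := q_mul (flow (su2v u v w) s) (flow (su2v u v w) t).
apply: SU2_ext.
- by rewrite a0 d0 b0 b1 b2 b3 c0 c1 c2 c3 cosD; ring: h'.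
- by rewrite a1 d1 b0 b1 b2 b3 c0 c1 c2 c3 sinD; ring: h'.
- by rewrite a2 d2 b0 b1 b2 b3 c0 c1 c2 c3 sinD; ring: h'.
- by rewrite a3 d3 b0 b1 b2 b3 c0 c1 c2 c3 sinD; ring: h'.
Qed.

Lemma flowD a b c s t :
  flow (su2v a b c) (s + t) = (flow (su2v a b c) s * flow (su2v a b c) t)%g.
Proof.
have [r [u [v [w [h _ _ _ E]]]]] := flow_polar a b c.
by rewrite (E (s + t)) (E s) (E t) mulrDr flowD_unit.
Qed.

Lemma flow0 a b c : flow (su2v a b c) 0 = 1%g.
Proof.
have [r [u [v [w [h _ _ _ E]]]]] := flow_polar a b c; rewrite (E 0) mulr0.
have [a0 a1 a2 a3] := flow_unit 0 h.
by have [b0 b1 b2 b3] := q_one; apply: SU2_ext;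
  rewrite (a0, a1, a2, a3) (b0, b1, b2, b3) ?cos0 ?sin0 ?mul0r.
Qed.

End Quaternions.

(** * The topology of SU(2) in quaternionic coordinates, and compactness *)

Section Topology.
Variable R : realType.
Local Notation C := R[i].
Local Notation G := (SU2 R).
Implicit Types (g h k : G) (a b c r s t u v w : R).

(** The l1 distance of the coordinates. It is not translation invariant, but translations on either
    side distort it by a factor of at most 4, which is enough for every estimate below. *)
Definition dist4 g h : R :=
  `|q0 g - q0 h| + `|q1 g - q1 h| + `|q2 g - q2 h| + `|q3 g - q3 h|.

Lemma complex_norm_le (z : C) : `|z| <= (`|complex.Re z| + `|complex.Im z|)%:C.
Proof.
case: z => a b /=; rewrite normc_def /= lecR.
rewrite -[leRHS]ger0_norm ?addr_ge0 // -sqrtr_sqr ler_wsqrtr //.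
rewrite -(real_normK (num_real a)) -(real_normK (num_real b)).
by rewrite sqrrD lerD2r lerDl mulrn_wge0 // mulr_ge0.
Qed.

Lemma Re_norm_le (z : C) : (`|complex.Re z|)%:C <= `|z|.
Proof.
case: z => a b /=; rewrite normc_def /= lecR -sqrtr_sqr ler_wsqrtr //.
by rewrite lerDl sqr_ge0.
Qed.

Lemma Im_norm_le (z : C) : (`|complex.Im z|)%:C <= `|z|.
Proof.
case: z => a b /=; rewrite normc_def /= lecR -sqrtr_sqr ler_wsqrtr //.
by rewrite lerDr sqr_ge0.
Qed.

Lemma ord2 (i : 'I_2) : i = 0 \/ i = 1.
Proof. by case: i => [[|[|k]] lk] //; [left|right]; apply/val_inj. Qed.

Lemma norm_le_dist4 g h i j :
  `|SU2val g i j - SU2val h i j| <= (dist4 g h)%:C.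
Proof.
apply: le_trans (complex_norm_le _) _; rewrite lecR /dist4 !SU2valE !mxE.
have [A0 A1 A2 A3] := And4 (normr_ge0 (q0 g - q0 h)) (normr_ge0 (q1 g - q1 h))
  (normr_ge0 (q2 g - q2 h)) (normr_ge0 (q3 g - q3 h)).
have B1 := distrC (- q1 g) (- q1 h); have B2 := distrC (- q2 g) (- q2 h).
have E1 : - q1 h - - q1 g = q1 g - q1 h by ring.
have E2 : - q2 h - - q2 g = q2 g - q2 h by ring.
rewrite E1 in B1; rewrite E2 in B2.
case: (ord2 i) => ->; case: (ord2 j) => -> /=; rewrite ?B1 ?B2.
all: move: A0 A1 A2 A3; move: `|_| `|_| `|_| `|_| => z0 z1 z2 z3; lra.
Qed.

Lemma dist4_le_norm g h :
  (dist4 g h)%:C <= (`|SU2val g 0 0 - SU2val h 0 0| +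
                    `|SU2val g 0 1 - SU2val h 0 1|) *+ 2.
Proof.
rewrite /dist4 2!raddfD raddfD mulr2n /=.
have Rr (z w : C) : complex.Re (z - w) = complex.Re z - complex.Re w.
  by case: z w => ? ? [].
have Ir (z w : C) : complex.Im (z - w) = complex.Im z - complex.Im w.
  by case: z w => ? ? [].
rewrite q0.unlock q1.unlock q2.unlock q3.unlock -!Rr -!Ir.
have := Re_norm_le (SU2val g 0 0 - SU2val h 0 0).
have := Im_norm_le (SU2val g 0 0 - SU2val h 0 0).
have := Re_norm_le (SU2val g 0 1 - SU2val h 0 1).
have := Im_norm_le (SU2val g 0 1 - SU2val h 0 1).
move=> h1 h2 h3 h4; apply: le_trans (lerD (lerD (lerD h4 h3) h2) h1) _.
by rewrite le_eqVlt; apply/orP; left; apply/eqP; ring.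
Qed.

Lemma pos_complexE (e : C) : 0 < e -> exists2 r : R, 0 < r & e = r%:C.
Proof.
by case: e => x y; rewrite ltcE /= => /andP[/eqP -> x0]; exists x.
Qed.

(** Replaces the initial topology, whose balls have complex radii, by estimates with real radii:
    matrix entries and coordinates bound each other. In the converse, two entries closer than e/4,
    doubled by [dist4_le_norm], give e. *)
Lemma nbhs_dist4 g (A : set G) : nbhs g A <->
  exists2 e : R, 0 < e & forall h, dist4 g h < e -> A h.
Proof.
split.
  rewrite nbhsE => -[B [[U Uop] UB Bg] BA].
  have Ug : U (SU2val g) by move: Bg; rewrite -UB.
  have /nbhs_ballP[e e0 eU] : nbhs (SU2val g) U by exact: open_nbhs_nbhs.
  have [r r0 eE] := pos_complexE e0; exists r => // h hg.
  apply: BA; rewrite -UB; apply: eU; split => // i j.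
  rewrite -ball_normE /=; apply: le_lt_trans (norm_le_dist4 _ _ _ _) _.
  by rewrite eE ltcR.
move=> [e e0 eA].
have H : nbhs (SU2val g) (ball (SU2val g) ((e / 4)%:C : C)).
  by apply: nbhsx_ballx; rewrite ltcR divr_gt0.
move: H; rewrite nbhsE => -[U [Uop Ug] UB].
rewrite nbhsE; exists (@SU2val R @^-1` U).
  by split; [exists U|exact: Ug].
move=> h /UB [_ gh].
apply: eA; rewrite -ltcR; apply: le_lt_trans (dist4_le_norm _ _) _.
have := gh 0 0; have := gh 0 1; rewrite -!ball_normE /= => h1 h2.
have -> : e%:C = ((e / 4)%:C + (e / 4)%:C) *+ 2.
  by rewrite -raddfD -rmorphMn /= mulr2n; congr (_ +i* _); field.
by rewrite ltrMn2r ltrD.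
Qed.

Lemma continuousGP (f : G -> R) : continuous f <->
  forall g e, 0 < e -> exists2 d : R, 0 < d &
    forall h, dist4 g h < d -> `|f g - f h| < e.
Proof.
split=> [cf g e e0|H g].
  have /cvgrPdist_lt/(_ e e0) /nbhs_dist4[d d0 H] := cf g.
  by exists d.
by apply/(@cvgrPdist_lt _ _ _ _ (nbhs_filter g)) => e e0; apply/nbhs_dist4; exact: H.
Qed.

Lemma dist4_sym g h : dist4 g h = dist4 h g.
Proof.
by rewrite /dist4 (distrC (q0 g)) (distrC (q1 g)) (distrC (q2 g)) (distrC (q3 g)).
Qed.

Lemma dist4_trans h g k : dist4 g k <= dist4 g h + dist4 h k.
Proof.
rewrite /dist4.
have := ler_distD (q0 h) (q0 g) (q0 k); have := ler_distD (q1 h) (q1 g) (q1 k).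
have := ler_distD (q2 h) (q2 g) (q2 k); have := ler_distD (q3 h) (q3 g) (q3 k).
lra.
Qed.

Lemma q_le1 g : [/\ `|q0 g| <= 1, `|q1 g| <= 1, `|q2 g| <= 1 & `|q3 g| <= 1].
Proof.
have h := q_norm g.
have N (x : R) : x ^+ 2 <= 1 -> `|x| <= 1.
  by rewrite -(real_normK (num_real x)) expr_le1.
by split; apply: N; nra.
Qed.

Lemma norm_comb4 (x1 x2 x3 x4 y1 y2 y3 y4 : R) :
  `|x1| <= 1 -> `|x2| <= 1 -> `|x3| <= 1 -> `|x4| <= 1 ->
  `|x1 * y1 + x2 * y2 + x3 * y3 + x4 * y4| <= `|y1| + `|y2| + `|y3| + `|y4|.
Proof.
move=> h1 h2 h3 h4.
have M (x y : R) : `|x| <= 1 -> `|x * y| <= `|y|.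
  by move=> hx; rewrite normrM ler_piMl.
have := ler_normD (x1 * y1 + x2 * y2 + x3 * y3) (x4 * y4).
have := ler_normD (x1 * y1 + x2 * y2) (x3 * y3).
have := ler_normD (x1 * y1) (x2 * y2).
have := M _ y1 h1; have := M _ y2 h2; have := M _ y3 h3; have := M _ y4 h4.
lra.
Qed.

(** Each coordinate of k(g - h) is a combination of those of g - h with coefficients of absolute
    value at most 1, hence at most [dist4 g h]; there are four of them. *)
Lemma dist4_mull k g h : dist4 (k * g)%g (k * h)%g <= 4 * dist4 g h.
Proof.
have [a0 a1 a2 a3] := q_mul k g; have [b0 b1 b2 b3] := q_mul k h.
have [k0 k1 k2 k3] := q_le1 k.
have Nk (x : R) : `|x| <= 1 -> `|- x| <= 1 by rewrite normrN.
rewrite /dist4 a0 a1 a2 a3 b0 b1 b2 b3.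
set d0 := q0 g - q0 h; set d1 := q1 g - q1 h.
set d2 := q2 g - q2 h; set d3 := q3 g - q3 h.
have := norm_comb4 d0 d1 d2 d3 k0 (Nk _ k1) (Nk _ k2) (Nk _ k3).
have := norm_comb4 d1 d0 d3 d2 k0 k1 k2 (Nk _ k3).
have := norm_comb4 d2 d3 d0 d1 k0 (Nk _ k1) k2 k3.
have := norm_comb4 d3 d2 d1 d0 k0 k1 (Nk _ k2) k3.
have -> : q0 k * d3 + q1 k * d2 + - q2 k * d1 + q3 k * d0 =
  q0 k * q3 g + q1 k * q2 g - q2 k * q1 g + q3 k * q0 g -
  (q0 k * q3 h + q1 k * q2 h - q2 k * q1 h + q3 k * q0 h) by rewrite /d0 /d1 /d2 /d3; ring.
have -> : q0 k * d2 + - q1 k * d3 + q2 k * d0 + q3 k * d1 =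
  q0 k * q2 g - q1 k * q3 g + q2 k * q0 g + q3 k * q1 g -
  (q0 k * q2 h - q1 k * q3 h + q2 k * q0 h + q3 k * q1 h) by rewrite /d0 /d1 /d2 /d3; ring.
have -> : q0 k * d1 + q1 k * d0 + q2 k * d3 + - q3 k * d2 =
  q0 k * q1 g + q1 k * q0 g + q2 k * q3 g - q3 k * q2 g -
  (q0 k * q1 h + q1 k * q0 h + q2 k * q3 h - q3 k * q2 h) by rewrite /d0 /d1 /d2 /d3; ring.
have -> : q0 k * d0 + - q1 k * d1 + - q2 k * d2 + - q3 k * d3 =
  q0 k * q0 g - q1 k * q1 g - q2 k * q2 g - q3 k * q3 g -
  (q0 k * q0 h - q1 k * q1 h - q2 k * q2 h - q3 k * q3 h) by rewrite /d0 /d1 /d2 /d3; ring.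
move: `|_ - _| `|_ - _| `|_ - _| `|_ - _| `|d0| `|d1| `|d2| `|d3| => z0 z1 z2 z3 e0 e1 e2 e3.
lra.
Qed.

Lemma q_mkq a b c t (h : a ^+ 2 + b ^+ 2 + c ^+ 2 + t ^+ 2 = 1) :
  let k := MkSU2 (mkq_subproof h) in
  [/\ q0 k = a, q1 k = b, q2 k = c & q3 k = t].
Proof. by rewrite q0.unlock q1.unlock q2.unlock q3.unlock /= !mxE. Qed.

Lemma q_inv g : [/\ q0 (g^-1)%g = q0 g, q1 (g^-1)%g = - q1 g,
  q2 (g^-1)%g = - q2 g & q3 (g^-1)%g = - q3 g].
Proof.
have h : q0 g ^+ 2 + (- q1 g) ^+ 2 + (- q2 g) ^+ 2 + (- q3 g) ^+ 2 = 1.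
  by have := q_norm g; lra.
pose k := MkSU2 (mkq_subproof h).
have [k0 k1 k2 k3] : [/\ q0 k = q0 g, q1 k = - q1 g, q2 k = - q2 g & q3 k = - q3 g].
  exact: q_mkq.
have [m0 m1 m2 m3] := q_mul g k; have [e0 e1 e2 e3] := q_one R.
have gk : (g * k = 1)%g.
  apply: SU2_ext; rewrite (m0, m1, m2, m3) (e0, e1, e2, e3) k0 k1 k2 k3; last 3 first.
  - by ring.
  - by ring.
  - by ring.
  - by rewrite -[RHS](q_norm g); ring.
have -> : (g^-1 = k)%g by rewrite -[RHS]mul1g -(mulVg g) -mulgA gk mulg1.
by [].
Qed.

Lemma dist4_inv g h : dist4 (g^-1)%g (h^-1)%g = dist4 g h.
Proof.
have [a0 a1 a2 a3] := q_inv g; have [b0 b1 b2 b3] := q_inv h.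
have N (x y : R) : `|- x - - y| = `|x - y| by rewrite opprK addrC distrC.
by rewrite /dist4 a0 a1 a2 a3 b0 b1 b2 b3 !N.
Qed.

Lemma dist4_mulr k g h : dist4 (g * k)%g (h * k)%g <= 4 * dist4 g h.
Proof. by rewrite -dist4_inv !invgM -(dist4_inv g); exact: dist4_mull. Qed.

(** The group is the continuous image of the unit sphere of R^4, which is closed and bounded. *)
Lemma compact_SU2 : compact [set: G].
Proof.
pose P (v : 'rV[R]_4) : R := v 0 (inord 0) ^+ 2 + v 0 (inord 1) ^+ 2
  + v 0 (inord 2) ^+ 2 + v 0 (inord 3) ^+ 2.
pose S := [set v : 'rV[R]_4 | P v = 1].
(* Off the sphere the value 1 is a mere default; continuity is only claimed within the sphere. *)
pose F (v : 'rV[R]_4) : G := if pselect (P v = 1) is left h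
  then MkSU2 (mkq_subproof h) else 1%g.
have FE (v : 'rV[R]_4) : S v -> [/\ q0 (F v) = v 0 (inord 0), q1 (F v) = v 0 (inord 1),
    q2 (F v) = v 0 (inord 2) & q3 (F v) = v 0 (inord 3)].
  by move=> Sv; rewrite /F; case: pselect => // h; exact: q_mkq.
have Pc : continuous P.
  have X i : continuous (fun v : 'rV[R]_4 => v 0 i ^+ 2).
    move=> v; apply: (@continuous_comp _ _ _ (fun v : 'rV[R]_4 => v 0 i) (fun x : R => x ^+ 2)).
      exact: coord_continuous.
    exact: exprn_continuous.
  by move=> v; rewrite /P; exact: (cvgD (cvgD (cvgD (X _ v) (X _ v)) (X _ v)) (X _ v)).
have Sc : compact S.
  apply: bounded_closed_compact.
    exists 1; split; first exact: num_real.
    move=> M M1 v Sv; apply: le_trans (ltW M1).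
    rewrite [leLHS]/Num.Def.normr /= mx_normrE; apply/bigmax_leP; split => //= -[i j] _ /=.
    rewrite (ord1 i).
    have [n0 n1 n2 n3] := q_le1 (F v); have [e0 e1 e2 e3] := FE v Sv.
    case: j => -[|[|[|[|k]]]] // lj.
    - by rewrite -[Ordinal lj]inord_val -e0.
    - by rewrite -[Ordinal lj]inord_val -e1.
    - by rewrite -[Ordinal lj]inord_val -e2.
    - by rewrite -[Ordinal lj]inord_val -e3.
  have -> : S = P @^-1` [set 1] by [].
  by apply: closed_comp => // v _; exact: Pc.
have -> : [set: G] = F @` S.
  apply/esym/seteqP; split=> // g _.
  pose v : 'rV[R]_4 := \row_i tnth [tuple q0 g; q1 g; q2 g; q3 g] i.
  have vE : [/\ v 0 (inord 0) = q0 g, v 0 (inord 1) = q1 g,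
    v 0 (inord 2) = q2 g & v 0 (inord 3) = q3 g].
    by rewrite /v !mxE !(tnth_nth 0) !inordK.
  have Sv : S v by have [v0 v1 v2 v3] := vE; rewrite /S /P /= v0 v1 v2 v3 q_norm.
  exists v => //; have [e0 e1 e2 e3] := FE v Sv; have [v0 v1 v2 v3] := vE.
  by apply: SU2_ext; rewrite ?e0 ?e1 ?e2 ?e3.
apply: continuous_compact Sc.
apply/subspace_continuousP => v Sv A /nbhs_dist4[e e0 eA].
have e40 : 0 < e / 4 by rewrite divr_gt0.
have H i : nbhs v (fun w : 'rV[R]_4 => `|(v : 'rV[R]_4) 0 i - w 0 i| < e / 4).
  have /cvgrPdist_lt/(_ _ e40) := @coord_continuous _ _ _ 0 i v; exact.
change (nbhs v (fun w : 'rV[R]_4 => S w -> A (F w))); near=> w.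
move=> Sw.
have [v0 v1 v2 v3] := FE v Sv; have [w0 w1 w2 w3] := FE w Sw.
apply: eA; rewrite /dist4 v0 v1 v2 v3 w0 w1 w2 w3.
have h0 : `|v 0 (inord 0) - w 0 (inord 0)| < e / 4 by near: w; exact: H.
have h1 : `|v 0 (inord 1) - w 0 (inord 1)| < e / 4 by near: w; exact: H.
have h2 : `|v 0 (inord 2) - w 0 (inord 2)| < e / 4 by near: w; exact: H.
have h3 : `|v 0 (inord 3) - w 0 (inord 3)| < e / 4 by near: w; exact: H.
move: h0 h1 h2 h3; move: `|_| `|_| `|_| `|_| => z0 z1 z2 z3; lra.
Unshelve. all: by end_near. Qed.

Lemma SU2_max (f : G -> R) : continuous f -> exists g0, forall g, f g <= f g0.
Proof.
move=> cf.
have [| |g0 _ H] := @compact_EVT_max _ _ f [set: G] _ compact_SU2.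
- by exists 1%g.
- exact: continuous_subspaceT.
- by exists g0 => g; apply: H; rewrite inE.
Qed.

Lemma SU2_bounded (f : G -> R) : continuous f -> exists2 M : R, 0 <= M & forall g, `|f g| <= M.
Proof.
move=> cf; have [|g0 H] := @SU2_max (fun g => `|f g|).
  apply/continuousGP => g e e0; have [d d0 H] := (continuousGP f).1 cf g e e0.
  by exists d => // h hd; apply: le_lt_trans (ler_dist_dist _ _) (H h hd).
by exists `|f g0|.
Qed.

Lemma MVT_sym (f df : R -> R) a b : (forall x : R, is_derive x 1 f (df x)) ->
  exists2 c : R, `|c - a| <= `|b - a| & f b - f a = df c * (b - a).
Proof.
move=> D.
have cf (x y : R) : {within `[x, y], continuous f}.
  apply: derivable_within_continuous => z _; exact: ex_derive.
have [ab|ba] := leP a b.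
  have [c] := MVT_segment ab (fun x _ => D x) (cf a b).
  rewrite in_itv /= => /andP[ac cb] E; exists c => //.
  by rewrite !ger0_norm ?subr_ge0 // lerD2r.
have [c] := MVT_segment (ltW ba) (fun x _ => D x) (cf b a).
rewrite in_itv /= => /andP[bc ca] E; exists c.
  by rewrite !ler0_norm ?subr_le0 ?(ltW ba) // lerN2 lerD2r.
by rewrite -opprB E -mulrN opprB.
Qed.

Lemma sin_abs_le t : `|sin t| <= `|t|.
Proof.
have [c _] := @MVT_sym sin cos 0 t (fun x => is_derive_sin x).
rewrite sin0 !subr0 => ->; rewrite normrM ler_piMl //.
by rewrite ler_norml cos_geN1 cos_le1.
Qed.

Lemma cos_abs_le t : `|1 - cos t| <= `|t|.
Proof.
have [c _] := @MVT_sym cos (- sin) 0 t (fun x => is_derive_cos x).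
rewrite cos0 distrC subr0 => ->; rewrite normrM ler_piMl //= normrN.
by rewrite ler_norml sin_geN1 sin_le1.
Qed.

Lemma flow_lip a b c : exists2 L : R, 0 <= L &
  forall t, dist4 1%g (flow (su2v a b c) t) <= L * `|t|.
Proof.
have [r [u [v [w [h _ _ _ E]]]]] := flow_polar a b c.
exists (`|r| * 4); first by rewrite mulr_ge0.
move=> t; rewrite (E t); have [e0 e1 e2 e3] := q_one R.
have [a0 a1 a2 a3] := flow_unit (r * t) h.
rewrite /dist4 e0 e1 e2 e3 a0 a1 a2 a3 !sub0r !normrN.
have N (x : R) : x ^+ 2 <= 1 -> `|sin (r * t) * x| <= `|r * t|.
  rewrite -(real_normK (num_real x)) expr_le1 // => x1.
  rewrite normrM; apply: le_trans (sin_abs_le _).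
  by rewrite ler_piMr.
have := cos_abs_le (r * t).
have /N : u ^+ 2 <= 1 by nra.
have /N : v ^+ 2 <= 1 by nra.
have /N : w ^+ 2 <= 1 by nra.
rewrite [`|r * t|]normrM -mulrA [4 * _]mulrC mulrA.
move: (`|r| * `|t|) `|1 - _| `|_ * u| `|_ * v| `|_ * w| => y z0 z1 z2 z3; lra.
Qed.

End Topology.

(** * Differentiation along one-parameter subgroups and Trotter's formula *)

Section RealCalculus.
Variable R : realType.
Local Notation C := R[i].
Local Notation G := (SU2 R).
Implicit Types (g h k : G) (a b c r s t u v w : R).

(** A first-order expansion in which the increment t = 0 is allowed, so that rescaling the time by a
    factor that may be 0 needs no case distinction. *)
Lemma is_derive_eps (f : R -> R) (x l : R) : is_derive x 1 f l <->
  forall e : R, 0 < e -> exists2 d : R, 0 < d &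
    forall t, `|t| < d -> `|f (x + t) - f x - t * l| <= e * `|t|.
Proof.
split=> [D e e0|H].
  have := @ex_derive _ _ _ _ _ _ _ D; have := @derive_val _ _ _ _ _ _ _ D.
  rewrite /derive /derivable => <- /cvgrPdist_le/(_ e e0) [d /= d0 Hd].
  exists d => // t td; have [->|t0] := eqVneq t 0.
    by rewrite addr0 subrr mul0r subrr normr0 mulr0.
  have := Hd t; rewrite /= sub0r normrN => /(_ td t0).
  rewrite scaler1 distrC [t + x]addrC -(ler_pM2r (_ : 0 < `|t|)) ?normr_gt0 //.
  rewrite -normrM mulrBl [_ *: _]mulrC mulfVK // [_ * t]mulrC //.
have cv : h^-1 *: (f (h *: 1 + x) - f x) @[h --> 0^'] --> l.
  apply/cvgrPdist_le => e e0; have [d d0 Hd] := H e e0.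
  exists d => // t; rewrite /= sub0r normrN => td t0.
  have := Hd t td; rewrite -(ler_pM2r (_ : 0 < `|t|^-1)) ?invr_gt0 ?normr_gt0 //.
  rewrite mulfK ?normr_eq0 // -normfV -normrM mulrBl [t * l * _]mulrAC mulfV // mul1r.
  by rewrite distrC scaler1 [t + x]addrC [_ *: _]mulrC.
by split; [apply/cvg_ex; exists l|exact: cvg_lim].
Qed.

(** Since flows are one-parameter groups, the derivative at time t along an orbit is the derivative
    at time 0 from the point reached. *)
Lemma is_derive_flow (f f' : G -> R) a b c :
  (forall g, is_derive (0 : R) 1 (fun t => f (g * flow (su2v a b c) t)%g) (f' g)) ->
  forall g t, is_derive t 1 (fun t => f (g * flow (su2v a b c) t)%g)
    (f' (g * flow (su2v a b c) t)%g).
Proof.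
move=> H g t; apply/is_derive_eps => e e0.
have /is_derive_eps/(_ e e0)[d d0 Hd] := H (g * flow (su2v a b c) t)%g.
exists d => // s /Hd; rewrite add0r flow0 mulg1.
by rewrite flowD mulgA.
Qed.

Lemma is_derive_flow0 a b c : let X := su2v a b c in
  [/\ is_derive (0 : R) 1 (fun t => q0 (flow X t)) 0,
      is_derive (0 : R) 1 (fun t => q1 (flow X t)) a,
      is_derive (0 : R) 1 (fun t => q2 (flow X t)) b &
      is_derive (0 : R) 1 (fun t => q3 (flow X t)) c].
Proof.
move=> X; rewrite /X; have [r [u [v [w [h -> -> -> E]]]]] := flow_polar a b c.
have S x : is_derive (0 : R) 1 (fun t => sin (r * t) * x) (r * x).
  by apply: is_derive_eq; rewrite mulr0 cos0 /GRing.scale /=; ring.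
have C0 : is_derive (0 : R) 1 (fun t => cos (r * t)) 0.
  by apply: is_derive_eq; rewrite mulr0 sin0 /GRing.scale /=; ring.
split; [move: C0|move: (S u)|move: (S v)|move: (S w)]; congr is_derive;
  by apply/funext => t; have [] := flow_unit (r * t) h; rewrite (E t).
Qed.

Section Trotter.
Variables (a1 b1 c1 a2 b2 c2 : R).
Let X1 := su2v a1 b1 c1.
Let X2 := su2v a2 b2 c2.
Let X3 := su2v (a1 + a2) (b1 + b2) (c1 + c2).

(** Both curves start at 1 with the same velocity, so they differ by o(t); each of the four
    coordinates gets a quarter of the error. *)
Lemma trotter_step (e : R) : 0 < e -> exists2 d : R, 0 < d &
  forall t, `|t| < d -> dist4 (flow X1 t * flow X2 t)%g (flow X3 t) <= e * `|t|.
Proof.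
move=> e0.
have [A0 A1 A2 A3] := is_derive_flow0 a1 b1 c1.
have [B0 B1 B2 B3] := is_derive_flow0 a2 b2 c2.
have [C0 C1 C2 C3] := is_derive_flow0 (a1 + a2) (b1 + b2) (c1 + c2).
have [i0 i1 i2 i3] := q_one R.
have K (q : G -> R) : q (1%g : G) = q (1%g : G) ->
   is_derive (0 : R) 1 (fun t => q (flow X1 t * flow X2 t)%g - q (flow X3 t)) 0 ->
   exists2 d : R, 0 < d & forall t, `|t| < d ->
     `|q (flow X1 t * flow X2 t)%g - q (flow X3 t)| <= e / 4 * `|t|.
  move=> _ /is_derive_eps/(_ (e / 4)); case; first by rewrite divr_gt0.
  move=> d d0 H; exists d => // t /H.
  by rewrite add0r mulr0 subr0 !flow0 mulg1 subrr subr0.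
have [||d0 d00 D0] := K (@q0 R); first by [].
  have -> : (fun t => q0 (flow X1 t * flow X2 t)%g - q0 (flow X3 t)) =
    (fun t => q0 (flow X1 t) * q0 (flow X2 t) - q1 (flow X1 t) * q1 (flow X2 t)
     - q2 (flow X1 t) * q2 (flow X2 t) - q3 (flow X1 t) * q3 (flow X2 t) - q0 (flow X3 t)).
    by apply/funext => t; have [->] := q_mul (flow X1 t) (flow X2 t).
  by apply: is_derive_eq; rewrite /X1 /X2 /X3 !flow0 ?i0 ?i1 ?i2 ?i3 /GRing.scale /=; ring.
have [||d1 d10 D1] := K (@q1 R); first by [].
  have -> : (fun t => q1 (flow X1 t * flow X2 t)%g - q1 (flow X3 t)) =
    (fun t => q0 (flow X1 t) * q1 (flow X2 t) + q1 (flow X1 t) * q0 (flow X2 t)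
     + q2 (flow X1 t) * q3 (flow X2 t) - q3 (flow X1 t) * q2 (flow X2 t) - q1 (flow X3 t)).
    by apply/funext => t; have [_ ->] := q_mul (flow X1 t) (flow X2 t).
  by apply: is_derive_eq; rewrite /X1 /X2 /X3 !flow0 ?i0 ?i1 ?i2 ?i3 /GRing.scale /=; ring.
have [||d2 d20 D2] := K (@q2 R); first by [].
  have -> : (fun t => q2 (flow X1 t * flow X2 t)%g - q2 (flow X3 t)) =
    (fun t => q0 (flow X1 t) * q2 (flow X2 t) - q1 (flow X1 t) * q3 (flow X2 t)
     + q2 (flow X1 t) * q0 (flow X2 t) + q3 (flow X1 t) * q1 (flow X2 t) - q2 (flow X3 t)).
    by apply/funext => t; have [_ _ ->] := q_mul (flow X1 t) (flow X2 t).
  by apply: is_derive_eq; rewrite /X1 /X2 /X3 !flow0 ?i0 ?i1 ?i2 ?i3 /GRing.scale /=; ring.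
have [||d3 d30 D3] := K (@q3 R); first by [].
  have -> : (fun t => q3 (flow X1 t * flow X2 t)%g - q3 (flow X3 t)) =
    (fun t => q0 (flow X1 t) * q3 (flow X2 t) + q1 (flow X1 t) * q2 (flow X2 t)
     - q2 (flow X1 t) * q1 (flow X2 t) + q3 (flow X1 t) * q0 (flow X2 t) - q3 (flow X3 t)).
    by apply/funext => t; have [_ _ _ ->] := q_mul (flow X1 t) (flow X2 t).
  by apply: is_derive_eq; rewrite /X1 /X2 /X3 !flow0 ?i0 ?i1 ?i2 ?i3 /GRing.scale /=; ring.
exists (Num.min (Num.min d0 d1) (Num.min d2 d3)); first by rewrite !lt_min d00 d10 d20 d30.
move=> t; rewrite !lt_min => /andP[/andP[/D0 t0 /D1 t1] /andP[/D2 t2 /D3 t3]].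
rewrite /dist4; apply: le_trans (lerD (lerD (lerD t0 t1) t2) t3) _.
by rewrite le_eqVlt; apply/orP; left; apply/eqP; field.
Qed.

(** Telescoping: the factors h are replaced by g one at a time, and the translations on the left and
    on the right of the replaced factor cost 4 each. *)
Lemma dist4_pow k h g n : dist4 (k * h ^+ n)%g (k * g ^+ n)%g <= n%:R * (16 * dist4 h g).
Proof.
elim: n k => [|n IH] k; first by rewrite !expg0 /dist4 !subrr !normr0 !addr0 mul0r.
rewrite !expgS !mulgA; apply: le_trans (dist4_trans (k * h * g ^+ n)%g _ _) _.
apply: le_trans (lerD (IH _) (dist4_mulr _ _ _)) _.
have := dist4_mull k h g; rewrite -natr1; lra.
Qed.

Variables (f f1 f2 : G -> R).
Hypothesis cf : continuous f.
Hypothesis cf1 : continuous f1.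
Hypothesis cf2 : continuous f2.
Hypothesis D1 : forall g, is_derive (0 : R) 1 (fun t => f (g * flow X1 t)%g) (f1 g).
Hypothesis D2 : forall g, is_derive (0 : R) 1 (fun t => f (g * flow X2 t)%g) (f2 g).

(* Along the polygonal path exp(tX1/n)exp(tX2/n)exp(tX1/n)... the increments of
   f are controlled by the mean value theorem, and the path converges to
   exp(t(X1+X2)) by Trotter's product formula. *)
Lemma is_derive_trotter g :
  is_derive (0 : R) 1 (fun t => f (g * flow X3 t)%g) (f1 g + f2 g).
Proof.
have [L1 L10 H1] := flow_lip a1 b1 c1; have [L2 L20 H2] := flow_lip a2 b2 c2.
pose L := L1 + L2 + 1.
have L0 : 0 < L by rewrite /L; lra.
have {}H1 t : dist4 1%g (flow X1 t) <= L * `|t|.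
  by apply: le_trans (H1 t) _; rewrite ler_wpM2r // /L; lra.
have {}H2 t : dist4 1%g (flow X2 t) <= L * `|t|.
  by apply: le_trans (H2 t) _; rewrite ler_wpM2r // /L; lra.
have N h k : dist4 1%g (h * k)%g <= dist4 1%g h + 4 * dist4 1%g k.
  apply: le_trans (dist4_trans h _ _) _; rewrite lerD2l.
  by have := dist4_mull h 1%g k; rewrite mulg1.
pose P t := (flow X1 t * flow X2 t)%g.
have NP t n : dist4 1%g (P t ^+ n)%g <= n%:R * (8 * L * `|t|).
  elim: n => [|n IH]; first by rewrite expg0 /dist4 !subrr normr0 !addr0 mul0r.
  rewrite expgSr /P mulgA; apply: le_trans (N _ _) _.
  have := N (P t ^+ n)%g (flow X1 t); have := H1 t; have := H2 t.
  by rewrite -natr1; rewrite /P in IH *; lra.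
apply/is_derive_eps => e e0.
have e30 : 0 < e / 3 by rewrite divr_gt0.
have [d1 d10 E1] := (continuousGP f1).1 cf1 g _ e30.
have [d2 d20 E2] := (continuousGP f2).1 cf2 g _ e30.
(* After k full steps and part of the next one the path is within (k + 1) 8L|tau| of 1, and
   translation by g costs another factor 4. The whole polygon thus stays within 32 L|t| of g, where
   f1 and f2 vary by less than e/3. *)
exists (Num.min d1 d2 / (32 * L)) => [|t].
  by rewrite divr_gt0 ?mulr_gt0 // lt_min d10 d20.
rewrite ltr_pdivlMr ?mulr_gt0 // => td.
rewrite add0r flow0 mulg1.
have [->|t0] := eqVneq t 0.
  by rewrite flow0 mulg1 mul0r !subrr normr0 mulr0.
have tpos : 0 < `|t| by rewrite normr_gt0.
have [d' d'0 E3] := (continuousGP f).1 cf (g * flow X3 t)%g _ (mulr_gt0 e30 tpos).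
(* With n steps of size tau = t/n the distance between the endpoints is at most 16 e'|t|, which is
   less than d' for this e'. The number of steps is chosen last, depending on t. *)
have e'0 : 0 < d' / (64 * (`|t| + 1)).
  by rewrite divr_gt0 // mulr_gt0 // addr_gt0.
have [d3 d30 E4] := trotter_step e'0.
have [n n0 tn] : exists2 n : nat, (0 < n)%N & `|t / n%:R| < d3.
  exists (Num.truncn (`|t| / d3)).+1 => //.
  rewrite normrM normfV normr_nat ltr_pdivrMr // mulrC -ltr_pdivrMr //.
  exact: truncnS_gt.
set tau := t / n%:R in tn.
have tE : t = n%:R * tau by rewrite /tau mulrCA mulfV ?mulr1 // pnatr_eq0 -lt0n.
have nt : `|t| = n%:R * `|tau| by rewrite tE normrM normr_nat.
clearbody tau.
have B3 : `|f (g * flow X3 t)%g - f (g * P tau ^+ n)%g| < e / 3 * `|t|.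
  apply: E3; rewrite dist4_sym.
  have -> : flow X3 t = (flow X3 tau ^+ n)%g.
    rewrite tE; elim: (n) => [|m IHm]; first by rewrite mul0r flow0 expg0.
    by rewrite expgSr -IHm -flowD -natr1 mulrDl mul1r.
  apply: le_lt_trans (dist4_pow _ _ _ _) _.
  have /E4 := tn.
  rewrite -/(P tau) => /(ler_wpM2l (_ : 0 <= n%:R * 16)) h.
  rewrite mulrA; apply: le_lt_trans (h _) _; first by rewrite mulr_ge0.
  have -> : n%:R * 16 * (d' / (64 * (`|t| + 1)) * `|tau|) =
    d' * (`|t| / (4 * (`|t| + 1))).
    by rewrite nt; field; rewrite -nt gt_eqF // addr_gt0.
  rewrite gtr_pMr // ltr_pdivrMr ?mul1r ?mulr_gt0 ?addr_gt0 //; lra.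
have step (k : nat) : (k <= n)%N ->
    `|f (g * P tau ^+ k)%g - f g - k%:R * tau * (f1 g + f2 g)|
      <= k%:R * (2 * (e / 3) * `|tau|).
  elim: k => [|k IH] kn.
    by rewrite expg0 mulg1 subrr !mul0r subrr normr0.
  have {}IH := IH (ltnW kn).
  have kn' : k%:R + 1 <= n%:R :> R by rewrite natr1 ler_nat.
  have bound j : dist4 1%g (P tau ^+ k * j)%g <= k%:R * (8 * L * `|tau|) + 8 * L * `|tau| ->
     dist4 g (g * (P tau ^+ k * j))%g < Num.min d1 d2.
    move=> hj; apply: le_lt_trans td.
    have := dist4_mull g 1%g (P tau ^+ k * j)%g; rewrite mulg1 => h.
    apply: le_trans h _; rewrite nt.
    have : (k%:R + 1) * (L * `|tau|) <= n%:R * (L * `|tau|).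
      by rewrite ler_wpM2r // mulr_ge0 // ltW.
    lra.
  have [x xt Ex] := @MVT_sym _ _ _ 0 tau (is_derive_flow D1 (g * P tau ^+ k)%g).
  have [y yt Ey] := @MVT_sym _ _ _ 0 tau (is_derive_flow D2 (g * P tau ^+ k * flow X1 tau)%g).
  rewrite !subr0 !flow0 !mulg1 in Ex Ey xt yt.
  have Fx : `|f1 g - f1 (g * P tau ^+ k * flow X1 x)%g| < e / 3.
    apply: E1; rewrite -mulgA; apply: lt_le_trans (bound _ _) _; last by rewrite ge_min lexx.
    have := N (P tau ^+ k)%g (flow X1 x); have := NP tau k; have := H1 x.
    have : L * `|x| <= L * `|tau| by rewrite ler_wpM2l // ltW.
    have : 0 <= L * `|tau| by rewrite mulr_ge0 // ltW.
    lra.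
  have Fy : `|f2 g - f2 (g * P tau ^+ k * flow X1 tau * flow X2 y)%g| < e / 3.
    apply: E2; rewrite -!mulgA; apply: lt_le_trans (bound _ _) _; last by rewrite ge_min lexx orbT.
    rewrite mulgA.
    have := N (P tau ^+ k * flow X1 tau)%g (flow X2 y).
    have := N (P tau ^+ k)%g (flow X1 tau); have := NP tau k; have := H1 tau; have := H2 y.
    have : L * `|y| <= L * `|tau| by rewrite ler_wpM2l // ltW.
    lra.
  have -> : f (g * P tau ^+ k.+1)%g - f g - k.+1%:R * tau * (f1 g + f2 g) =
    (f (g * P tau ^+ k)%g - f g - k%:R * tau * (f1 g + f2 g))
    - (f1 g - f1 (g * P tau ^+ k * flow X1 x)%g) * tau
    - (f2 g - f2 (g * P tau ^+ k * flow X1 tau * flow X2 y)%g) * tau.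
    rewrite expgSr /P !mulgA -/(P tau) -natr1.
    move: Ex Ey; set A1 := f _; set A2 := f _; set A3 := f _; set A4 := f1 _; set A5 := f2 _.
    by move=> h1 /(canRL (subrK _)) ->; rewrite (canRL (subrK _) h1); ring.
  rewrite -[k.+1%:R]natr1 [leRHS]mulrDl mul1r.
  apply: le_trans (ler_normB _ _) _.
  apply: le_trans (lerD (ler_normB _ _) (lexx _)) _.
  apply: le_trans (lerD (lerD IH (lexx _)) (lexx _)) _.
  rewrite !normrM.
  have := ler_wpM2r (normr_ge0 tau) (ltW Fx); have := ler_wpM2r (normr_ge0 tau) (ltW Fy).
  lra.
have := step n (leqnn n); rewrite -tE => B4.
have -> : f (g * flow X3 t)%g - f g - t * (f1 g + f2 g) =
  (f (g * flow X3 t)%g - f (g * P tau ^+ n)%g) +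
  (f (g * P tau ^+ n)%g - f g - t * (f1 g + f2 g)) by ring.
apply: le_trans (ler_normD _ _) _; apply: le_trans (lerD (ltW B3) B4) _.
by rewrite nt le_eqVlt; apply/orP; left; apply/eqP; field.
Qed.

End Trotter.
End RealCalculus.

(** * Calculus along the left-invariant frame *)

Inductive axis := AI | AJ | AK.

Section Axes.
Variable R : realType.
Definition e1 (x : axis) : R := if x is AI then 1 else 0.
Definition e2 (x : axis) : R := if x is AJ then 1 else 0.
Definition e3 (x : axis) : R := if x is AK then 1 else 0.
Definition vec (x : axis) : 'M[R[i]]_2 := su2v (e1 x) (e2 x) (e3 x).
End Axes.

Definition axis_succ (x : axis) := match x with AI => AJ | AJ => AK | AK => AI end.

HB.lock Definition rd (R : realType) (x : axis) (f : SU2 R -> R) : SU2 R -> R :=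
  fun g => 'D_1 (fun t => f (g * flow (vec R x) t)%g) (0 : R).

Section Smooth.
Variable R : realType.
Local Notation C := R[i].
Local Notation G := (SU2 R).
Implicit Types (g k : G) (f h : G -> R) (x : axis) (n : nat) (a b c r s t u v w : R).

Lemma flow_scale r a b c t :
  flow (su2v (r * a) (r * b) (r * c)) t = flow (su2v a b c) (r * t).
Proof. by rewrite flow.unlock !su2vZ !mulrA [t * r]mulrC. Qed.

Lemma flow_lip2 a b c : exists2 L : R, 0 <= L &
  forall s t, dist4 (flow (su2v a b c) s) (flow (su2v a b c) t) <= L * `|s - t|.
Proof.
have [L L0 H] := flow_lip a b c; exists (4 * L); first by rewrite mulr_ge0.
move=> s t; have -> : t = s + (t - s) by ring.
rewrite flowD; have := dist4_mull (flow (su2v a b c) s) 1%g (flow (su2v a b c) (t - s)).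
rewrite mulg1 => h; apply: le_trans h _.
have := H (t - s); rewrite opprD addrA subrr sub0r normrN; lra.
Qed.

Lemma continuous_flow2 g a b c a' b' c' :
  continuous (fun z : R * R => (g * flow (su2v a b c) z.1 * flow (su2v a' b' c') z.2)%g : G).
Proof.
have [L L0 HL] := flow_lip2 a b c; have [M M0 HM] := flow_lip2 a' b' c'.
move=> [s t] A /= /nbhs_dist4[e e0 eA].
pose d := e / (16 * (L + M + 1)).
have d0 : 0 < d by rewrite divr_gt0 // mulr_gt0 //; lra.
apply/nbhs_ballP; exists d => //= -[s' t'] /= [].
rewrite /ball /= => hs ht; apply: eA.
set X := su2v a b c in HL *; set Y := su2v a' b' c' in HM *.
rewrite -!mulgA; apply: le_lt_trans (dist4_mull _ _ _) _.
have h1 := dist4_trans (flow X s' * flow Y t)%g (flow X s * flow Y t)%g (flow X s' * flow Y t')%g.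
have h2 := dist4_mulr (flow Y t) (flow X s) (flow X s').
have h3 := dist4_mull (flow X s') (flow Y t) (flow Y t').
have h4 : dist4 (flow X s) (flow X s') <= L * d.
  by apply: le_trans (HL _ _) _; rewrite ler_wpM2l // ltW.
have h5 : dist4 (flow Y t) (flow Y t') <= M * d.
  by apply: le_trans (HM _ _) _; rewrite ler_wpM2l // ltW.
apply: (@le_lt_trans _ _ (16 * ((L + M) * d))); first by lra.
have -> : e = 16 * ((L + M + 1) * d) by rewrite /d; field; lra.
by rewrite ltr_pM2l // ltr_pM2r // ltrDl.
Qed.

Lemma continuous_flow g a b c : continuous (fun t => (g * flow (su2v a b c) t)%g : G).
Proof.
have [L L0 H] := flow_lip2 a b c.
move=> t A /= /nbhs_dist4[e e0 eA].
have d0 : 0 < e / (4 * (L + 1)) by rewrite divr_gt0 // mulr_gt0 //; lra.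
apply/nbhs_ballP; exists (e / (4 * (L + 1))) => // s.
rewrite /ball /= => hs; apply: eA; apply: le_lt_trans (dist4_mull _ _ _) _.
have := H t s; have : L * `|t - s| <= L * (e / (4 * (L + 1))) by rewrite ler_wpM2l // ltW.
have : e = 4 * (L * (e / (4 * (L + 1)))) + 4 * (e / (4 * (L + 1))) by field; lra.
lra.
Qed.

Definition rder (x : axis) (f f' : G -> R) := forall g,
  is_derive (0 : R) 1 (fun t => f (g * flow (vec R x) t)%g) (f' g).

Lemma rdE x f f' : rder x f f' -> rd x f = f'.
Proof. by move=> H; apply/funext => g; rewrite rd.unlock; have [] := H g. Qed.

(** Differentiability is required only along I, J and K, but every derivative is required to be
    continuous: this is what the polygonal argument needs in order to reach all other directions. *)
Fixpoint rC (n : nat) (f : G -> R) : Prop := continuous f /\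
  if n is n'.+1 then forall x, rder x f (rd x f) /\ rC n' (rd x f) else True.

Lemma rC_cont n f : rC n f -> continuous f.
Proof. by case: n => [|n] []. Qed.

Lemma rC_intro n f (f' : axis -> G -> R) : continuous f ->
  (forall x, rder x f (f' x) /\ rC n (f' x)) -> rC n.+1 f.
Proof.
move=> cf H; split=> // x; have [D Cf] := H x.
by rewrite (rdE D).
Qed.

Lemma rC_pred n f : rC n.+1 f -> rC n f.
Proof.
elim: n f => [|n IH] f [cf H]; first by split.
by split=> // x; have [D /IH] := H x.
Qed.

Lemma rder_cst x r : rder x (fun=> r) (fun=> 0).
Proof. by move=> g; exact: is_derive_cst. Qed.

Lemma rderD x f f' h h' : rder x f f' -> rder x h h' ->
  rder x (fun g => f g + h g) (fun g => f' g + h' g).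
Proof. by move=> Df Dh g; have A := Df g; have B := Dh g; exact: is_deriveD. Qed.

Lemma rderM x f f' h h' : rder x f f' -> rder x h h' ->
  rder x (fun g => f g * h g) (fun g => f g * h' g + h g * f' g).
Proof.
move=> Df Dh g; have A := Df g; have B := Dh g.
by have := is_deriveM A B; rewrite !flow0 mulg1.
Qed.

Lemma contG_comp2 (op : R -> R -> R) (f h : G -> R) :
  continuous (fun z : R * R => op z.1 z.2) -> continuous f -> continuous h ->
  continuous (fun g => op (f g) (h g)).
Proof.
move=> cop cf ch; apply/continuousGP => g e e0.
have /cvgrPdist_lt/(_ e e0)/nbhs_ballP[d /= d0 Hd] := cop (f g, h g).
have [d1 d10 H1] := (continuousGP f).1 cf g d d0.
have [d2 d20 H2] := (continuousGP h).1 ch g d d0.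
exists (Num.min d1 d2); first by rewrite lt_min d10 d20.
move=> k; rewrite lt_min => /andP[/H1 k1 /H2 k2].
by apply: (Hd (f k, h k)); split.
Qed.

Lemma contGD (f h : G -> R) : continuous f -> continuous h ->
  continuous (fun g => f g + h g).
Proof.
by apply: contG_comp2 => z; apply: cvgD; [exact: cvg_fst|exact: cvg_snd].
Qed.

Lemma contGM (f h : G -> R) : continuous f -> continuous h ->
  continuous (fun g => f g * h g).
Proof.
by apply: contG_comp2 => z; apply: cvgM; [exact: cvg_fst|exact: cvg_snd].
Qed.

Lemma contG_cst r : continuous (fun _ : G => r).
Proof.
by apply/continuousGP => g e e0; exists 1 => // k _; rewrite subrr normr0.
Qed.

Lemma rC_cst n r : rC n (fun=> r).
Proof.
elim: n r => [|n IH] r; first by split=> //; exact: contG_cst.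
by apply: (@rC_intro n _ (fun _ _ => 0)) => [|x]; [exact: contG_cst|split => //; exact: rder_cst].
Qed.

Lemma rCD n f h : rC n f -> rC n h -> rC n (fun g => f g + h g).
Proof.
elim: n f h => [|n IH] f h [cf Hf] [ch Hh]; first by split=> //; exact: contGD.
apply: (@rC_intro n _ (fun x g => rd x f g + rd x h g)); first exact: contGD.
move=> x; have [Df Cf] := Hf x; have [Dh Ch] := Hh x.
by split; [exact: rderD|exact: IH].
Qed.

Lemma rCM n f h : rC n f -> rC n h -> rC n (fun g => f g * h g).
Proof.
elim: n f h => [|n IH] f h.
  by move=> [cf _] [ch _]; split => //; exact: contGM.
move=> Hf Hh; have Pf := rC_pred Hf; have Ph := rC_pred Hh.
move: Hf Hh => [cf Hf] [ch Hh].
apply: (@rC_intro n _ (fun x g => f g * rd x h g + h g * rd x f g)); first exact: contGM.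
move=> x; have [Df Cf] := Hf x; have [Dh Ch] := Hh x.
by split; [exact: rderM|apply: rCD; apply: IH].
Qed.

Lemma q_continuous : [/\ continuous (@q0 R), continuous (@q1 R), continuous (@q2 R) &
  continuous (@q3 R)].
Proof.
by split; apply/continuousGP => g e e0; exists e => // h; apply: le_lt_trans;
  rewrite /dist4; move: (normr_ge0 (q0 g - q0 h)) (normr_ge0 (q1 g - q1 h))
   (normr_ge0 (q2 g - q2 h)) (normr_ge0 (q3 g - q3 h)); lra.
Qed.

(* The derivatives of q0, ..., q3 along the frame: right multiplication by I, J, K
   in quaternionic coordinates. *)
Definition dq (x : axis) : (G -> R) * (G -> R) * (G -> R) * (G -> R) :=
  match x with
  | AI => (fun g => - q1 g, @q0 R, @q3 R, fun g => - q2 g)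
  | AJ => (fun g => - q2 g, fun g => - q3 g, @q0 R, @q1 R)
  | AK => (fun g => - q3 g, @q2 R, fun g => - q1 g, @q0 R)
  end.

Lemma rder_q x : [/\ rder x (@q0 R) (dq x).1.1.1, rder x (@q1 R) (dq x).1.1.2,
  rder x (@q2 R) (dq x).1.2 & rder x (@q3 R) (dq x).2].
Proof.
have [i0 i1 i2 i3] := q_one R.
have [D0 D1 D2 D3] := is_derive_flow0 (e1 R x) (e2 R x) (e3 R x).
split=> g; rewrite /vec.
- have -> : (fun t => q0 (g * flow (su2v (e1 R x) (e2 R x) (e3 R x)) t)%g) = (fun t =>
   q0 g * q0 (flow (su2v (e1 R x) (e2 R x) (e3 R x)) t) - q1 g * q1 (flow (su2v (e1 R x) (e2 R x) (e3 R x)) t)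
   - q2 g * q2 (flow (su2v (e1 R x) (e2 R x) (e3 R x)) t) - q3 g * q3 (flow (su2v (e1 R x) (e2 R x) (e3 R x)) t)).
    by apply/funext => t; have [->] := q_mul g (flow (su2v (e1 R x) (e2 R x) (e3 R x)) t).
  apply: is_derive_eq; rewrite /GRing.scale /=.
  by rewrite ?flow0 ?i0 ?i1 ?i2 ?i3; case: (x) => /=; ring.
- have -> : (fun t => q1 (g * flow (su2v (e1 R x) (e2 R x) (e3 R x)) t)%g) = (fun t =>
   q0 g * q1 (flow (su2v (e1 R x) (e2 R x) (e3 R x)) t) + q1 g * q0 (flow (su2v (e1 R x) (e2 R x) (e3 R x)) t)
   + q2 g * q3 (flow (su2v (e1 R x) (e2 R x) (e3 R x)) t) - q3 g * q2 (flow (su2v (e1 R x) (e2 R x) (e3 R x)) t)).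
    by apply/funext => t; have [_ ->] := q_mul g (flow (su2v (e1 R x) (e2 R x) (e3 R x)) t).
  apply: is_derive_eq; rewrite /GRing.scale /=.
  by rewrite ?flow0 ?i0 ?i1 ?i2 ?i3; case: (x) => /=; ring.
- have -> : (fun t => q2 (g * flow (su2v (e1 R x) (e2 R x) (e3 R x)) t)%g) = (fun t =>
   q0 g * q2 (flow (su2v (e1 R x) (e2 R x) (e3 R x)) t) - q1 g * q3 (flow (su2v (e1 R x) (e2 R x) (e3 R x)) t)
   + q2 g * q0 (flow (su2v (e1 R x) (e2 R x) (e3 R x)) t) + q3 g * q1 (flow (su2v (e1 R x) (e2 R x) (e3 R x)) t)).
    by apply/funext => t; have [_ _ ->] := q_mul g (flow (su2v (e1 R x) (e2 R x) (e3 R x)) t).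
  apply: is_derive_eq; rewrite /GRing.scale /=.
  by rewrite ?flow0 ?i0 ?i1 ?i2 ?i3; case: (x) => /=; ring.
- have -> : (fun t => q3 (g * flow (su2v (e1 R x) (e2 R x) (e3 R x)) t)%g) = (fun t =>
   q0 g * q3 (flow (su2v (e1 R x) (e2 R x) (e3 R x)) t) + q1 g * q2 (flow (su2v (e1 R x) (e2 R x) (e3 R x)) t)
   - q2 g * q1 (flow (su2v (e1 R x) (e2 R x) (e3 R x)) t) + q3 g * q0 (flow (su2v (e1 R x) (e2 R x) (e3 R x)) t)).
    by apply/funext => t; have [_ _ _ ->] := q_mul g (flow (su2v (e1 R x) (e2 R x) (e3 R x)) t).
  apply: is_derive_eq; rewrite /GRing.scale /=.
  by rewrite ?flow0 ?i0 ?i1 ?i2 ?i3; case: (x) => /=; ring.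
Qed.

Lemma rCZ n r f : rC n f -> rC n (fun g => r * f g).
Proof. by apply: rCM; exact: rC_cst. Qed.

Lemma rCN n f : rC n f -> rC n (fun g => - f g).
Proof.
by move=> /(rCZ (-1)); congr rC; apply/funext => g; rewrite mulN1r.
Qed.

Lemma rC_q n : [/\ rC n (@q0 R), rC n (@q1 R), rC n (@q2 R) & rC n (@q3 R)].
Proof.
have [c0 c1 c2 c3] := q_continuous.
elim: n => [|n [IH0 IH1 IH2 IH3]]; first by split; split.
split; [apply: (@rC_intro n _ (fun x => (dq x).1.1.1)) => // x
       |apply: (@rC_intro n _ (fun x => (dq x).1.1.2)) => // x
       |apply: (@rC_intro n _ (fun x => (dq x).1.2)) => // x
       |apply: (@rC_intro n _ (fun x => (dq x).2)) => // x];
  have [D0 D1 D2 D3] := rder_q x; split => //;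
  case: (x) => //=; exact: rCN.
Qed.

Definition smoothR f := forall n, rC n f.

Lemma smoothR_rd x f : smoothR f -> smoothR (rd x f).
Proof. by move=> H n; have [_ /(_ x)[]] := H n.+1. Qed.

Lemma smoothR_rder x f : smoothR f -> rder x f (rd x f).
Proof. by move=> H; have [_ /(_ x)[]] := H 1. Qed.

Lemma smoothR_cont f : smoothR f -> continuous f.
Proof. by move=> /(_ 0%N)[]. Qed.

(** Trotter's formula is applied twice, to aI + bJ and then to the sum with cK. The multiples of a
    single axis are changes of speed, where |r| + 1 stands for |r| because r may be 0. *)
Lemma is_derive_lin f a b c : rC 1 f -> forall g,
  is_derive (0 : R) 1 (fun t => f (g * flow (su2v a b c) t)%g)
    (a * rd AI f g + b * rd AJ f g + c * rd AK f g).
Proof.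
move=> [cf H] g.
have [DI [cI _]] := H AI; have [DJ [cJ _]] := H AJ; have [DK [cK _]] := H AK.
have S r (x y z : R) (f' : G -> R) : (forall g, is_derive (0 : R) 1 (fun t => f (g * flow (su2v x y z) t)%g) (f' g)) ->
  forall g, is_derive (0 : R) 1 (fun t => f (g * flow (su2v (r * x) (r * y) (r * z)) t)%g) (r * f' g).
  move=> {}H {}g; have := H g => /is_derive_eps Hg; apply/is_derive_eps => e e0.
  have [|d d0 Hd] := Hg (e / (`|r| + 1)); first by rewrite divr_gt0 // ltr_wpDl.
  exists (d / (`|r| + 1)); first by rewrite divr_gt0 // ltr_wpDl.
  move=> t; rewrite ltr_pdivlMr ?ltr_wpDl // => td.
  have rt : `|r * t| <= `|t| * (`|r| + 1) by rewrite normrM mulrC ler_wpM2l // lerDl.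
  have := Hd (r * t) (le_lt_trans rt td).
  rewrite !add0r !flow0 flow_scale mulrCA mulrA => h.
  apply: le_trans h _.
  rewrite -mulrA ler_pM2l // ler_pdivrMl ?ltr_wpDl //.
  by rewrite [leRHS]mulrC; exact: rt.
have c' (r : R) (f' : G -> R) : continuous f' -> continuous (fun g : G => r * f' g).
  by move=> h; apply: contGM => //; exact: contG_cst.
have := is_derive_trotter (a1 := a * 1 + b * 0) (b1 := a * 0 + b * 1) (c1 := a * 0 + b * 0)
  (a2 := c * 0) (b2 := c * 0) (c2 := c * 1) (f := f)
  (f1 := fun g => a * rd AI f g + b * rd AJ f g) (f2 := fun g => c * rd AK f g) cf _ _ _ (S c 0 0 1 _ DK) g.
rewrite !mulr0 !mulr1 !addr0 !add0r; apply.
- by apply: contGD; exact: c'.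
- exact: c'.
have := is_derive_trotter (a1 := a * 1) (b1 := a * 0) (c1 := a * 0)
  (a2 := b * 0) (b2 := b * 1) (c2 := b * 0) (f := f)
  (f1 := fun g => a * rd AI f g) (f2 := fun g => b * rd AJ f g) cf _ _ (S a 1 0 0 _ DI) (S b 0 1 0 _ DJ).
by rewrite !mulr0 !mulr1 !addr0 !add0r; apply; exact: c'.
Qed.

Lemma is_derive_unique (f : R -> R) (x a b : R) :
  is_derive x 1 f a -> is_derive x 1 f b -> a = b.
Proof. by move=> [_ <-] [_ <-]. Qed.

(** The second mixed derivative is produced, not assumed. Two mean values turn the second difference
    u(s,t) - u(s,0) - u(0,t) + u(0,0) into ust(x,y) t s with |x| <= |s| and |y| <= |t|, and
    continuity of [ust] at the origin concludes. *)
Lemma schwarz (u us ust : R -> R -> R) (ut : R -> R) :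
  (forall s t, is_derive s 1 (u^~ t) (us s t)) ->
  (forall s t, is_derive t 1 (us s) (ust s t)) ->
  {for ((0, 0) : R * R), continuous (fun z : R * R => ust z.1 z.2)} ->
  (forall s, is_derive (0 : R) 1 (u s) (ut s)) ->
  is_derive (0 : R) 1 ut (ust 0 0).
Proof.
move=> H1 H2 H3 H4; apply/is_derive_eps => e e0.
have /cvgrPdist_lt/(_ e e0)/nbhs_ballP[d /= d0 Hd] := H3.
(* The slack e' pays for replacing the derivatives [ut s] and [ut 0] by difference quotients, e'/2
   for each; t is chosen after s and e'. *)
exists d => // s sd; rewrite add0r; apply/ler_addgt0Pr => e' e'0.
have e'20 : 0 < e' / 2 by rewrite divr_gt0.
have [d1 d10 Hd1] := (is_derive_eps (u s) 0 (ut s)).1 (H4 s) _ e'20.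
have [d2 d20 Hd2] := (is_derive_eps (u 0) 0 (ut 0)).1 (H4 0) _ e'20.
pose t := Num.min d (Num.min d1 d2) / 2.
have m0 : 0 < Num.min d (Num.min d1 d2) by rewrite !lt_min d0 d10 d20.
have t0 : 0 < t by rewrite divr_gt0.
have tm : `|t| < Num.min d (Num.min d1 d2).
  by rewrite gtr0_norm // /t ltr_pdivrMr // ltr_pMr // ltr1n.
move: tm; rewrite !lt_min => /and3P[td /Hd1 B1 /Hd2 B2].
have [x xs Ex] : exists2 c, `|c - 0| <= `|s - 0| &
    (u s t - u s 0) - (u 0 t - u 0 0) = (us c t - us c 0) * (s - 0).
  apply: (@MVT_sym _ (fun c => u c t - u c 0) (fun c => us c t - us c 0)).
have [y yt Ey] := @MVT_sym _ (us x) (ust x) 0 t (H2 x).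
rewrite !subr0 in xs Ex yt Ey; rewrite Ey in Ex.
have B3 : `|ust 0 0 - ust x y| < e.
  apply: (Hd (x, y)); split; rewrite /ball /= sub0r normrN.
    exact: le_lt_trans xs sd.
  exact: le_lt_trans yt td.
rewrite !add0r in B1 B2.
rewrite -(ler_pM2r t0) -[X in _ * X <= _](gtr0_norm t0) -normrM.
have -> : (ut s - ut 0 - s * ust 0 0) * t =
  (u 0 t - u 0 0 - t * ut 0) - (u s t - u s 0 - t * ut s) - (ust 0 0 - ust x y) * (t * s).
  rewrite [in RHS]mulrBl.
  have -> : ust x y * (t * s) = u s t - u s 0 - (u 0 t - u 0 0) by rewrite Ex mulrA.
  ring.
apply: le_trans (ler_normB _ _) _.
apply: le_trans (lerD (ler_normB _ _) (lexx _)) _.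
clearbody t; rewrite (gtr0_norm t0) in B1 B2; rewrite !normrM (gtr0_norm t0).
have := ler_wpM2r (mulr_ge0 (ltW t0) (normr_ge0 s)) (ltW B3).
lra.
Qed.

(** exp(sX) exp(tY) = exp(tY) exp(s Ad(exp(-tY)) X), and as [X, Y] = 2Z this adjoint action rotates
    X towards Z through the angle 2t. *)
Lemma conj_axis x s t : let y := axis_succ x in let z := axis_succ y in
  (flow (vec R x) s * flow (vec R y) t = flow (vec R y) t *
    flow (su2v (cos (2 * t) * e1 R x + sin (2 * t) * e1 R z)
             (cos (2 * t) * e2 R x + sin (2 * t) * e2 R z)
             (cos (2 * t) * e3 R x + sin (2 * t) * e3 R z)) s)%g.
Proof.
move=> y z; set X := flow (vec R x) s; set Y := flow (vec R y) t; set Z := flow _ s.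
have unit x' : e1 R x' ^+ 2 + e2 R x' ^+ 2 + e3 R x' ^+ 2 = 1 by case: x' => /=; ring.
have cs : cos t ^+ 2 = 1 - sin t ^+ 2 by rewrite -(cos2Dsin2 t) addrK.
have unitZ : (cos (2 * t) * e1 R x + sin (2 * t) * e1 R z) ^+ 2 +
  (cos (2 * t) * e2 R x + sin (2 * t) * e2 R z) ^+ 2 +
  (cos (2 * t) * e3 R x + sin (2 * t) * e3 R z) ^+ 2 = 1.
  have c2s := cos2Dsin2 (2 * t).
  by rewrite -[RHS]c2s /z /y; case: (x) => /=; ring.
have [X0 X1 X2 X3] := flow_unit s (unit x).
have [Y0 Y1 Y2 Y3] := flow_unit t (unit y).
have [Z0 Z1 Z2 Z3] := flow_unit s unitZ.
have [A0 A1 A2 A3] := q_mul X Y; have [B0 B1 B2 B3] := q_mul Y Z.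
have c2 : cos (2 * t) = cos t * cos t - sin t * sin t by rewrite -cosD mulr_natl mulr2n.
have s2 : sin (2 * t) = sin t * cos t + cos t * sin t by rewrite -sinD mulr_natl mulr2n.
apply: SU2_ext; [rewrite A0 B0|rewrite A1 B1|rewrite A2 B2|rewrite A3 B3];
  rewrite X0 X1 X2 X3 Y0 Y1 Y2 Y3 Z0 Z1 Z2 Z3 c2 s2 /z /y; case: (x) => /=; ring: cs.
Qed.

Lemma continuous_comp_flow2 F g a b c a' b' c' : continuous F ->
  continuous (fun z : R * R => F (g * flow (su2v a b c) z.1 * flow (su2v a' b' c') z.2)%g : R).
Proof.
by move=> cF z A hA; exact: (@continuous_flow2 g a b c a' b' c' z _ (cF _ A hA)).
Qed.

Lemma continuous_comp_flow F g a b c : continuous F ->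
  continuous (fun t => F (g * flow (su2v a b c) t)%g : R).
Proof.
by move=> cF z A hA; exact: (@continuous_flow g a b c z _ (cF _ A hA)).
Qed.

Lemma is_derive_conj f g s t x : rC 1 f -> let y := axis_succ x in let z := axis_succ y in
  is_derive s 1 (fun s => f (g * flow (vec R x) s * flow (vec R y) t)%g)
   (cos (2 * t) * rd x f (g * flow (vec R x) s * flow (vec R y) t)%g +
    sin (2 * t) * rd z f (g * flow (vec R x) s * flow (vec R y) t)%g).
Proof.
move=> Cf y z; apply/is_derive_eps => e e0.
have := is_derive_lin (cos (2 * t) * e1 R x + sin (2 * t) * e1 R z)
             (cos (2 * t) * e2 R x + sin (2 * t) * e2 R z)
             (cos (2 * t) * e3 R x + sin (2 * t) * e3 R z) Cf (g * flow (vec R x) s * flow (vec R y) t)%g.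
move=> /is_derive_eps/(_ e e0)[d d0 Hd]; exists d => // h /Hd.
rewrite add0r flow0 mulg1.
rewrite [flow _ (s + h)]flowD !mulgA -[(_ * flow _ h * _)%g]mulgA -/(vec R x) conj_axis !mulgA.
congr (`|_ - _ * _| <= _).
by rewrite /z /y; case: (x) => /=; ring.
Qed.

(** The function f(g exp(sX) exp(tY)) is differentiated in s after moving exp(sX) to the right, and
    then in t: at the origin this gives YXf + 2Zf. By Schwarz's theorem it equals the derivative in
    the other order, XYf. *)
Lemma rd_comm x f g : rC 2 f -> let y := axis_succ x in let z := axis_succ y in
  rd x (rd y f) g - rd y (rd x f) g = 2 * rd z f g.
Proof.
move=> C2f y z; have C1f := rC_pred C2f.
have [cf H] := C2f.
have [Dx Cx] := H x; have [Dy Cy] := H y; have [Dz Cz] := H z.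
have [cx /(_ y)[Dyx [cyx _]]] := Cx.
have [cz /(_ y)[Dyz [cyz _]]] := Cz.
have [cy /(_ x)[Dxy _]] := Cy.
pose p s t := (g * flow (vec R x) s * flow (vec R y) t)%g.
have := @schwarz (fun s t => f (p s t))
  (fun s t => cos (2 * t) * rd x f (p s t) + sin (2 * t) * rd z f (p s t))
  (fun s t => (cos (2 * t) * rd y (rd x f) (p s t) + rd x f (p s t) * (- (2 * sin (2 * t)))) +
     (sin (2 * t) * rd y (rd z f) (p s t) + rd z f (p s t) * (2 * cos (2 * t))))
  (fun s => rd y f (g * flow (vec R x) s)%g).
case.
- by move=> s t; exact: is_derive_conj.
- move=> s t.
  have A := is_derive_flow Dyx (g * flow (vec R x) s)%g t.
  have B := is_derive_flow Dyz (g * flow (vec R x) s)%g t.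
  have Dc : is_derive t 1 (fun t : R => cos (2 * t)) (- (2 * sin (2 * t))).
    by apply: is_derive_eq; rewrite /GRing.scale /=; ring.
  have Ds : is_derive t 1 (fun t : R => sin (2 * t)) (2 * cos (2 * t)).
    by apply: is_derive_eq; rewrite /GRing.scale /=; ring.
  exact: (is_deriveD (is_deriveM Dc A) (is_deriveM Ds B)).
- have c2 : continuous (fun z : R * R => cos (2 * z.2)).
    move=> w; apply: (@continuous_comp _ _ _ (fun z : R * R => 2 * z.2) cos).
      by apply: cvgM; [exact: cvg_cst|exact: cvg_snd].
    exact: continuous_cos.
  have s2 : continuous (fun z : R * R => sin (2 * z.2)).
    move=> w; apply: (@continuous_comp _ _ _ (fun z : R * R => 2 * z.2) sin).
      by apply: cvgM; [exact: cvg_cst|exact: cvg_snd].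
    exact: continuous_sin.
  have F h : continuous h -> continuous (fun z : R * R => h (p z.1 z.2)).
    by move=> ch; exact: continuous_comp_flow2.
  apply: cvgD; apply: cvgD; apply: cvgM.
  + exact: c2.
  + exact: (F _ cyx).
  + exact: (F _ cx).
  + by apply: cvgN; apply: cvgM; [exact: cvg_cst|exact: s2].
  + exact: s2.
  + exact: (F _ cyz).
  + exact: (F _ cz).
  + by apply: cvgM; [exact: cvg_cst|exact: c2].
- move=> s; have := Dy (g * flow (vec R x) s)%g; exact.
have Hx := Dxy g.
move=> Dab Eab; rewrite (is_derive_unique Hx (DeriveDef Dab Eab)).
rewrite /p !flow0 !mulg1 mulr0 cos0 sin0; ring.
Qed.

End Smooth.

(** * Complex functions, weights and the maximum principle *)

Definition re (R : realType) (f : SU2 R -> R[i]) : SU2 R -> R :=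
  fun g => complex.Re (f g).
Definition im (R : realType) (f : SU2 R -> R[i]) : SU2 R -> R :=
  fun g => complex.Im (f g).

HB.lock Definition fder (R : realType) (x : axis) (f : SU2 R -> R[i]) : SU2 R -> R[i] :=
  fun g => rd x (re f) g +i* rd x (im f) g.

Section ComplexCalculus.
Variable R : realType.
Local Notation C := R[i].
Local Notation G := (SU2 R).
Implicit Types (g k : G) (f h : G -> C) (x y z : axis) (n : nat) (a b c : C) (w : int).

Definition Ck n f := rC n (re f) /\ rC n (im f).
Definition smoothC f := smoothR (re f) /\ smoothR (im f).

Lemma smoothC_Ck f : smoothC f <-> forall n, Ck n f.
Proof. by split=> [[H1 H2] n|H]; [split|split=> n; have [] := H n]. Qed.

Lemma re_d x f : re (fder x f) = rd x (re f).
Proof. by apply/funext => g; rewrite fder.unlock. Qed.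

Lemma im_d x f : im (fder x f) = rd x (im f).
Proof. by apply/funext => g; rewrite fder.unlock. Qed.

Lemma ReIm_eq (u v : C) : complex.Re u = complex.Re v -> complex.Im u = complex.Im v -> u = v.
Proof. by case: u v => ? ? [? ?] /= -> ->. Qed.

Lemma cReD (u v : C) : complex.Re (u + v) = complex.Re u + complex.Re v.
Proof. by case: u v => ? ? []. Qed.
Lemma cImD (u v : C) : complex.Im (u + v) = complex.Im u + complex.Im v.
Proof. by case: u v => ? ? []. Qed.
Lemma cReM (u v : C) : complex.Re (u * v) =
  complex.Re u * complex.Re v - complex.Im u * complex.Im v.
Proof. by case: u v => ? ? []. Qed.
Lemma cImM (u v : C) : complex.Im (u * v) =
  complex.Re u * complex.Im v + complex.Im u * complex.Re v.
Proof. by case: u v => ? ? []. Qed.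

Lemma CkD n f h : Ck n f -> Ck n h -> Ck n (fun g => f g + h g).
Proof.
move=> [f1 f2] [h1 h2]; split.
  have -> : re (fun g => f g + h g) = (fun g => re f g + re h g).
    by apply/funext => g; exact: cReD.
  exact: rCD.
have -> : im (fun g => f g + h g) = (fun g => im f g + im h g).
  by apply/funext => g; exact: cImD.
exact: rCD.
Qed.

Lemma CkM n f h : Ck n f -> Ck n h -> Ck n (fun g => f g * h g).
Proof.
move=> [f1 f2] [h1 h2]; split.
  have -> : re (fun g => f g * h g) = (fun g => re f g * re h g + - (im f g * im h g)).
    by apply/funext => g; exact: cReM.
  by apply: rCD; [exact: rCM|apply: rCN; exact: rCM].
have -> : im (fun g => f g * h g) = (fun g => re f g * im h g + im f g * re h g).
  by apply/funext => g; exact: cImM.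
by apply: rCD; exact: rCM.
Qed.

Lemma Ck_cst n c : Ck n (fun=> c).
Proof. by split; exact: rC_cst. Qed.

Lemma smoothCD f h : smoothC f -> smoothC h -> smoothC (fun g => f g + h g).
Proof. by move=> /smoothC_Ck Hf /smoothC_Ck Hh; apply/smoothC_Ck => n; exact: CkD. Qed.

Lemma smoothCM f h : smoothC f -> smoothC h -> smoothC (fun g => f g * h g).
Proof. by move=> /smoothC_Ck Hf /smoothC_Ck Hh; apply/smoothC_Ck => n; exact: CkM. Qed.

Lemma smoothC_cst c : smoothC (fun=> c).
Proof. by apply/smoothC_Ck => n; exact: Ck_cst. Qed.

Lemma smoothCZ c f : smoothC f -> smoothC (fun g => c * f g).
Proof. by apply: smoothCM; exact: smoothC_cst. Qed.

Lemma smoothC_d x f : smoothC f -> smoothC (fder x f).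
Proof. by move=> [H1 H2]; split; rewrite ?re_d ?im_d; exact: smoothR_rd. Qed.

Lemma d_cst x c : fder x (fun=> c) = fun=> 0.
Proof.
apply/funext => g; apply: ReIm_eq; rewrite fder.unlock /=;
  by rewrite (rdE (@rder_cst _ _ _)).
Qed.

Lemma dD x f h : smoothC f -> smoothC h -> fder x (fun g => f g + h g) = fun g => fder x f g + fder x h g.
Proof.
move=> [f1 f2] [h1 h2]; apply/funext => g; apply: ReIm_eq; rewrite ?cReD ?cImD fder.unlock /=.
  have -> : re (fun g => f g + h g) = (fun g => re f g + re h g).
    by apply/funext => k; exact: cReD.
  by rewrite (rdE (rderD (smoothR_rder x f1) (smoothR_rder x h1))).
have -> : im (fun g => f g + h g) = (fun g => im f g + im h g).
  by apply/funext => k; exact: cImD.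
by rewrite (rdE (rderD (smoothR_rder x f2) (smoothR_rder x h2))).
Qed.

Lemma rderN x (u u' : G -> R) : rder x u u' -> rder x (fun g => - u g) (fun g => - u' g).
Proof. by move=> H g; have A := H g; exact: is_deriveN. Qed.

Lemma dM x f h : smoothC f -> smoothC h ->
  fder x (fun g => f g * h g) = fun g => fder x f g * h g + f g * fder x h g.
Proof.
move=> [f1 f2] [h1 h2]; apply/funext => g; apply: ReIm_eq;
  rewrite ?cReD ?cImD ?cReM ?cImM fder.unlock /=.
  have -> : re (fun g => f g * h g) = (fun g => re f g * re h g + - (im f g * im h g)).
    by apply/funext => k; exact: cReM.
  rewrite (rdE (rderD (rderM (smoothR_rder x f1) (smoothR_rder x h1))
     (rderN (rderM (smoothR_rder x f2) (smoothR_rder x h2))))).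
  by rewrite /re /im; ring.
have -> : im (fun g => f g * h g) = (fun g => re f g * im h g + im f g * re h g).
  by apply/funext => k; exact: cImM.
rewrite (rdE (rderD (rderM (smoothR_rder x f1) (smoothR_rder x h2))
     (rderM (smoothR_rder x f2) (smoothR_rder x h1)))).
by rewrite /re /im; ring.
Qed.

Lemma dZ x c f : smoothC f -> fder x (fun g => c * f g) = fun g => c * fder x f g.
Proof.
by move=> sf; rewrite dM ?d_cst //; [apply/funext => g; rewrite mul0r add0r|exact: smoothC_cst].
Qed.

Lemma d_lin x a b f h : smoothC f -> smoothC h ->
  fder x (fun g => a * f g + b * h g) = fun g => a * fder x f g + b * fder x h g.
Proof. by move=> sf sh; rewrite dD ?dZ //; exact: smoothCZ. Qed.

Lemma d_comm x f g : smoothC f -> let y := axis_succ x in let z := axis_succ y in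
  fder x (fder y f) g - fder y (fder x f) g = 2 * fder z f g.
Proof.
move=> [f1 f2] y z; have E1 := rd_comm x g (f1 2%N); have E2 := rd_comm x g (f2 2%N).
cbv zeta in E1, E2; rewrite -!re_d in E1; rewrite -!im_d in E2.
have D (u v w : C) : complex.Re u - complex.Re v = 2 * complex.Re w ->
    complex.Im u - complex.Im v = 2 * complex.Im w -> u - v = 2 * w.
  case: u v w => [u1 u2] [v1 v2] [w1 w2] /= h1 h2.
  by apply: ReIm_eq => /=; rewrite ?h1 ?h2; ring.
exact: D.
Qed.

Definition ii : C := 0 +i* 1.
Lemma iiM : ii * ii = -1.
Proof. by rewrite /ii; simpc; congr (_ +i* _); ring. Qed.

(** The ladder operators of sl(2) relative to I. The coefficients 1 and -1 are written out so that
    both have the shape of a linear combination treated by [d_lin]. *)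
Definition opA f : G -> C := fun g => 1 * fder AJ f g + ii * fder AK f g.
Definition opB f : G -> C := fun g => -1 * fder AJ f g + ii * fder AK f g.
(** The infinitesimal form of f(g exp(tI)) = exp(iwt) f(g), which [wt_orbit] recovers. *)
Definition wt w f := forall g, fder AI f g = ii * w%:~R * f g.

Lemma smoothCA f : smoothC f -> smoothC (opA f).
Proof. by move=> sf; apply: smoothCD; apply: smoothCZ; exact: smoothC_d. Qed.
Lemma smoothCB f : smoothC f -> smoothC (opB f).
Proof. by move=> sf; apply: smoothCD; apply: smoothCZ; exact: smoothC_d. Qed.

Lemma opAB f g : smoothC f ->
  opA (opB f) g = - (fder AJ (fder AJ f) g + fder AK (fder AK f) g) + 2 * ii * fder AI f g.
Proof.
move=> sf; rewrite /opA /opB; rewrite !d_lin; try exact: smoothC_d.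
have := d_comm AJ g sf; rewrite /= => E.
have -> : 2 * ii * fder AI f g = ii * (fder AJ (fder AK f) g - fder AK (fder AJ f) g) by rewrite E; ring.
by ring: iiM.
Qed.

Lemma opBA f g : smoothC f ->
  opB (opA f) g = - (fder AJ (fder AJ f) g + fder AK (fder AK f) g) - 2 * ii * fder AI f g.
Proof.
move=> sf; rewrite /opA /opB; rewrite !d_lin; try exact: smoothC_d.
have := d_comm AJ g sf; rewrite /= => E.
have -> : 2 * ii * fder AI f g = ii * (fder AJ (fder AK f) g - fder AK (fder AJ f) g) by rewrite E; ring.
by ring: iiM.
Qed.

(** Both products are the same sub-Laplacian up to a term 2i d_I of opposite sign, and d_I acts as
    iw. *)
Lemma opBA_wt f w g : smoothC f -> wt w f -> opB (opA f) g = opA (opB f) g + 4 * w%:~R * f g.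
Proof.
by move=> sf wf; rewrite opBA // opAB // wf; ring: iiM.
Qed.

Lemma wt_d w f : wt w f -> fder AI f = fun g => ii * w%:~R * f g.
Proof. by move=> H; apply/funext. Qed.

Lemma wtA w f : smoothC f -> wt w f -> wt (w - 2) (opA f).
Proof.
move=> sf wf g; rewrite {1}/opA d_lin; try exact: smoothC_d.
have E1 := d_comm AI g sf; have E2 := d_comm AK g sf; rewrite /= (wt_d wf) !dZ // in E1 E2.
rewrite /opA intrD.
rewrite (canRL (subrK _) E1).
have -> : fder AI (fder AK f) g = ii * w%:~R * fder AK f g - 2 * fder AJ f g by rewrite -E2; ring.
by ring: iiM.
Qed.

Lemma wtB w f : smoothC f -> wt w f -> wt (w + 2) (opB f).
Proof.
move=> sf wf g; rewrite {1}/opB d_lin; try exact: smoothC_d.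
have E1 := d_comm AI g sf; have E2 := d_comm AK g sf; rewrite /= (wt_d wf) !dZ // in E1 E2.
rewrite /opB intrD.
rewrite (canRL (subrK _) E1).
have -> : fder AI (fder AK f) g = ii * w%:~R * fder AK f g - 2 * fder AJ f g by rewrite -E2; ring.
by ring: iiM.
Qed.

Lemma wtM w w' f h : smoothC f -> smoothC h -> wt w f -> wt w' h -> wt (w + w') (fun g => f g * h g).
Proof. by move=> sf sh wf wh g; rewrite dM // wf wh intrD; ring. Qed.

Lemma wtD w f h : smoothC f -> smoothC h -> wt w f -> wt w h -> wt w (fun g => f g + h g).
Proof. by move=> sf sh wf wh g; rewrite dD // wf wh; ring. Qed.

Lemma wtZ w c f : smoothC f -> wt w f -> wt w (fun g => c * f g).
Proof. by move=> sf wf g; rewrite dZ // wf; ring. Qed.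

Lemma opBM f h g : smoothC f -> smoothC h -> opB (fun g => f g * h g) g = opB f g * h g + f g * opB h g.
Proof. by move=> sf sh; rewrite /opB !dM //; ring. Qed.
Lemma opAD f h g : smoothC f -> smoothC h -> opA (fun g => f g + h g) g = opA f g + opA h g.
Proof. by move=> sf sh; rewrite /opA !dD //; ring. Qed.
Lemma opBD f h g : smoothC f -> smoothC h -> opB (fun g => f g + h g) g = opB f g + opB h g.
Proof. by move=> sf sh; rewrite /opB !dD //; ring. Qed.
Lemma opAZ c f g : smoothC f -> opA (fun g => c * f g) g = c * opA f g.
Proof. by move=> sf; rewrite /opA !dZ //; ring. Qed.
Lemma opBZ c f g : smoothC f -> opB (fun g => c * f g) g = c * opB f g.
Proof. by move=> sf; rewrite /opB !dZ //; ring. Qed.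
Lemma opA0 g : opA (fun=> 0) g = 0.
Proof. by rewrite /opA !d_cst; ring. Qed.
Lemma opB0 g : opB (fun=> 0) g = 0.
Proof. by rewrite /opB !d_cst; ring. Qed.

Definition z00 g : C := q0 g +i* q1 g.
Definition z01 g : C := q2 g +i* q3 g.
Definition z10 g : C := - q2 g +i* q3 g.
Definition z11 g : C := q0 g +i* - q1 g.

Lemma smoothC_z : [/\ smoothC z00, smoothC z01, smoothC z10 & smoothC z11].
Proof.
have Q n := rC_q R n.
by split; split=> n; have [Q0 Q1 Q2 Q3] := Q n; rewrite /re /im /=; do ?apply: rCN.
Qed.

Lemma d_z x g : let X := match x with AI => mxI R | AJ => mxJ R | AK => mxK R end in
  [/\ fder x z00 g = z00 g * X 0 0 + z01 g * X 1 0, fder x z01 g = z00 g * X 0 1 + z01 g * X 1 1,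
   fder x z10 g = z10 g * X 0 0 + z11 g * X 1 0 & fder x z11 g = z10 g * X 0 1 + z11 g * X 1 1].
Proof.
have [Q0 Q1 Q2 Q3] := rder_q R x.
have E0 := rdE Q0; have E1 := rdE Q1; have E2 := rdE Q2; have E3 := rdE Q3.
have N1 := rdE (rderN Q1); have N2 := rdE (rderN Q2).
by split; apply: ReIm_eq; rewrite fder.unlock /= ?cReD ?cImD ?cReM ?cImM /= /re /im /=
  ?E0 ?E1 ?E2 ?E3 ?N1 ?N2; case: (x) => /=; rewrite !mxE /=; ring.
Qed.

Lemma det_z g : z00 g * z11 g - z01 g * z10 g = 1.
Proof.
rewrite /z00 /z01 /z10 /z11; simpc; congr (_ +i* _); last by ring.
by rewrite -[RHS](q_norm g); ring.
Qed.

End ComplexCalculus.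

(** * The maximum principle, and surjectivity of the exponential map *)

Section MaximumPrinciple.
Variable R : realType.
Local Notation C := R[i].
Local Notation G := (SU2 R).
Implicit Types (g k : G) (f h : G -> C) (x y z : axis) (n : nat) (a b c : C) (w : int).

(** If l were positive, the first derivative, which vanishes at the maximum, would be positive just
    to the right of it, and u would increase there. *)
Lemma second_derivative_max (u u1 : R -> R) (l : R) :
  (forall t : R, is_derive t 1 u (u1 t)) -> is_derive (0 : R) 1 u1 l ->
  (forall t, u t <= u 0) -> l <= 0.
Proof.
move=> D1 D2 M; rewrite leNgt; apply/negP => l0.
have D0 : u1 0 = 0.
  apply: (is_derive_unique (D1 0)).
  have l11 : (-1 : R) <= 1 by lra.
  have m0 : (0 : R) \in `](-1), 1[ by rewrite in_itv /=; apply/andP; split; lra.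
  exact: (derive1_at_max l11 (fun t _ => @ex_derive _ _ _ _ _ _ _ (D1 t)) m0 (fun t _ => M t)).
have l20 : 0 < l / 2 by rewrite divr_gt0.
have [e e0 He] := (is_derive_eps u1 0 l).1 D2 _ l20.
have t0 : 0 < e / 2 by rewrite divr_gt0.
have [|c] := @MVT _ u u1 0 (e / 2) t0 (fun s _ => D1 s).
  by apply: derivable_within_continuous => s _; exact: ex_derive.
rewrite in_itv /= => /andP[c0 ce] E.
have := He c; rewrite add0r D0 subr0 gtr0_norm // => /(_ _).
have -> : (c < e) = true by apply: lt_trans ce _; rewrite ltr_pdivrMr // ltr_pMr // ltr1n.
move=> /(_ isT); rewrite ler_norml => /andP[h _].
have u1c : 0 < u1 c by have := mulr_gt0 l20 c0; lra.
have : 0 < u (e / 2) - u 0 by rewrite E subr0 mulr_gt0.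
by rewrite subr_gt0 ltNge M.
Qed.

Lemma rd_max (u : G -> R) g0 x : rC 2 u -> (forall g, u g <= u g0) -> rd x (rd x u) g0 <= 0.
Proof.
move=> [cu /(_ x)[D1 [_ /(_ x)[D2 _]]]] M.
have H := is_derive_flow D1 g0.
apply: (second_derivative_max H (D2 g0)) => t; rewrite flow0 mulg1; exact: M.
Qed.

(** At a maximum of |f|^2, which exists by compactness, the second derivatives along J and K are at
    most 0. Their sum is twice a sum of squares of first derivatives plus 2 Re(c) |f|^2, so that
    |f|^2 is at most 0 there. *)
Lemma maximum_principle f c : smoothC f ->
  (forall g, fder AJ (fder AJ f) g + fder AK (fder AK f) g = c * f g) -> 0 < complex.Re c ->
  forall g, f g = 0.
Proof.
move=> [su sv] E c0.
pose F g := re f g * re f g + im f g * im f g.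
have sF : smoothR F by move=> n; apply: rCD; apply: rCM; [exact: su|exact: su|exact: sv|exact: sv].
have [g0 M] := SU2_max (smoothR_cont sF).
have dF x : rd x F = fun g => 2 * (re f g * rd x (re f) g + im f g * rd x (im f) g).
  rewrite (rdE (rderD (rderM (smoothR_rder x su) (smoothR_rder x su)) (rderM (smoothR_rder x sv) (smoothR_rder x sv)))).
  by apply/funext => g; ring.
have ddF x : rd x (rd x F) g0 = 2 * (rd x (re f) g0 ^+ 2 + rd x (im f) g0 ^+ 2 +
    (re f g0 * rd x (rd x (re f)) g0 + im f g0 * rd x (rd x (im f)) g0)).
  rewrite dF.
  have sxu := smoothR_rd x su; have sxv := smoothR_rd x sv.
  rewrite (rdE (rderM (@rder_cst _ x 2) (rderD (rderM (smoothR_rder x su) (smoothR_rder x sxu))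
    (rderM (smoothR_rder x sv) (smoothR_rder x sxv))))).
  by ring.
have H x := rd_max x (sF 2%N) M.
have := lerD (H AJ) (H AK); rewrite addr0 !ddF => K.
have [Eu Ev] : rd AJ (rd AJ (re f)) g0 + rd AK (rd AK (re f)) g0 =
    complex.Re c * re f g0 - complex.Im c * im f g0 /\
    rd AJ (rd AJ (im f)) g0 + rd AK (rd AK (im f)) g0 =
    complex.Re c * im f g0 + complex.Im c * re f g0.
  have := E g0; rewrite -!re_d -!im_d /re /im.
  case: (fder AJ _ g0) (fder AK _ g0) (f g0) c {E c0} => [a1 a2] [b1 b2] [f1 f2] [c1 c2] /=.
  by case=> -> ->; split; ring.
have F0 : F g0 <= 0.
  have Eq : (re f g0 * rd AJ (rd AJ (re f)) g0 + im f g0 * rd AJ (rd AJ (im f)) g0) +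
    (re f g0 * rd AK (rd AK (re f)) g0 + im f g0 * rd AK (rd AK (im f)) g0) = complex.Re c * F g0.
    rewrite addrACA -!mulrDr Eu Ev /F; ring.
  have := sqr_ge0 (rd AJ (re f) g0); have := sqr_ge0 (rd AJ (im f) g0).
  have := sqr_ge0 (rd AK (re f) g0); have := sqr_ge0 (rd AK (im f) g0).
  move=> h1 h2 h3 h4; have : complex.Re c * F g0 <= 0 by lra.
  by rewrite pmulr_rle0.
move=> g; have := le_trans (M g) F0; rewrite /F -!expr2 => Fg.
have : re f g ^+ 2 + im f g ^+ 2 == 0 by rewrite eq_le Fg addr_ge0 ?sqr_ge0.
rewrite paddr_eq0 ?sqr_ge0 // !sqrf_eq0 /re /im => /andP[/eqP f1 /eqP f2].
exact: ReIm_eq.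
Qed.

Lemma unit_circle_angle (p q : R) : p ^+ 2 + q ^+ 2 = 1 -> 0 <= q ->
  exists t, cos t = p /\ sin t = q.
Proof.
move=> h q0'; have p1 : -1 <= p <= 1 by apply/andP; split; nra.
exists (acos p); rewrite acosK //; split=> //.
by rewrite sin_acos // -h addrC addKr sqrtr_sqr ger0_norm.
Qed.

(** A unit quaternion is cos t + sin t times a unit imaginary one; the norm r of the imaginary part
    is nonnegative, so t = acos q0 has sin t = r. *)
Lemma flow_surj g : exists X : R * R * R, g = flow (su2v X.1.1 X.1.2 X.2) 1.
Proof.
pose r := Num.sqrt (q1 g ^+ 2 + q2 g ^+ 2 + q3 g ^+ 2).
have s0 : 0 <= q1 g ^+ 2 + q2 g ^+ 2 + q3 g ^+ 2 by rewrite !addr_ge0 ?sqr_ge0.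
have r2 : r ^+ 2 = q1 g ^+ 2 + q2 g ^+ 2 + q3 g ^+ 2 by rewrite sqr_sqrtr.
have [u [v [w' [h E1 E2 E3]]]] : exists u v w : R, [/\ u ^+ 2 + v ^+ 2 + w ^+ 2 = 1,
    q1 g = r * u, q2 g = r * v & q3 g = r * w].
  have [r0|rN0] := eqVneq r 0.
    have : q1 g ^+ 2 + q2 g ^+ 2 + q3 g ^+ 2 == 0 by rewrite -r2 r0 expr0n.
    rewrite !paddr_eq0 ?addr_ge0 ?sqr_ge0 // !sqrf_eq0.
    move=> /andP[/andP[/eqP -> /eqP ->] /eqP ->].
    by exists 1, 0, 0; rewrite r0 !mul0r !expr0n /= expr1n !addr0.
  exists (q1 g / r), (q2 g / r), (q3 g / r); split; [|by field..].
  by rewrite !expr_div_n -!mulrDl -r2 divff ?expf_neq0.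
have [|t [ct st]] := @unit_circle_angle (q0 g) r _ (sqrtr_ge0 _).
  by rewrite r2 -(q_norm g); ring.
exists (t * u, t * v, t * w'); rewrite /= flow_scale mulr1.
have [A0 A1 A2 A3] := flow_unit t h.
by apply: SU2_ext; rewrite ?A0 ?A1 ?A2 ?A3 ?E1 ?E2 ?E3 ?ct ?st.
Qed.

(** Every g is reached from 1 along a one-parameter subgroup, on which u has derivative 0 by
    linearity; surjectivity of the exponential replaces a connectedness argument. *)
Lemma rd0_cst (u : G -> R) : rC 1 u -> (forall x, rd x u = fun=> 0) -> forall g, u g = u 1%g.
Proof.
move=> Cu H g; have [[[a b] c] ->] := flow_surj g; rewrite /=.
have D (t : R) : is_derive t 1 (fun t => u (1 * flow (su2v a b c) t)%g) 0.
  have := is_derive_flow (is_derive_lin a b c Cu) 1%g t.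
  by rewrite !H !mulr0 !addr0.
have := @is_derive_0_is_cst _ _ 1 0 D; rewrite /= !mul1g => ->.
by rewrite flow0.
Qed.

Lemma d0_cst f : smoothC f -> (forall x, fder x f = fun=> 0) -> forall g, f g = f 1%g.
Proof.
move=> [su sv] H g; apply: ReIm_eq.
  apply: (rd0_cst (su 1%N)) => x; rewrite -re_d H //.
apply: (rd0_cst (sv 1%N)) => x; rewrite -im_d H //.
Qed.

Lemma dJ_AB f g : fder AJ f g = (opA f g - opB f g) / 2.
Proof. by rewrite /opA /opB; field. Qed.

Lemma dK_AB f g : fder AK f g = - ii R * (opA f g + opB f g) / 2.
Proof. by rewrite /opA /opB; field: (iiM R). Qed.

End MaximumPrinciple.

(** * Highest weight vectors *)

Section HighestWeight.
Variable R : realType.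
Local Notation C := R[i].
Local Notation G := (SU2 R).
Implicit Types (g : G) (f h : G -> C) (x : axis) (n j a : nat) (c : C) (w : int).

Lemma ReZ_int (w : int) : complex.Re (w%:~R : C) = w%:~R.
Proof. by rewrite -(rmorph_int (real_complex R)). Qed.

Lemma laplaceE f c w g : smoothC f -> wt w f -> (forall g, opA (opB f) g = c * f g) ->
  fder AJ (fder AJ f) g + fder AK (fder AK f) g = - (c + 2 * w%:~R) * f g.
Proof.
by move=> sf wf E; have := opAB g sf; rewrite E wf => E';
  apply: oppr_inj; rewrite -[LHS](addrK (2 * ii R * (ii R * w%:~R * f g))) -E'; ring: (iiM R).
Qed.

(** On weight w the operator AB + 2w is minus the sub-Laplacian, so by the maximum principle its
    eigenvalues cannot have negative real part. *)
Lemma eigen_bound f c w : smoothC f -> wt w f -> (forall g, opA (opB f) g = c * f g) ->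
  complex.Re c + 2 * w%:~R < 0 -> forall g, f g = 0.
Proof.
move=> sf wf E cw; apply: (@maximum_principle _ _ (- (c + 2 * w%:~R)) sf).
  by move=> g; exact: laplaceE.
have -> : complex.Re (- (c + 2 * w%:~R)) = - (complex.Re c + 2 * w%:~R).
  have : complex.Re (c + 2 * w%:~R) = complex.Re c + 2 * w%:~R.
    have -> : 2 * w%:~R = w%:~R + w%:~R :> C by ring.
    by rewrite !cReD ReZ_int; ring.
  by case: (c + _) => ? ? /= ->.
by rewrite oppr_gt0.
Qed.

Lemma holomorphic_neg f w : smoothC f -> wt w f -> (forall g, opB f g = 0) -> w < 0 ->
  forall g, f g = 0.
Proof.
move=> sf wf B0 w0; apply: (@eigen_bound _ 0 _ sf wf).
  by move=> g; rewrite mul0r (_ : opB f = fun=> 0) ?opA0 //; apply/funext.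
by rewrite /= add0r pmulr_rlt0 // ltrz0.
Qed.

Lemma opB_z : [/\ forall g, opB (@z00 R) g = 0, forall g, opB (@z01 R) g = - 2 * z00 g,
  forall g, opB (@z10 R) g = 0 & forall g, opB (@z11 R) g = - 2 * z10 g].
Proof.
by split=> g; have [J0 J1 J2 J3] := d_z AJ g; have [K0 K1 K2 K3] := d_z AK g;
  rewrite /opB ?J0 ?J1 ?J2 ?J3 ?K0 ?K1 ?K2 ?K3 !mxE /= -/(ii R); ring: (iiM R).
Qed.

Lemma wt_z : [/\ wt 1 (@z00 R), wt (-1) (@z01 R), wt 1 (@z10 R) & wt (-1) (@z11 R)].
Proof.
have iN : 0 +i* (-1) = - ii R by rewrite /ii; simpc.
by split=> g; have [I0 I1 I2 I3] := d_z AI g;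
  rewrite ?I0 ?I1 ?I2 ?I3 !mxE /= ?iN -/(ii R) ?mulrN1z; ring.
Qed.

Definition mono n j : G -> C := fun g => z00 g ^+ j * z10 g ^+ (n - j).

(* Induction on n: with u = z00, v = z10 the functions
   p = n z11 f + z10 A f / 2 and q = - n z01 f - z00 A f / 2 are again killed by B,
   have weight n - 1, and u p + v q = n f because det g = 1. *)
Lemma holomorphic_poly n f : smoothC f -> wt n f -> (forall g, opB f g = 0) ->
  exists k : nat -> C, forall g, f g = \sum_(a < n.+1) k a * mono n a g.
Proof.
have [s00 s01 s10 s11] := smoothC_z R.
have [B00 B01 B10 B11] := opB_z; have [w00 w01 w10 w11] := wt_z.
elim: n f => [|n IH] f sf wf Bf.
  have Bf0 : opB f = fun=> 0 by apply/funext.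
  (* In weight 0 the commutator vanishes, so Af is again killed by B; its weight is -2, hence Af =
     0. All derivatives of f then vanish and f is constant. *)
  have A0 : forall g, opA f g = 0.
    apply: (@holomorphic_neg _ (0 - 2)) => //; [exact: smoothCA|exact: wtA|].
    by move=> g; rewrite (opBA_wt g sf wf) Bf0 opA0; ring.
  have D x : fder x f = fun=> 0.
    apply/funext => g; case: x.
    - by rewrite wf; ring.
    - by rewrite dJ_AB A0 Bf; ring.
    - by rewrite dK_AB A0 Bf; ring.
  exists (fun=> f 1%g) => g.
  by rewrite big_ord_recl big_ord0 /mono !expr0 !mulr1 addr0; exact: d0_cst.
have n0 : n.+1%:R != 0 :> C by rewrite pnatr_eq0.
have sA := smoothCA sf.
have wA := wtA sf wf.
have Bf0 : opB f = fun=> 0 by apply/funext.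
have BA g : opB (opA f) g = 4 * n.+1%:R * f g.
  by rewrite (opBA_wt g sf wf) Bf0 opA0 add0r.
pose p g := n.+1%:R * (z11 g * f g) + 2^-1 * (z10 g * opA f g).
pose q g := - n.+1%:R * (z01 g * f g) + - 2^-1 * (z00 g * opA f g).
have s1 := smoothCM s11 sf; have s2 := smoothCM s10 sA; have s3 := smoothCM s01 sf; have s4 := smoothCM s00 sA.
have [k kE] : exists k : nat -> C, forall g, p g = \sum_(a < n.+1) k a * mono n a g.
  apply: IH.
  - by apply: smoothCD; exact: smoothCZ.
  - have e1 : n%:Z = -1 + n.+1%:Z by lia.
    have e2 : n%:Z = 1 + (n.+1%:Z - 2) by lia.
    apply: wtD; [exact: smoothCZ|exact: smoothCZ| |]; apply: wtZ => //.
      by rewrite e1; apply: wtM.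
    by rewrite e2; apply: wtM.
  - move=> g; rewrite /p opBD ?opBZ ?opBM //; try exact: smoothCZ.
    by rewrite B11 B10 Bf BA; field.
have [l lE] : exists l : nat -> C, forall g, q g = \sum_(a < n.+1) l a * mono n a g.
  apply: IH.
  - by apply: smoothCD; exact: smoothCZ.
  - have e1 : n%:Z = -1 + n.+1%:Z by lia.
    have e2 : n%:Z = 1 + (n.+1%:Z - 2) by lia.
    apply: wtD; [exact: smoothCZ|exact: smoothCZ| |]; apply: wtZ => //.
      by rewrite e1; apply: wtM.
    by rewrite e2; apply: wtM.
  - move=> g; rewrite /q opBD ?opBZ ?opBM //; try exact: smoothCZ.
    by rewrite B00 B01 Bf BA; field.
(* Multiplying by z00 shifts the exponent a by one, multiplying by z10 keeps it. The guard discards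
   the value of [l] beyond n, about which nothing is known. *)
exists (fun a => ((if a is a'.+1 then k a' else 0) + (if (a <= n)%N then l a else 0)) / n.+1%:R).
move=> g.
have E : n.+1%:R * f g = z00 g * p g + z10 g * q g.
  rewrite /p /q -[LHS]mul1r -(det_z g); ring.
apply: (mulfI n0); rewrite E kE lE mulr_sumr mulr_sumr mulr_sumr.
under [RHS]eq_bigr => i _ do rewrite mulrA [X in X * _]mulrC divfK // mulrDl.
rewrite big_split /=; congr (_ + _).
  rewrite [RHS]big_ord_recl mul0r add0r; apply: eq_bigr => i _.
  by rewrite /mono /= /bump /= add1n subSS exprS; ring.
rewrite [RHS]big_ord_recr /= ltnn mul0r addr0; apply: eq_bigr => i _.
have ilen : (i <= n)%N by rewrite -ltnS.
by rewrite /mono ilen (subSn ilen) [_ ^+ (n - i).+1]exprS; ring.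
Qed.

Definition wvec n j (a : nat) : G -> C := iter j (@opA R) (mono n a).

Lemma smoothC_expr f n : smoothC f -> smoothC (fun g => f g ^+ n).
Proof.
move=> sf; elim: n => [|n IH].
  by have -> : (fun g => f g ^+ 0) = fun=> 1; [apply/funext|exact: smoothC_cst].
have -> : (fun g => f g ^+ n.+1) = fun g => f g * f g ^+ n by apply/funext => g; rewrite exprS.
exact: smoothCM.
Qed.

Lemma smoothC_mono n a : smoothC (mono n a).
Proof. by have [s00 _ s10 _] := smoothC_z R; apply: smoothCM; exact: smoothC_expr. Qed.

Lemma smoothC_iterA f n : smoothC f -> smoothC (iter n (@opA R) f).
Proof. by move=> sf; elim: n => //= n; exact: smoothCA. Qed.

Lemma smoothC_iterB f n : smoothC f -> smoothC (iter n (@opB R) f).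
Proof. by move=> sf; elim: n => //= n; exact: smoothCB. Qed.

Lemma smoothC_wvec n j a : smoothC (wvec n j a).
Proof. exact/smoothC_iterA/smoothC_mono. Qed.

Lemma wt_iterA w f n : smoothC f -> wt w f -> wt (w - (2 * n)%N%:Z) (iter n (@opA R) f).
Proof.
move=> sf wf; elim: n => [|n IH]; first by rewrite muln0 subr0.
have -> : w - (2 * n.+1)%N%:Z = w - (2 * n)%N%:Z - 2 by lia.
by apply: wtA => //; exact: smoothC_iterA.
Qed.

Lemma wt_iterB w f n : smoothC f -> wt w f -> wt (w + (2 * n)%N%:Z) (iter n (@opB R) f).
Proof.
move=> sf wf; elim: n => [|n IH]; first by rewrite muln0 addr0.
have -> : w + (2 * n.+1)%N%:Z = w + (2 * n)%N%:Z + 2 by lia.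
by apply: wtB => //; exact: smoothC_iterB.
Qed.

Lemma wt_expr f n : smoothC f -> wt 1 f -> wt n (fun g => f g ^+ n).
Proof.
move=> sf wf; elim: n => [|n IH].
  have -> : (fun g => f g ^+ 0) = fun=> 1 by apply/funext.
  by move=> g; rewrite d_cst; ring.
have -> : (fun g => f g ^+ n.+1) = fun g => f g * f g ^+ n by apply/funext => g; rewrite exprS.
have -> : n.+1%:Z = 1 + n%:Z by lia.
by apply: wtM => //; exact: smoothC_expr.
Qed.

Lemma opB_expr f n : smoothC f -> (forall g, opB f g = 0) -> forall g, opB (fun g => f g ^+ n) g = 0.
Proof.
move=> sf Bf; elim: n => [|n IH] g.
  have -> : (fun g => f g ^+ 0) = fun=> 1 by apply/funext.
  by rewrite /opB !d_cst; ring.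
have -> : (fun g => f g ^+ n.+1) = fun g => f g * f g ^+ n by apply/funext => k; rewrite exprS.
by rewrite opBM ?Bf ?IH //; [ring|exact: smoothC_expr].
Qed.

Lemma opB_mono n a g : opB (mono n a) g = 0.
Proof.
have [s00 _ s10 _] := smoothC_z R; have [B00 _ B10 _] := opB_z.
by rewrite opBM ?opB_expr //; try exact: smoothC_expr; ring.
Qed.

Lemma wt_mono n a : (a <= n)%N -> wt n (mono n a).
Proof.
move=> an; have [s00 _ s10 _] := smoothC_z R; have [w00 _ w10 _] := wt_z.
have -> : n%:Z = a%:Z + (n - a)%N%:Z by lia.
by apply: wtM; try exact: smoothC_expr; exact: wt_expr.
Qed.

Lemma wt_wvec n j a : (a <= n)%N -> wt (n%:Z - (2 * j)%N%:Z) (wvec n j a).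
Proof. by move=> an; apply: wt_iterA; [exact: smoothC_mono|exact: wt_mono]. Qed.

(* Eigenvalue of AB on the vectors of weight n - 2 j of the representation of
   highest weight n. *)
Definition casimir n j : C := (n%:R + 1) ^+ 2 - (n%:R - 2 * j%:R + 1) ^+ 2.

(** Each application of A adds 4w to the eigenvalue, where w = n - 2j is the current weight, and 4w
    = (w + 1)^2 - (w - 1)^2 telescopes. *)
Lemma opAB_wvec n j a g : (a <= n)%N -> opA (opB (wvec n j a)) g = casimir n j * wvec n j a g.
Proof.
move=> an; elim: j g => [|j IH] g.
  have -> : opB (wvec n 0 a) = fun=> 0 by apply/funext => k; exact: opB_mono.
  by rewrite opA0 /casimir; ring.
have sb := smoothC_wvec n j a.
have -> : opB (wvec n j.+1 a) = fun g => casimir n j.+1 * wvec n j a g.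
  apply/funext => k; rewrite /wvec iterS -/(wvec n j a).
  rewrite (opBA_wt k sb (wt_wvec j an)) IH /casimir intrB.
  by rewrite -[in RHS]natr1 !pmulrn -!pmulrn natrM; ring.
by rewrite opAZ.
Qed.

Lemma opB_wvec n j a g : (a <= n)%N -> opB (wvec n j.+1 a) g = casimir n j.+1 * wvec n j a g.
Proof.
move=> an; have sb := smoothC_wvec n j a.
rewrite /wvec iterS -/(wvec n j a) (opBA_wt g sb (wt_wvec j an)) opAB_wvec // /casimir intrB.
by rewrite -[in RHS]natr1 -!pmulrn natrM; ring.
Qed.

(** The Casimir value, eigenvalue plus (weight + 1)^2, is not changed by raising. *)
Lemma opAB_iterB f c w j g : smoothC f -> wt w f -> (forall g, opA (opB f) g = c * f g) ->
  opA (opB (iter j (@opB R) f)) g =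
  (c + (w%:~R + 1) ^+ 2 - (w%:~R + 2 * j%:R + 1) ^+ 2) * iter j (@opB R) f g.
Proof.
move=> sf wf E; elim: j g => [|j IH] g /=; first by rewrite E; ring.
have sj := smoothC_iterB j sf.
have := opBA_wt g (smoothCB sj) (wt_iterB j.+1 sf wf).
have -> : opA (opB (iter j (@opB R) f)) = (fun g => (c + (w%:~R + 1) ^+ 2 -
  (w%:~R + 2 * j%:R + 1) ^+ 2) * iter j (@opB R) f g) by apply/funext.
rewrite opBZ // => E2.
rewrite (canRL (addrK _) (esym E2)) intrD -natr1 -pmulrn natrM -natr1; ring.
Qed.

Lemma iterA_Z c f j g : smoothC f -> iter j (@opA R) (fun g => c * f g) g = c * iter j (@opA R) f g.
Proof.
move=> sf; elim: j g => //= j IH g.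
have -> : iter j (@opA R) (fun g => c * f g) = fun g => c * iter j (@opA R) f g by apply/funext.
by rewrite opAZ //; exact: smoothC_iterA.
Qed.

Lemma smoothC_sum (m : nat) (F : nat -> G -> C) : (forall i, smoothC (F i)) ->
  smoothC (fun g => \sum_(i < m) F i g).
Proof.
move=> H; elim: m => [|m IH].
  have -> : (fun g => \sum_(i < 0) F i g) = fun=> 0 by apply/funext => g; rewrite big_ord0.
  exact: smoothC_cst.
have -> : (fun g => \sum_(i < m.+1) F i g) = fun g => \sum_(i < m) F i g + F m g.
  by apply/funext => g; rewrite big_ord_recr.
exact: smoothCD.
Qed.

Lemma opA_sum (m : nat) (F : nat -> G -> C) g : (forall i, smoothC (F i)) ->
  opA (fun g => \sum_(i < m) F i g) g = \sum_(i < m) opA (F i) g.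
Proof.
move=> H; elim: m => [|m IH].
  have -> : (fun g => \sum_(i < 0) F i g) = fun=> 0 by apply/funext => k; rewrite big_ord0.
  by rewrite opA0 big_ord0.
have -> : (fun g => \sum_(i < m.+1) F i g) = fun g => \sum_(i < m) F i g + F m g.
  by apply/funext => k; rewrite big_ord_recr.
by rewrite opAD ?IH ?big_ord_recr //; exact: smoothC_sum.
Qed.

Lemma opB_sum (m : nat) (F : nat -> G -> C) g : (forall i, smoothC (F i)) ->
  opB (fun g => \sum_(i < m) F i g) g = \sum_(i < m) opB (F i) g.
Proof.
move=> H; elim: m => [|m IH].
  have -> : (fun g => \sum_(i < 0) F i g) = fun=> 0 by apply/funext => k; rewrite big_ord0.
  by rewrite opB0 big_ord0.
have -> : (fun g => \sum_(i < m.+1) F i g) = fun g => \sum_(i < m) F i g + F m g.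
  by apply/funext => k; rewrite big_ord_recr.
by rewrite opBD ?IH ?big_ord_recr //; exact: smoothC_sum.
Qed.

Lemma iterA_sum (m j : nat) (F : nat -> G -> C) g : (forall i, smoothC (F i)) ->
  iter j (@opA R) (fun g => \sum_(i < m) F i g) g = \sum_(i < m) iter j (@opA R) (F i) g.
Proof.
move=> H; elim: j g => //= j IH g.
have -> : iter j (@opA R) (fun g => \sum_(i < m) F i g) =
  fun g => \sum_(i < m) iter j (@opA R) (F i) g by apply/funext.
by apply: (@opA_sum m (fun i => iter j (@opA R) (F i))) => i; exact: smoothC_iterA.
Qed.

Lemma int_sqr_bound (w n : int) : 0 <= n -> w ^+ 2 <= n ^+ 2 + 2 * n -> (- n <= w) && (w <= n).
Proof. by move=> n0 h; apply/andP; split; nia. Qed.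

Lemma Re_casimir c w j : complex.Re (c + (w%:~R + 1) ^+ 2 - (w%:~R + 2 * j%:R + 1) ^+ 2) =
   complex.Re c + (w%:~R + 1) ^+ 2 - (w%:~R + 2 * j%:R + 1) ^+ 2.
Proof.
have -> : c + (w%:~R + 1) ^+ 2 - (w%:~R + 2 * j%:R + 1) ^+ 2 =
   c + (((w%:~R + 1) ^+ 2 - (w%:~R + 2 * j%:R + 1) ^+ 2)%R : R)%:C.
  rewrite rmorphB !rmorphXn /= !rmorphD /= rmorphM /= !rmorph_int !rmorph_nat.
  by rewrite rmorph1 addrA.
by rewrite cReD /= addrA.
Qed.

(* Raising to highest weight: the maximum principle kills B^j f for large j. *)
Lemma iterB_eventually0 f c w : smoothC f -> wt w f -> (forall g, opA (opB f) g = c * f g) ->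
  exists j, forall g, iter j (@opB R) f g = 0.
Proof.
move=> sf wf E.
pose M : R := `|complex.Re c + (w%:~R + 1) ^+ 2|.
(* This j makes the weight v = w + 2j at least 1 and larger than M. The quantity tested by
   [eigen_bound] is then at most M - (v + 1)^2 + 2v = M - v^2 - 1, which is negative. *)
pose j := (`|w|%N + (Num.truncn M).+1)%N; exists j => g.
apply: (eigen_bound (smoothC_iterB j sf) (wt_iterB j sf wf)
  (fun g => opAB_iterB j g sf wf E)).
rewrite Re_casimir.
have h1 : complex.Re c + (w%:~R + 1) ^+ 2 <= M by exact: ler_norm.
have h2 : M < (w + (2 * j)%N%:Z)%:~R.
  apply: lt_le_trans (truncnS_gt M) _.
  have -> : (Num.truncn M).+1%:R = ((Num.truncn M).+1%:Z)%:~R :> R by [].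
  by rewrite ler_int /j; lia.
have M0 : 0 <= M by exact: normr_ge0.
have -> : (w + (2 * j)%N%:Z)%:~R = w%:~R + 2 * j%:R :> R.
  by rewrite intrD -pmulrn natrM.
rewrite intrD -pmulrn natrM in h2.
have h3 : 1 <= w%:~R + 2 * j%:R :> R.
  have -> : w%:~R + 2 * j%:R = (w + (2 * j)%N%:Z)%:~R :> R by rewrite intrD -pmulrn natrM.
  by rewrite ler1z /j; lia.
set v := w%:~R + 2 * j%:R in h2 h3 *.
have : v <= v ^+ 2 by rewrite expr2 ler_peMl //; lra.
by move: h1 h2; move: (complex.Re c + _) => m; nra.
Qed.

End HighestWeight.

(** * Classification and linear independence of the weight vectors *)

Section WeightVectors.
Variable R : realType.
Local Notation C := R[i].
Local Notation G := (SU2 R).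
Implicit Types (g : G) (f h : G -> C) (x : axis) (n j a : nat) (c : C) (w : int).

Lemma casimir_nat n j : (j <= n.+1)%N -> casimir R n j = (4 * j * (n.+1 - j))%:R.
Proof.
by move=> jn; rewrite /casimir !natrM natrB // -[n.+1%:R]natr1; ring.
Qed.

Lemma casimir_neq0 n j : (0 < j <= n)%N -> casimir R n j != 0.
Proof.
move=> /andP[j0 jn]; rewrite casimir_nat ?(leqW jn) // pnatr_eq0 -lt0n !muln_gt0 j0 /=.
by rewrite subn_gt0 ltnS.
Qed.

Lemma natZC n : (n%:Z)%:~R = n%:R :> C.
Proof. by rewrite -pmulrn. Qed.

(** The last nonzero B^j f is a highest weight vector, hence a polynomial in the first column. Its
    Casimir value determines c, and A^j leads back from it to f up to nonzero factors. *)
Theorem weight_vector_span f c w : smoothC f -> wt w f ->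
  (forall g, opA (opB f) g = c * f g) -> (exists g, f g != 0) ->
  exists n j, [/\ (j <= n)%N, w = n%:Z - (2 * j)%N%:Z, c = casimir R n j &
    exists k : nat -> C, forall g, f g = \sum_(a < n.+1) k a * wvec n j a g].
Proof.
move=> sf wf E [g1 fg1].
have [J0 HJ0] := iterB_eventually0 sf wf E.
have exP : exists J, `[< forall g, iter J (@opB R) f g = 0 >] by exists J0; apply/asboolP.
case: (ex_minnP exP) => -[|j] /asboolP Bj minJ.
  by move: fg1; rewrite -[f g1]/(iter 0 (@opB R) f g1) Bj eqxx.
have [g2 hg2] : exists g, iter j (@opB R) f g != 0.
  apply: contrapT => H; suff /minJ : `[< forall g, iter j (@opB R) f g = 0 >] by rewrite ltnn.
  apply/asboolP => g; apply: contrapT => hg; apply: H; exists g; exact/eqP.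
pose h := iter j (@opB R) f.
have sh : smoothC h by exact: smoothC_iterB.
have wh : wt (w + (2 * j)%N%:Z) h by exact: wt_iterB.
have Bh : opB h = fun=> 0 by apply/funext => g; exact: Bj.
have cE : c + (w%:~R + 1) ^+ 2 - (w%:~R + 2 * j%:R + 1) ^+ 2 = 0.
  have := opAB_iterB j g2 sf wf E; rewrite -/h Bh opA0 => /esym/eqP.
  by rewrite mulf_eq0 (negbTE hg2) orbF => /eqP.
have n0 : 0 <= w + (2 * j)%N%:Z.
  rewrite leNgt; apply/negP => wneg; move: hg2; rewrite -/h.
  by rewrite (holomorphic_neg sh wh _ wneg) ?eqxx // => g; rewrite Bh.
pose n := absz (w + (2 * j)%N%:Z).
have nE : w + (2 * j)%N%:Z = n%:Z by rewrite /n; lia.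
have wE : w = n%:Z - (2 * j)%N%:Z by rewrite -nE; lia.
have cG : c = casimir R n j.
  rewrite /casimir; have -> : n%:R = w%:~R + 2 * j%:R :> C.
    by rewrite -natZC -nE intrD natZC natrM.
  move/eqP: cE; rewrite subr_eq0 => /eqP cE; rewrite -[LHS](addrK ((w%:~R + 1) ^+ 2)) cE; ring.
(* [eigen_bound] for f itself gives (n + 1)^2 - (w + 1)^2 + 2w >= 0, that is w^2 <= n^2 + 2n < (n +
   1)^2. Hence w = n - 2j is at least - n. *)
have jn : (j <= n)%N.
  have : 0 <= complex.Re c + 2 * w%:~R.
    rewrite leNgt; apply/negP => neg.
    by move: fg1; rewrite (eigen_bound sf wf E neg) eqxx.
  have -> : complex.Re c = ((n%:Z + 1) ^+ 2 - (w + 1) ^+ 2)%:~R.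
    have -> : c = (((n%:Z + 1) ^+ 2 - (w + 1) ^+ 2)%:~R : R)%:C.
      rewrite cG /casimir rmorph_int intrB !rmorphXn /= !rmorphD /= wE !intrB rmorph1 !natZC natrM.
      by ring.
    by [].
  have -> : 2 * w%:~R = (2 * w)%:~R :> R by rewrite intrM.
  rewrite -intrD ler0z => Hn.
  by have := @int_sqr_bound w n%:Z; lia.
rewrite nE in wh.
have [k kE] := holomorphic_poly sh wh (fun g => congr1 (fun F => F g) Bh).
(* Undoing one raising multiplies by [casimir R n (j - i)], where j - i runs through values between
   1 and n, so that no factor vanishes. *)
have [K KE] : exists K, forall g, f g = K * iter j (@opA R) h g.
  suff H i : (i <= j)%N -> exists K, forall g, f g = K * iter i (@opA R) (iter i (@opB R) f) g.
    exact: H.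
  elim: i => [|i IH] ij; first by exists 1 => g; rewrite mul1r.
  have [K KE] := IH (ltnW ij).
  have gi : casimir R n (j - i) != 0 by apply: casimir_neq0; lia.
  exists (K / casimir R n (j - i)) => g; rewrite KE -mulrA; congr (_ * _).
  have si : smoothC (iter i.+1 (@opB R) f) by exact: smoothC_iterB.
  rewrite iterSr -(iterA_Z (casimir R n (j - i))^-1 i g (smoothCA si)).
  congr (iter i (@opA R) _ g); apply/funext => k'.
  have := opAB_iterB i k' sf wf E; rewrite -iterS => ->.
  have -> : c + (w%:~R + 1) ^+ 2 - (w%:~R + 2 * i%:R + 1) ^+ 2 = casimir R n (j - i).
    rewrite cG /casimir wE intrB !natZC natrM natrB; [ring|lia].
  by rewrite mulKf.
exists n, j; split => //.
exists (fun a => K * k a) => g; rewrite KE.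
have -> : h = fun g => \sum_(a < n.+1) k a * mono n a g by apply/funext.
rewrite (@iterA_sum _ n.+1 j (fun a g => k a * mono n a g)); last first.
  by move=> i; apply: smoothCZ; exact: smoothC_mono.
rewrite mulr_sumr; apply: eq_bigr => i _.
by rewrite iterA_Z ?mulrA //; exact: smoothC_mono.
Qed.

(** For each natural number t there is a group element whose first column is (t, 1) divided by its
    norm r. There the relation becomes a polynomial identity at t, and a polynomial with all natural
    numbers as roots is zero. *)
Lemma mono_free n (k : nat -> C) : (forall g, \sum_(a < n.+1) k a * mono n a g = 0) ->
  forall a, (a <= n)%N -> k a = 0.
Proof.
move=> H.
pose p : {poly C} := \poly_(a < n.+1) k a.
have root_p (t : nat) : root p t%:R.
  pose r : R := Num.sqrt (1 + t%:R ^+ 2).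
  have r0 : 0 < r by rewrite sqrtr_gt0 ltr_pwDl // sqr_ge0.
  have r2 : r ^+ 2 = 1 + t%:R ^+ 2 by rewrite sqr_sqrtr // addr_ge0 ?sqr_ge0.
  have hq : (t%:R / r) ^+ 2 + 0 ^+ 2 + (- r^-1) ^+ 2 + 0 ^+ 2 = 1.
    rewrite sqrrN expr_div_n exprVn r2 -[0]/(0 : R) !expr0n /= !addr0 -[X in _ + X]mul1r -mulrDl.
    by rewrite addrC mulfV // gt_eqF // ltr_pwDl // sqr_ge0.
  have [Q0 Q1 Q2 Q3] := q_mkq hq.
  have := H (MkSU2 (mkq_subproof hq)); rewrite /mono /z00 /z10 Q0 Q1 Q2 Q3 opprK.
  have -> : (t%:R / r) +i* 0 = t%:R * (r^-1)%:C :> C.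
    by rewrite -(rmorph_nat (real_complex R)) -rmorphM.
  have -> : r^-1 +i* 0 = (r^-1)%:C :> C by [].
  have rC0 : (r^-1)%:C != 0 :> C by rewrite fmorph_eq0 invr_eq0 gt_eqF.
  rewrite /root horner_poly => Hs.
  have : (r^-1)%:C ^+ n * \sum_(i < n.+1) k i * t%:R ^+ i = 0.
    rewrite -[RHS]Hs mulr_sumr; apply: eq_bigr => i _.
    have i_n : (i <= n)%N by rewrite -ltnS.
    have -> : (r^-1)%:C ^+ n = (r^-1)%:C ^+ (n - i) * (r^-1)%:C ^+ i :> C.
      by rewrite -exprD subnK.
    by rewrite exprMn; ring.
  by move=> /eqP; rewrite mulf_eq0 expf_eq0 (negbTE rC0) andbF.
have p0 : p = 0.
  apply/eqP; apply: contraT => pN0.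
  have := max_poly_roots pN0 (rs := [seq (t%:R : C) | t <- iota 0 n.+1]).
  have -> : all (root p) [seq (t%:R : C) | t <- iota 0 n.+1].
    by apply/allP => x /mapP[t _ ->].
  rewrite map_inj_uniq ?iota_uniq => [|u v /eqP]; last by rewrite eqr_nat => /eqP.
  move=> /(_ isT isT); rewrite size_map size_iota => /leq_trans/(_ (size_poly _ _)).
  by rewrite ltnn.
move=> a an; have := congr1 (fun q : {poly C} => q`_a) p0.
by rewrite coef0 coef_poly ltnS an.
Qed.

(** Applying B to a relation lowers j by one, up to a Casimir factor that is nonzero for j <= n, and
    ends at the monomials. *)
Lemma wvec_free n j (k : nat -> C) : (j <= n)%N ->
  (forall g, \sum_(a < n.+1) k a * wvec n j a g = 0) ->
  forall a, (a <= n)%N -> k a = 0.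
Proof.
elim: j => [|j IH] jn H; first exact: mono_free.
apply: IH => [|g]; first exact: ltnW.
have gj : casimir R n j.+1 != 0 by apply: casimir_neq0.
apply: (mulfI gj); rewrite mulr0.
have : opB (fun g => \sum_(a < n.+1) k a * wvec n j.+1 a g) g = 0.
  have -> : (fun g => \sum_(a < n.+1) k a * wvec n j.+1 a g) = fun=> 0 by apply/funext.
  exact: opB0.
rewrite (@opB_sum _ _ (fun a g => k a * wvec n j.+1 a g)) => [H'|i]; last first.
  by apply: smoothCZ; exact: smoothC_wvec.
rewrite -[RHS]H'.
rewrite mulr_sumr; apply: eq_bigr => i _.
rewrite opBZ; last exact: smoothC_wvec.
by rewrite opB_wvec -1?ltnS // mulrCA.
Qed.

End WeightVectors.

(** * Fourier components along the circle generated by I *)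

Section Integrals.
Variable R : realType.
Local Notation C := R[i].
Local Notation G := (SU2 R).
Local Notation mu := (@lebesgue_measure R).
Implicit Types (g : G) (x : axis) (s t : R).

Definition circle : set R := `[0, 2 * pi]%classic.
Definition circ_int (u : R -> R) : R := \int[mu]_(t in circle) u t.

Lemma measurable_circle : measurable circle.
Proof. exact: measurable_itv. Qed.
#[local] Hint Resolve measurable_circle : core.

Lemma twopi_gt0 : 0 < 2 * pi :> R.
Proof. by rewrite mulr_gt0 // pi_gt0. Qed.

Lemma circ_int_integrable (u : R -> R) : continuous u -> mu.-integrable circle (EFin \o u).
Proof.
move=> cu; apply: continuous_compact_integrable; first exact: segment_compact.
exact: continuous_subspaceT.
Qed.

Lemma circ_intD (u v : R -> R) : continuous u -> continuous v ->
  circ_int (fun t => u t + v t) = circ_int u + circ_int v.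
Proof. by move=> cu cv; rewrite /circ_int RintegralD //; exact: circ_int_integrable. Qed.

Lemma circ_intB (u v : R -> R) : continuous u -> continuous v ->
  circ_int (fun t => u t - v t) = circ_int u - circ_int v.
Proof. by move=> cu cv; rewrite /circ_int RintegralB //; exact: circ_int_integrable. Qed.

Lemma circ_intZ r (u : R -> R) : continuous u -> circ_int (fun t => r * u t) = r * circ_int u.
Proof. by move=> cu; rewrite /circ_int RintegralZl //; exact: circ_int_integrable. Qed.

Lemma circ_int_cst r : circ_int (fun=> r) = 2 * pi * r.
Proof.
have E : mu circle = (2 * pi)%:E.
  rewrite /circle lebesgue_measure_itv; case: ifP => [_|]; first by rewrite sube0.
  by rewrite lte_fin twopi_gt0.
by rewrite /circ_int Rintegral_cst // mulrC; congr (_ * r); rewrite -[RHS]/(fine (2 * pi)%:E) -E.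
Qed.

Lemma circ_int_le (u v : R -> R) : continuous u -> continuous v ->
  (forall t, t \in `[0, 2 * pi] -> u t <= v t) -> circ_int u <= circ_int v.
Proof. by move=> cu cv H; apply: le_Rintegral => //; exact: circ_int_integrable. Qed.

Lemma circ_int_norm_le (u : R -> R) (e : R) : continuous u ->
  (forall t, t \in `[0, 2 * pi] -> `|u t| <= e) -> `|circ_int u| <= 2 * pi * e.
Proof.
move=> cu H.
have ce (r : R) : continuous (fun _ : R => r) by move=> t; exact: cvg_cst.
rewrite ler_norml -mulrN -!circ_int_cst; apply/andP; split; apply: circ_int_le => // t /H;
  by rewrite ler_norml => /andP[].
Qed.

Lemma circ_int_FTC (u u' : R -> R) : (forall t, is_derive t 1 u (u' t)) -> continuous u' ->
  circ_int u' = u (2 * pi) - u 0.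
Proof.
move=> D cu'; rewrite /circ_int /Rintegral /circle.
rewrite (@continuous_FTC2 _ u' u 0 (2 * pi)) //.
- exact: twopi_gt0.
- exact: continuous_subspaceT.
- have cu : continuous u by move=> t; apply/differentiable_continuous/derivable1_diffP; exact: ex_derive.
  split=> [t _||].
  + exact: ex_derive.
  + exact: (cvg_at_right_filter (cu _)).
  + exact: (cvg_at_left_filter (cu _)).
- by move=> t _; rewrite derive1E; exact: derive_val.
Qed.

Lemma circ_int_derive (U U' : R -> R -> R) (M : R) :
  (forall s, continuous (U s)) ->
  (forall s t, is_derive s 1 (U^~ t) (U' s t)) ->
  (forall s t, t \in `[0, 2 * pi] -> `|U' s t| <= M) ->
  is_derive (0 : R) 1 (fun s => circ_int (U s)) (circ_int (U' 0)).
Proof.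
move=> cU D HM.
have mB : measurable circle by exact: measurable_itv.
have I0 : `]-1, 1[%classic (0 : R) by rewrite /= in_itv /=; apply/andP; split; lra.
have cM : continuous (fun _ : R => `|M|) by move=> t; exact: cvg_cst.
have Ub s t : `]-1, 1[%classic s -> circle t -> `|partial1of2 U s t| <= `|M|.
  move=> _ tB; rewrite partial1of2E (@derive_val _ _ _ _ _ _ _ (D s t)).
  by apply: le_trans (HM s t tB) _; exact: ler_norm.
have H := @cvg_differentiation_under_integral R _ _ mu U circle mB 0 (-1) 1 I0
  (fun s _ => circ_int_integrable (cU s)) (fun s t _ _ => @ex_derive _ _ _ _ _ _ _ (D s t))
  (fun=> `|M|) (fun=> normr_ge0 _) (circ_int_integrable cM) Ub.
have E : circ_int (U' 0) = \int[mu]_(y in circle) partial1of2 U 0 y.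
  apply: eq_Rintegral => t _; rewrite partial1of2E.
  by rewrite (@derive_val _ _ _ _ _ _ _ (D 0 t)).
rewrite E.
have H' : h^-1 *: (circ_int (U (h *: 1 + 0)) - circ_int (U 0)) @[h --> 0^'] -->
    \int[mu]_(y in circle) partial1of2 U 0 y.
  by under eq_fun do rewrite scaler1.
split; first by apply/cvg_ex; eexists; exact: H'.
exact: cvg_lim H'.
Qed.

Lemma is_derive_continuous (u u' : R -> R) : (forall t : R, is_derive t 1 u (u' t)) -> continuous u.
Proof.
by move=> D t; apply/differentiable_continuous/derivable1_diffP; exact: ex_derive.
Qed.

(** Averages over the circle compare u at all points g exp(tI) at once, so the radius must not
    depend on the point. *)
Lemma SU2_uniform_continuous (u : G -> R) : continuous u -> forall e : R, 0 < e ->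
  exists2 d : R, 0 < d & forall g h, dist4 g h < d -> `|u g - u h| < e.
Proof.
move=> cu e e0.
pose P (r : R) g := forall h, dist4 g h < r -> `|u g - u h| < e.
have /compact_near_coveringP := @compact_SU2 R.
move=> /(_ R (nbhs (0 : R)^'+) P _) H.
have /H : forall g, [set: G] g -> \forall x' \near g & i \near (0 : R)^'+, P i x'.
  move=> g _; have e20 : 0 < e / 2 by rewrite divr_gt0.
  have [r r0 Hr] := (continuousGP u).1 cu g _ e20.
  have r20 : 0 < r / 2 by rewrite divr_gt0.
  exists ([set h | dist4 g h < r / 2], [set s | s < r / 2]).
    split; first by apply/nbhs_dist4; exists (r / 2).
    exact: nbhs_right_lt.
  move=> [h s] /= [hg sr] k hk.
  have h1 : `|u g - u h| < e / 2 by apply: Hr; lra.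
  have h2 : `|u g - u k| < e / 2.
    by apply: Hr; have := dist4_trans h g k; lra.
  have -> : u h - u k = (u g - u k) - (u g - u h) by ring.
  by apply: le_lt_trans (ler_normB _ _) _; lra.
move=> K; near (0 : R)^'+ => r.
exists r; first by near: r; exact: nbhs_right_gt.
move=> g h gh; have : [set: G] `<=` P r by near: r.
by move=> /(_ g I h gh).
Unshelve. all: by end_near. Qed.

Lemma circle_bounded (phi : R -> R) : continuous phi -> exists2 M : R, 0 < M &
  forall t, t \in `[0, 2 * pi] -> `|phi t| <= M.
Proof.
move=> cphi.
have [|c _ H] := @EVT_max _ (fun t => `|phi t|) 0 (2 * pi) (ltW twopi_gt0).
  by apply: continuous_subspaceT => t; apply: cvg_norm; exact: cphi.
exists (`|phi c| + 1) => [|t /H h]; first by rewrite ltr_wpDl.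
by apply: le_trans h _; rewrite lerDl.
Qed.

(** The coordinates of Ad(exp(-tI)) applied to an axis: I is fixed and the plane of J and K is
    rotated through the angle -2t. *)
Definition axrot (x : axis) (t : R) : R * R * R := match x with
  | AI => (1, 0, 0)
  | AJ => (0, cos (2 * t), - sin (2 * t))
  | AK => (0, sin (2 * t), cos (2 * t)) end.

Lemma conj_AI x s t : (flow (vec R x) s * flow (vec R AI) t = flow (vec R AI) t *
  flow (su2v (axrot x t).1.1 (axrot x t).1.2 (axrot x t).2) s)%g.
Proof.
set X := flow (vec R x) s; set Y := flow (vec R AI) t; set Z := flow _ s.
have unit x' : e1 R x' ^+ 2 + e2 R x' ^+ 2 + e3 R x' ^+ 2 = 1 by case: x' => /=; ring.
have cs : cos t ^+ 2 = 1 - sin t ^+ 2 by rewrite -(cos2Dsin2 t) addrK.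
have unitZ : (axrot x t).1.1 ^+ 2 + (axrot x t).1.2 ^+ 2 + (axrot x t).2 ^+ 2 = 1.
  have c2s := cos2Dsin2 (2 * t).
  by case: (x) => /=; [|rewrite -[RHS]c2s..]; ring.
have [X0 X1 X2 X3] := flow_unit s (unit x).
have [Y0 Y1 Y2 Y3] := flow_unit t (unit AI).
have [Z0 Z1 Z2 Z3] := flow_unit s unitZ.
have [A0 A1 A2 A3] := q_mul X Y; have [B0 B1 B2 B3] := q_mul Y Z.
have c2 : cos (2 * t) = cos t * cos t - sin t * sin t by rewrite -cosD mulr_natl mulr2n.
have s2 : sin (2 * t) = sin t * cos t + cos t * sin t by rewrite -sinD mulr_natl mulr2n.
apply: SU2_ext; [rewrite A0 B0|rewrite A1 B1|rewrite A2 B2|rewrite A3 B3];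
  rewrite X0 X1 X2 X3 Y0 Y1 Y2 Y3 Z0 Z1 Z2 Z3; case: (x) => /=; rewrite ?c2 ?s2; ring: cs.
Qed.

Lemma is_derive_conj_AI (u : G -> R) g s t x : rC 1 u ->
  is_derive s 1 (fun s => u (g * flow (vec R x) s * flow (vec R AI) t)%g)
   ((axrot x t).1.1 * rd AI u (g * flow (vec R x) s * flow (vec R AI) t)%g +
    (axrot x t).1.2 * rd AJ u (g * flow (vec R x) s * flow (vec R AI) t)%g +
    (axrot x t).2 * rd AK u (g * flow (vec R x) s * flow (vec R AI) t)%g).
Proof.
move=> Cu; apply/is_derive_eps => e e0.
have := is_derive_lin (axrot x t).1.1 (axrot x t).1.2 (axrot x t).2 Cu
  (g * flow (vec R x) s * flow (vec R AI) t)%g.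
move=> /is_derive_eps/(_ e e0)[d d0 Hd]; exists d => // h /Hd.
rewrite add0r flow0 mulg1.
by rewrite [flow _ (s + h)]flowD !mulgA -[(_ * flow _ h * _)%g]mulgA -/(vec R x) conj_AI !mulgA.
Qed.

(** The kernel is arbitrary because a derivative along J or K, moved past the flow of I, is rotated
    by an angle depending on t. The trigonometric factors are absorbed into the kernel, so this
    class of averages is closed under differentiation. *)
Definition circ_avg (phi : R -> R) (u : G -> R) : G -> R := fun g =>
  circ_int (fun t => phi t * u (g * flow (vec R AI) t)%g).

Lemma continuous_mul (phi psi : R -> R) : continuous phi -> continuous psi ->
  continuous (fun t => phi t * psi t).
Proof. by move=> c1 c2 t; exact: (cvgM (c1 t) (c2 t)). Qed.

Lemma continuous_add (phi psi : R -> R) : continuous phi -> continuous psi ->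
  continuous (fun t => phi t + psi t).
Proof. by move=> c1 c2 t; exact: (cvgD (c1 t) (c2 t)). Qed.

Lemma continuous_sub (phi psi : R -> R) : continuous phi -> continuous psi ->
  continuous (fun t => phi t - psi t).
Proof. by move=> c1 c2 t; exact: (cvgB (c1 t) (c2 t)). Qed.

Lemma continuous_orbit (u : G -> R) g : continuous u ->
  continuous (fun t => u (g * flow (vec R AI) t)%g).
Proof. exact: continuous_comp_flow. Qed.

Lemma circ_avg_cont phi u : continuous phi -> continuous u -> continuous (circ_avg phi u).
Proof.
move=> cphi cu; apply/continuousGP => g e e0.
have [M M0 HM] := circle_bounded cphi.
have pi0 : 0 < 2 * pi :> R := twopi_gt0.
have e'0 : 0 < e / (4 * pi * M) by rewrite divr_gt0 // !mulr_gt0 // pi_gt0.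
have [r r0 Hr] := SU2_uniform_continuous cu e'0.
exists (r / 4) => [|h gh]; first by rewrite divr_gt0.
rewrite /circ_avg -circ_intB; try by apply: continuous_mul => //; exact: continuous_orbit.
apply: (@le_lt_trans _ _ (2 * pi * (M * (e / (4 * pi * M))))).
  apply: circ_int_norm_le => [|t tB].
    by apply: continuous_sub; apply: continuous_mul => //; exact: continuous_orbit.
  rewrite -mulrBr normrM ler_pM //; first exact: HM.
  apply/ltW/Hr; apply: le_lt_trans (dist4_mulr _ _ _) _; lra.
have -> : 2 * pi * (M * (e / (4 * pi * M))) = e / 2.
  have K (a b c : R) : a != 0 -> b != 0 -> 2 * a * (b * (c / (4 * a * b))) = c / 2.
    by move=> a0 b0; field; rewrite a0 b0.
  by apply: K; rewrite gt_eqF // pi_gt0.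
lra.
Qed.

Lemma continuous_axrot x : [/\ continuous (fun t => (axrot x t).1.1),
  continuous (fun t => (axrot x t).1.2) & continuous (fun t => (axrot x t).2)].
Proof.
have c2 : continuous (fun t : R => cos (2 * t)).
  apply: (@is_derive_continuous _ (fun t => - (2 * sin (2 * t)))) => t.
  by apply: is_derive_eq; rewrite /GRing.scale /=; ring.
have s2 : continuous (fun t : R => sin (2 * t)).
  apply: (@is_derive_continuous _ (fun t => 2 * cos (2 * t))) => t.
  by apply: is_derive_eq; rewrite /GRing.scale /=; ring.
have cc (r : R) : continuous (fun _ : R => r) by move=> t; exact: cvg_cst.
case: x; split => //=; try exact: cc.
by move=> t; exact: (cvgN (s2 t)).
Qed.

Lemma circ_avg_der phi u x : continuous phi -> rC 1 u ->
  rder x (circ_avg phi u) (fun g => circ_avg (fun t => phi t * (axrot x t).1.1) (rd AI u) g +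
    circ_avg (fun t => phi t * (axrot x t).1.2) (rd AJ u) g +
    circ_avg (fun t => phi t * (axrot x t).2) (rd AK u) g).
Proof.
move=> cphi Cu g; have [cu H] := Cu.
have [_ [cI _]] := H AI; have [_ [cJ _]] := H AJ; have [_ [cK _]] := H AK.
have [r1 r2 r3] := continuous_axrot x.
pose p s t := (g * flow (vec R x) s * flow (vec R AI) t)%g.
pose U' s t := phi t * ((axrot x t).1.1 * rd AI u (p s t) + (axrot x t).1.2 * rd AJ u (p s t) +
   (axrot x t).2 * rd AK u (p s t)).
have -> : circ_avg (fun t => phi t * (axrot x t).1.1) (rd AI u) g +
    circ_avg (fun t => phi t * (axrot x t).1.2) (rd AJ u) g +
    circ_avg (fun t => phi t * (axrot x t).2) (rd AK u) g = circ_int (U' 0).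
  have cI' := continuous_mul (continuous_mul cphi r1) (@continuous_orbit _ g cI).
  have cJ' := continuous_mul (continuous_mul cphi r2) (@continuous_orbit _ g cJ).
  have cK' := continuous_mul (continuous_mul cphi r3) (@continuous_orbit _ g cK).
  rewrite /circ_avg -circ_intD // -circ_intD //; last exact: continuous_add.
  by congr circ_int; apply/funext => t; rewrite /U' /p flow0 mulg1; ring.
have [M1 M10 B1] := circle_bounded (continuous_mul cphi r1).
have [M2 M20 B2] := circle_bounded (continuous_mul cphi r2).
have [M3 M30 B3] := circle_bounded (continuous_mul cphi r3).
have [N1 N10 D1] := SU2_bounded cI; have [N2 N20 D2] := SU2_bounded cJ.
have [N3 N30 D3] := SU2_bounded cK.
apply: (@circ_int_derive (fun s t => phi t * u (p s t)) U' (M1 * N1 + M2 * N2 + M3 * N3)).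
- by move=> s; apply: continuous_mul => //; exact: continuous_orbit.
- move=> s t; have D := @is_derive_conj_AI u g s t x Cu.
  exact: is_deriveZ.
- move=> s t tB; rewrite /U' !mulrDr !mulrA.
  apply: le_trans (ler_normD _ _) _; apply: lerD; last first.
    by rewrite normrM ler_pM // ?B3 ?D3.
  apply: le_trans (ler_normD _ _) _; apply: lerD; rewrite normrM ler_pM //.
  + exact: B1.
  + exact: B2.
Qed.

Lemma circ_avg_rC n phi u : continuous phi -> rC n u -> rC n (circ_avg phi u).
Proof.
elim: n phi u => [|n IH] phi u cphi Cu.
  by split=> //; apply: circ_avg_cont => //; case: Cu.
have C1u : rC 1 u by elim: (n) Cu {IH} => // m IH /rC_pred /IH.
have [cu H] := Cu.
apply: (@rC_intro _ n _ _ (circ_avg_cont cphi cu)) => x.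
split; first exact: circ_avg_der.
have [r1 r2 r3] := continuous_axrot x.
have [_ CI] := H AI; have [_ CJ] := H AJ; have [_ CK] := H AK.
by apply: rCD; [apply: rCD|]; apply: IH => //; exact: continuous_mul.
Qed.

End Integrals.

(** * Fourier components of complex functions and their uniqueness *)

Section Fourier.
Variable R : realType.
Local Notation C := R[i].
Local Notation G := (SU2 R).
Implicit Types (g : G) (f h : G -> C) (x : axis) (s t : R) (w : int) (c : C) (phi psi : R -> C).

Definition ccont phi := continuous (fun t => complex.Re (phi t)) /\
  continuous (fun t => complex.Im (phi t)).

Definition cint phi : C := circ_int (fun t => complex.Re (phi t)) +i* circ_int (fun t => complex.Im (phi t)).

Lemma ccontD phi psi : ccont phi -> ccont psi -> ccont (fun t => phi t + psi t).
Proof.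
move=> [a1 a2] [b1 b2]; split.
  have -> : (fun t => complex.Re (phi t + psi t)) =
    fun t => complex.Re (phi t) + complex.Re (psi t) by apply/funext => t; rewrite cReD.
  exact: continuous_add.
have -> : (fun t => complex.Im (phi t + psi t)) =
  fun t => complex.Im (phi t) + complex.Im (psi t) by apply/funext => t; rewrite cImD.
exact: continuous_add.
Qed.

Lemma ccontM phi psi : ccont phi -> ccont psi -> ccont (fun t => phi t * psi t).
Proof.
move=> [a1 a2] [b1 b2]; split.
  have -> : (fun t => complex.Re (phi t * psi t)) = fun t => complex.Re (phi t) * complex.Re (psi t)
    - complex.Im (phi t) * complex.Im (psi t) by apply/funext => t; rewrite cReM.
  by apply: continuous_sub; exact: continuous_mul.
have -> : (fun t => complex.Im (phi t * psi t)) = fun t => complex.Re (phi t) * complex.Im (psi t)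
  + complex.Im (phi t) * complex.Re (psi t) by apply/funext => t; rewrite cImM.
by apply: continuous_add; exact: continuous_mul.
Qed.

Lemma ccont_cst c : ccont (fun=> c).
Proof. by split=> t; exact: cvg_cst. Qed.

Lemma cintD phi psi : ccont phi -> ccont psi ->
  cint (fun t => phi t + psi t) = cint phi + cint psi.
Proof.
move=> [a1 a2] [b1 b2]; apply: ReIm_eq; rewrite ?cReD ?cImD /=.
  by rewrite -circ_intD //; congr circ_int; apply/funext => t; rewrite cReD.
by rewrite -circ_intD //; congr circ_int; apply/funext => t; rewrite cImD.
Qed.

Lemma cintZ c phi : ccont phi -> cint (fun t => c * phi t) = c * cint phi.
Proof.
move=> [a1 a2].
have cZ (r : R) (u : R -> R) : continuous u -> continuous (fun t => r * u t).
  by apply: continuous_mul => t; exact: cvg_cst.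
apply: ReIm_eq; rewrite ?cReM ?cImM /=.
  rewrite -!circ_intZ // -circ_intB; try exact: cZ.
  by congr circ_int; apply/funext => t; rewrite cReM.
rewrite -!circ_intZ // -circ_intD; try exact: cZ.
by congr circ_int; apply/funext => t; rewrite cImM.
Qed.

Lemma cint_cst c : cint (fun=> c) = (2 * pi)%:C * c.
Proof. by rewrite /cint !circ_int_cst; apply: ReIm_eq; rewrite ?cReM ?cImM /=; ring. Qed.

Lemma ccont_orbit f g : smoothC f -> ccont (fun t => f (g * flow (vec R AI) t)%g).
Proof.
by move=> [/smoothR_cont c1 /smoothR_cont c2]; split; [exact: (continuous_orbit c1)|exact: (continuous_orbit c2)].
Qed.

Definition avg phi f : G -> C := fun g => cint (fun t => phi t * f (g * flow (vec R AI) t)%g).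

Lemma re_avg phi f : ccont phi -> smoothC f -> re (avg phi f) = fun g =>
  circ_avg (fun t => complex.Re (phi t)) (re f) g + - circ_avg (fun t => complex.Im (phi t)) (im f) g.
Proof.
move=> [a1 a2] [/smoothR_cont c1 /smoothR_cont c2]; apply/funext => g.
rewrite /re /avg /cint /= /circ_avg -circ_intB.
- by congr circ_int; apply/funext => t; rewrite cReM.
- by apply: continuous_mul => //; exact: (continuous_orbit c1).
- by apply: continuous_mul => //; exact: (continuous_orbit c2).
Qed.

Lemma im_avg phi f : ccont phi -> smoothC f -> im (avg phi f) = fun g =>
  circ_avg (fun t => complex.Re (phi t)) (im f) g + circ_avg (fun t => complex.Im (phi t)) (re f) g.
Proof.
move=> [a1 a2] [/smoothR_cont c1 /smoothR_cont c2]; apply/funext => g.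
rewrite /im /avg /cint /= /circ_avg -circ_intD.
- by congr circ_int; apply/funext => t; rewrite cImM.
- by apply: continuous_mul => //; exact: (continuous_orbit c2).
- by apply: continuous_mul => //; exact: (continuous_orbit c1).
Qed.

Lemma smoothC_avg phi f : ccont phi -> smoothC f -> smoothC (avg phi f).
Proof.
move=> cphi sf; have [a1 a2] := cphi; have [s1 s2] := sf.
split=> n; rewrite ?re_avg ?im_avg //; apply: rCD; rewrite ?rCN //; try exact: circ_avg_rC.
by apply: rCN; exact: circ_avg_rC.
Qed.

Definition rotd x f t : G -> C := fun g => ((axrot x t).1.1)%:C * fder AI f g +
  ((axrot x t).1.2)%:C * fder AJ f g + ((axrot x t).2)%:C * fder AK f g.

Lemma ccont_rotd x f g : smoothC f -> ccont (fun t => rotd x f t (g * flow (vec R AI) t)%g).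
Proof.
move=> sf; have [r1 r2 r3] := continuous_axrot R x.
have cR (u : R -> R) : continuous u -> ccont (fun t => (u t)%:C).
  by move=> cu; split=> //= t; exact: cvg_cst.
rewrite /rotd; apply: ccontD; [apply: ccontD|]; apply: ccontM; try exact: cR;
 apply: ccont_orbit; exact: smoothC_d.
Qed.

Lemma d_avg x phi f g : ccont phi -> smoothC f ->
  fder x (avg phi f) g = cint (fun t => phi t * rotd x f t (g * flow (vec R AI) t)%g).
Proof.
move=> cphi sf; have [a1 a2] := cphi; have [s1 s2] := sf.
have D1 := circ_avg_der x a1 (s1 1%N); have D2 := circ_avg_der x a2 (s2 1%N).
have D3 := circ_avg_der x a1 (s2 1%N); have D4 := circ_avg_der x a2 (s1 1%N).
have [r1 r2 r3] := continuous_axrot R x.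
have M1 := continuous_mul a1 r1; have M2 := continuous_mul a1 r2; have M3 := continuous_mul a1 r3.
have N1 := continuous_mul a2 r1; have N2 := continuous_mul a2 r2; have N3 := continuous_mul a2 r3.
have O (u : G -> R) y : smoothR u -> continuous (fun t => rd y u (g * flow (vec R AI) t)%g).
  by move=> su; apply: continuous_orbit; apply: smoothR_cont; exact: smoothR_rd.
have P (p : R -> R) (u : G -> R) y : continuous p -> smoothR u ->
  continuous (fun t => p t * rd y u (g * flow (vec R AI) t)%g).
  by move=> cp su; apply: continuous_mul => //; exact: O.
have Q (p1 p2 p3 : R -> R) (u : G -> R) : continuous p1 -> continuous p2 -> continuous p3 -> smoothR u ->
   circ_avg p1 (rd AI u) g + circ_avg p2 (rd AJ u) g + circ_avg p3 (rd AK u) g =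
   circ_int (fun t => p1 t * rd AI u (g * flow (vec R AI) t)%g + p2 t * rd AJ u (g * flow (vec R AI) t)%g +
      p3 t * rd AK u (g * flow (vec R AI) t)%g) /\
   continuous (fun t => p1 t * rd AI u (g * flow (vec R AI) t)%g + p2 t * rd AJ u (g * flow (vec R AI) t)%g +
      p3 t * rd AK u (g * flow (vec R AI) t)%g).
  move=> c1 c2 c3 su; have P1 := P _ _ AI c1 su; have P2 := P _ _ AJ c2 su; have P3 := P _ _ AK c3 su.
  have P12 := continuous_add P1 P2.
  by split; [rewrite /circ_avg -circ_intD // -circ_intD|exact: continuous_add].
have [Q1 C1] := Q _ _ _ _ M1 M2 M3 s1; have [Q2 C2] := Q _ _ _ _ N1 N2 N3 s2.
have [Q3 C3] := Q _ _ _ _ M1 M2 M3 s2; have [Q4 C4] := Q _ _ _ _ N1 N2 N3 s1.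
apply: ReIm_eq; rewrite fder.unlock /=.
  rewrite re_avg // (rdE (rderD D1 (rderN D2))) Q1 Q2 -circ_intB //.
  congr circ_int; apply/funext => t; rewrite /rotd.
  by rewrite cReM !cReD !cImD !cReM !cImM fder.unlock /=; ring.
rewrite im_avg // (rdE (rderD D3 D4)) Q3 Q4 -circ_intD //.
congr circ_int; apply/funext => t; rewrite /rotd.
by rewrite cImM !cReD !cImD !cReM !cImM fder.unlock /=; ring.
Qed.

(* exp(- i w t) *)
Definition em w t : C := cos (w%:~R * t) +i* - sin (w%:~R * t).

Lemma is_derive_linear_trig (a t : R) :
  is_derive t 1 (fun t => cos (a * t)) (- (a * sin (a * t))) /\
  is_derive t 1 (fun t => sin (a * t)) (a * cos (a * t)).
Proof. by split; apply: is_derive_eq; rewrite /GRing.scale /=; ring. Qed.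

Lemma ccont_em w : ccont (em w).
Proof.
split.
  exact: (is_derive_continuous (fun t => (is_derive_linear_trig w%:~R t).1)).
have cs := is_derive_continuous (fun t => (is_derive_linear_trig w%:~R t).2).
by move=> t; exact: (cvgN (cs t)).
Qed.

Definition fourier w f : G -> C := fun g => ((2 * pi)^-1)%:C * avg (em w) f g.

Lemma smoothC_fourier w f : smoothC f -> smoothC (fourier w f).
Proof. by move=> sf; apply: smoothCZ; apply: smoothC_avg => //; exact: ccont_em. Qed.

Lemma em_shift w t : em (w - 2) t = em w t * (cos (2 * t) +i* sin (2 * t)) /\
  em (w + 2) t = em w t * (cos (2 * t) +i* - sin (2 * t)).
Proof.
have E1 : (w - 2)%:~R * t = w%:~R * t - 2 * t by rewrite intrB mulrBl.
have E2 : (w + 2)%:~R * t = w%:~R * t + 2 * t by rewrite intrD mulrDl.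
rewrite /em E1 E2 cosB sinB cosD sinD.
by split; apply: ReIm_eq; rewrite ?cReM ?cImM /=; ring.
Qed.

(** The rotation Ad(exp(-tI)) multiplies J + iK by exp(2it), and this factor turns the kernel of
    index w into that of index w - 2. *)
Lemma fourier_opA w f g : smoothC f -> opA (fourier w f) g = fourier (w - 2) (opA f) g.
Proof.
move=> sf; have ce := ccont_em w.
rewrite /fourier opAZ; last exact: smoothC_avg.
congr (_ * _); rewrite /opA !d_avg // -!cintZ; try by apply: ccontM => //; exact: ccont_rotd.
rewrite -cintD; try by apply: ccontM; [exact: ccont_cst|apply: ccontM => //; exact: ccont_rotd].
rewrite /avg; congr cint; apply/funext => t; rewrite (em_shift w t).1 /rotd /opA /=.
have -> : cos (2 * t) +i* sin (2 * t) = (cos (2 * t))%:C + ii R * (sin (2 * t))%:C.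
  by rewrite /ii; simpc.
by rewrite rmorphN /=; ring: (iiM R).
Qed.

Lemma fourier_opB w f g : smoothC f -> opB (fourier w f) g = fourier (w + 2) (opB f) g.
Proof.
move=> sf; have ce := ccont_em w.
rewrite /fourier opBZ; last exact: smoothC_avg.
congr (_ * _); rewrite /opB !d_avg // -!cintZ; try by apply: ccontM => //; exact: ccont_rotd.
rewrite -cintD; try by apply: ccontM; [exact: ccont_cst|apply: ccontM => //; exact: ccont_rotd].
rewrite /avg; congr cint; apply/funext => t; rewrite (em_shift w t).2 /rotd /opB /=.
have -> : cos (2 * t) +i* - sin (2 * t) = (cos (2 * t))%:C - ii R * (sin (2 * t))%:C.
  by rewrite /ii; simpc.
by rewrite rmorphN /=; ring: (iiM R).
Qed.

Lemma fourier_dI w f g : smoothC f -> fder AI (fourier w f) g = fourier w (fder AI f) g.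
Proof.
move=> sf; have ce := ccont_em w.
rewrite /fourier dZ; last exact: smoothC_avg.
congr (_ * _); rewrite d_avg // /avg; congr cint; apply/funext => t.
by rewrite /rotd /= mul1r !mul0r !addr0.
Qed.

Lemma fourier_lin w a c f h g : smoothC f -> smoothC h ->
  fourier w (fun g => a * f g + c * h g) g = a * fourier w f g + c * fourier w h g.
Proof.
move=> sf sh; have ce := ccont_em w.
rewrite /fourier [a * _]mulrCA [c * _]mulrCA -mulrDr; congr (_ * _).
have A := ccontM ce (ccont_orbit g sf); have B := ccontM ce (ccont_orbit g sh).
rewrite /avg -!cintZ // -cintD; try by apply: ccontM => //; exact: ccont_cst.
by congr cint; apply/funext => t; ring.
Qed.

Lemma is_derive_orbit f g t : smoothC f ->
  is_derive t 1 (fun t => complex.Re (f (g * flow (vec R AI) t)%g)) (complex.Re (fder AI f (g * flow (vec R AI) t)%g)) /\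
  is_derive t 1 (fun t => complex.Im (f (g * flow (vec R AI) t)%g)) (complex.Im (fder AI f (g * flow (vec R AI) t)%g)).
Proof.
move=> [s1 s2]; rewrite fder.unlock /=; split.
  exact: (is_derive_flow (smoothR_rder AI s1) g t).
exact: (is_derive_flow (smoothR_rder AI s2) g t).
Qed.

Lemma is_derive_em_orbit w f g t : smoothC f ->
  let u t := em w t * f (g * flow (vec R AI) t)%g in
  let u' t := em w t * (fder AI f (g * flow (vec R AI) t)%g - ii R * w%:~R * f (g * flow (vec R AI) t)%g) in
  is_derive t 1 (fun t => complex.Re (u t)) (complex.Re (u' t)) /\
  is_derive t 1 (fun t => complex.Im (u t)) (complex.Im (u' t)).
Proof.
move=> sf /=; have [D1 D2] := is_derive_orbit g t sf.
have [T1 T2] := is_derive_linear_trig w%:~R t.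
split.
  have := is_deriveB (is_deriveM T1 D1) (is_deriveM (is_deriveN T2) D2).
  congr (is_derive _ _ _ _); first by apply/funext => r; rewrite cReM.
  rewrite -[(- _) t]/(- sin (w%:~R * t)) /GRing.scale /= /em.
  case: (fder AI f _) (f _) => [p1 p2] [r1 r2] /=.
  have -> : (w%:~R : C) = (w%:~R)%:C by rewrite rmorph_int.
  by rewrite /ii /=; ring.
have := is_deriveD (is_deriveM T1 D2) (is_deriveM (is_deriveN T2) D1).
congr (is_derive _ _ _ _); first by apply/funext => r; rewrite cImM.
rewrite -[(- _) t]/(- sin (w%:~R * t)) /GRing.scale /= /em.
case: (fder AI f _) (f _) => [p1 p2] [r1 r2] /=.
have -> : (w%:~R : C) = (w%:~R)%:C by rewrite rmorph_int.
by rewrite /ii /=; ring.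
Qed.

Lemma trig_int w : cos (w%:~R * (2 * pi)) = 1 :> R /\ sin (w%:~R * (2 * pi)) = 0 :> R.
Proof.
have N (n : nat) : cos (n%:R * (2 * pi)) = 1 :> R /\ sin (n%:R * (2 * pi)) = 0 :> R.
  have c2 : cos (2 * pi) = 1 :> R by rewrite mulr_natl cos2pi.
  have s2 : sin (2 * pi) = 0 :> R by rewrite mulr_natl sin2pi.
  elim: n => [|n [IHc IHs]]; first by rewrite mul0r cos0 sin0.
  by rewrite -natr1 mulrDl mul1r cosD sinD IHc IHs c2 s2; split; ring.
case: w => n; first by have := N n; rewrite -pmulrn.
have [c1 s1] := N n.+1.
by rewrite NegzE mulrNz mulNr cosN sinN -pmulrn c1 s1 oppr0.
Qed.

Lemma flow_2pi : flow (vec R AI) (2 * pi) = 1%g.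
Proof.
have h : e1 R AI ^+ 2 + e2 R AI ^+ 2 + e3 R AI ^+ 2 = 1 by rewrite /=; ring.
have [A0 A1 A2 A3] := flow_unit (2 * pi) h; have [B0 B1 B2 B3] := q_one R.
have [c1 s1] := trig_int 1; rewrite mul1r in c1 s1.
by apply: SU2_ext; rewrite ?A0 ?A1 ?A2 ?A3 ?B0 ?B1 ?B2 ?B3 ?c1 ?s1 ?mul0r.
Qed.

Lemma em_0 w : em w 0 = 1.
Proof. by rewrite /em mulr0 cos0 sin0 oppr0. Qed.

Lemma em_2pi w : em w (2 * pi) = 1.
Proof. by have [c1 s1] := trig_int w; rewrite /em c1 s1 oppr0. Qed.

(** Integration by parts over a full period: kernel and flow both return to their initial value at 2
    pi, so the boundary terms cancel. *)
Lemma wt_fourier w f : smoothC f -> wt w (fourier w f).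
Proof.
move=> sf g; rewrite fourier_dI // /fourier mulrCA; congr (_ * _).
have sI := smoothC_d AI sf; have ce := ccont_em w.
have c1 := ccontM ce (ccont_orbit g sf); have c2 := ccontM ce (ccont_orbit g sI).
apply/eqP; rewrite -subr_eq0; apply/eqP.
rewrite /avg -mulNr -cintZ // -cintD //; last by apply: ccontM => //; exact: ccont_cst.
have c3 := ccontM ce (ccontD (ccont_orbit g sI) (ccontM (ccont_cst (- (ii R * w%:~R))) (ccont_orbit g sf))).
have E : (fun t => em w t * fder AI f (g * flow (vec R AI) t)%g + - (ii R * w%:~R) * (em w t * f (g * flow (vec R AI) t)%g)) =
  (fun t => em w t * (fder AI f (g * flow (vec R AI) t)%g - ii R * w%:~R * f (g * flow (vec R AI) t)%g)).
  by apply/funext => t; ring.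
have E' : (fun t => em w t * (fder AI f (g * flow (vec R AI) t)%g + - (ii R * w%:~R) * f (g * flow (vec R AI) t)%g)) =
  (fun t => em w t * (fder AI f (g * flow (vec R AI) t)%g - ii R * w%:~R * f (g * flow (vec R AI) t)%g)).
  by apply/funext => t; ring.
rewrite E' in c3; have [c31 c32] := c3.
rewrite E /cint (circ_int_FTC (fun t => (is_derive_em_orbit w g t sf).1) c31).
rewrite (circ_int_FTC (fun t => (is_derive_em_orbit w g t sf).2) c32).
by rewrite em_0 em_2pi flow_2pi /vec flow0 !subrr.
Qed.

(** The left side has derivative 0 in t by the weight equation, and equals f(g) at t = 0. *)
Lemma wt_orbit w f g t : smoothC f -> wt w f -> em w t * f (g * flow (vec R AI) t)%g = f g.
Proof.
move=> sf wf.
have D1 (r : R) := (is_derive_em_orbit w g r sf).1.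
have D2 (r : R) := (is_derive_em_orbit w g r sf).2.
have Z (r : R) : em w r * (fder AI f (g * flow (vec R AI) r)%g - ii R * w%:~R * f (g * flow (vec R AI) r)%g) = 0.
  by rewrite wf subrr mulr0.
have D1' (r : R) : is_derive r 1 (fun t => complex.Re (em w t * f (g * flow (vec R AI) t)%g)) 0.
  by have := D1 r; rewrite Z.
have D2' (r : R) : is_derive r 1 (fun t => complex.Im (em w t * f (g * flow (vec R AI) t)%g)) 0.
  by have := D2 r; rewrite Z.
have E : f g = em w 0 * f (g * flow (vec R AI) 0)%g by rewrite em_0 /vec flow0 mulg1 mul1r.
rewrite E; apply: ReIm_eq.
  exact: (is_derive_0_is_cst t 0 D1').
exact: (is_derive_0_is_cst t 0 D2').
Qed.

Lemma fourier_id w f g : smoothC f -> wt w f -> fourier w f g = f g.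
Proof.
move=> sf wf; rewrite /fourier /avg.
have -> : (fun t => em w t * f (g * flow (vec R AI) t)%g) = fun=> f g.
  by apply/funext => t; exact: wt_orbit.
rewrite cint_cst mulrA -rmorphM mulVf ?mul1r // gt_eqF //; exact: twopi_gt0.
Qed.

(** No orthogonality integral is computed: d_I acts on the component of index v both as iv, by its
    weight, and as iw, by linearity. *)
Lemma fourier_neq v w f g : smoothC f -> wt w f -> v != w -> fourier v f g = 0.
Proof.
move=> sf wf vw.
have := wt_fourier v sf g; rewrite fourier_dI // (wt_d wf).
have := @fourier_lin v (ii R * w%:~R) 0 f f g sf sf.
have -> : (fun g => ii R * w%:~R * f g + 0 * f g) = fun g => ii R * w%:~R * f g.
  by apply/funext => k; ring.
move=> -> /eqP; rewrite mul0r addr0 -subr_eq0 -mulrBl -mulrBr -intrB mulf_eq0 => /orP[|/eqP //].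
rewrite mulf_eq0 intr_eq0 subr_eq0 [w == v]eq_sym (negbTE vw) orbF.
by rewrite /ii eq_complex /= oner_eq0 andbF.
Qed.

(** With q = p^2, the sum of the n + 1 powers p^0, ..., p^n gives (n + 1)(1 - p) p^n <= 1, whence (n
    + 1) q^n <= p^n / (1 - p), which tends to 0. *)
Lemma expr_decay (q c : R) : 0 <= q < 1 -> 0 < c -> exists n : nat, n.+1%:R * q ^+ n < c.
Proof.
move=> /andP[q0' q1'] c0.
pose p := Num.sqrt q; have p0 : 0 <= p by exact: sqrtr_ge0.
have p2 : p ^+ 2 = q by rewrite sqr_sqrtr.
have p1 : p < 1 by rewrite -(@expr_lt1 _ 2) // p2.
have H (n : nat) : n.+1%:R * (1 - p) * p ^+ n <= 1 - p ^+ n.+1.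
  elim: n => [|n IH]; first by rewrite expr0 expr1; lra.
  have pn : p ^+ n.+1 <= 1 by rewrite exprn_ile1 // ltW.
  have pn0 : 0 <= p ^+ n.+1 by rewrite exprn_ge0.
  rewrite -natr1 [p ^+ n.+2]exprS.
  have : p * (n.+1%:R * (1 - p) * p ^+ n) <= p * (1 - p ^+ n.+1) by rewrite ler_wpM2l.
  rewrite (_ : p * (n.+1%:R * (1 - p) * p ^+ n) = n.+1%:R * (1 - p) * p ^+ n.+1); last by rewrite exprS; ring.
  by move: (p ^+ n.+1) pn pn0 (n.+1%:R) => y h1 h2 m h3; nra.
have cp : 0 < c * (1 - p) by rewrite mulr_gt0 // subr_gt0.
have : p ^+ n @[n --> \oo] --> (0 : R) by apply: cvg_expr; rewrite ger0_norm.
move=> /cvgrPdist_lt/(_ _ cp)[n _ Hn]; exists n.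
have := Hn n (leqnn n); rewrite sub0r normrN ger0_norm ?exprn_ge0 // => pn.
rewrite -p2 -exprM mulnC exprM expr2.
have pn0 : 0 <= p ^+ n by rewrite exprn_ge0.
rewrite -(ltr_pM2r (_ : 0 < 1 - p)) ?subr_gt0 //.
have := H n; have pn1 : 0 <= p ^+ n.+1 by rewrite exprn_ge0.
move: (n.+1%:R) (p ^+ n.+1) pn1 => m z z0 h.
apply: le_lt_trans pn; have -> : m * (p ^+ n * p ^+ n) * (1 - p) = m * (1 - p) * p ^+ n * p ^+ n by ring.
by rewrite ler_piMl //; lra.
Qed.

(* The kernels bump n are trigonometric polynomials concentrating at pi, and their
   integrals decay only like 1/n: they detect the value at pi of a function all
   of whose Fourier coefficients vanish. *)
Definition bump (n : nat) (t : R) : R := ((1 - cos t) / 2) ^+ n.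

Lemma continuous_bump n : continuous (bump n).
Proof.
move=> t; apply: (@continuous_comp _ _ _ (fun t => (1 - cos t) / 2) (fun x : R => x ^+ n)).
  apply: cvgM; last exact: cvg_cst.
  by apply: cvgB; [exact: cvg_cst|exact: continuous_cos].
exact: exprn_continuous.
Qed.

Lemma bump_ge0 n t : 0 <= bump n t.
Proof. by rewrite exprn_ge0 // divr_ge0 // subr_ge0 cos_le1. Qed.

(** Integrating the derivative of - sin t times [bump m t] over a period gives Wallis's recursion
    (2m + 2) I(m+1) = (2m + 1) I(m). As (n + 2)(2n + 1) >= (n + 1)(2n + 2), the products (n + 1)
    I(n) never fall below their value 2 pi at n = 0. *)
Lemma bump_int n : 2 * pi <= n.+1%:R * circ_int (bump n).
Proof.
have rec m : (2 * m%:R + 2) * circ_int (bump m.+1) = (2 * m%:R + 1) * circ_int (bump m).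
  have cb := continuous_bump.
  have cZ (a : R) (k : nat) : continuous (fun t => a * bump k t).
    by apply: continuous_mul => //; move=> t; exact: cvg_cst.
  rewrite -!circ_intZ //; apply/eqP; rewrite -subr_eq0 -circ_intB //.
  have D (t : R) : is_derive t 1 (fun t => - (sin t * bump m t))
      ((2 * m%:R + 2) * bump m.+1 t - (2 * m%:R + 1) * bump m t).
    have DQ : is_derive t 1 (fun t : R => (1 - cos t) / 2) (sin t / 2).
      by apply: is_derive_eq; rewrite /GRing.scale /=; ring.
    have cs : sin t * sin t = (1 - cos t) * (1 + cos t).
      by rewrite -(expr2 (sin t)) sin2cos2; ring.
    have DX : is_derive t 1 (bump m) (m%:R * ((1 - cos t) / 2) ^+ m.-1 * (sin t / 2)).
      have -> : bump m = (fun t : R => (1 - cos t) / 2) ^+ m by apply/funext => r; rewrite exprfctE.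
      exact: is_deriveX.
    have D2 := is_deriveZ (-1) (is_deriveM (is_derive_sin t) DX).
    have -> : (fun t => - (sin t * bump m t)) = (fun t => -1 * (sin t * bump m t)).
      by apply/funext => r; ring.
    apply: (is_derive_eq D2); rewrite /GRing.scale /= /bump.
    case: (m) => [|k] /=; first by rewrite !expr0 expr1; field.
    rewrite [_ ^+ k.+2]exprS [_ ^+ k.+1]exprS -[k.+1%:R]natr1.
    by move: (_ ^+ k) => P; field: cs.
  rewrite (circ_int_FTC D); last exact: continuous_sub.
  by rewrite sin0 mulr_natl sin2pi !mul0r oppr0 subrr.
elim: n => [|n IH].
  have -> : bump 0 = fun=> 1 by apply/funext => t; rewrite /bump expr0.
  by rewrite circ_int_cst mul1r mulr1.
have R1 := rec n.
have I0 : 0 <= circ_int (bump n).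
  have -> : 0 = circ_int (fun=> 0 : R) by rewrite circ_int_cst mulr0.
  apply: circ_int_le => [t||t _]; [exact: cvg_cst|exact: continuous_bump|exact: bump_ge0].
apply: le_trans IH _; rewrite -[n.+2%:R]natr1 -[n.+1%:R]natr1.
have -> : circ_int (bump n.+1) = (2 * n%:R + 1) / (2 * n%:R + 2) * circ_int (bump n).
  have nz : 2 * n%:R + 2 != 0 :> R by rewrite gt_eqF // ltr_wpDl // mulr_ge0.
  by apply: (mulfI nz); rewrite R1; field.
rewrite mulrA ler_wpM2r //.
have n0 : 0 <= n%:R :> R by [].
have p2 : 0 < 2 * n%:R + 2 :> R by lra.
rewrite mulrA ler_pdivlMr //; nra.
Qed.

(** Suppose u(pi) > 0 and put e = u(pi)/2. Near pi one has u >= e, elsewhere the kernel is at most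
    q^n with q < 1; so kernel times u is everywhere at least e times the kernel minus (M + e) q^n.
    Integrated, this contradicts (n + 1) q^n < e/(M + e) for a suitable n, by the lower bound on the
    integrals of the kernels. *)
Lemma peak (u : R -> R) : continuous u -> (forall n, circ_int (fun t => bump n t * u t) = 0) ->
  u pi <= 0.
Proof.
move=> cu H; rewrite leNgt; apply/negP => up.
pose e := u pi / 2; have e0 : 0 < e by rewrite divr_gt0.
have /cvgrPdist_lt/(_ e e0)/nbhs_ballP[d0 /= d00 Hd0] := cu pi.
pose d1 := Num.min d0 1.
have d10 : 0 < d1 by rewrite lt_min d00 ltr01.
have pi1 : 1 < pi :> R by have := pi_ge2 R; lra.
have d1pi : d1 < pi by apply: le_lt_trans pi1; rewrite ge_min lexx orbT.
have Hd t : `|t - pi| < d1 -> e <= u t.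
  rewrite lt_min => /andP[h _]; have : ball pi d0 t by rewrite /ball /= distrC.
  by move=> /Hd0 /=; rewrite ltr_norml /e => /andP[_]; lra.
pose q := (1 + cos d1) / 2.
have q01 : 0 <= q < 1.
  apply/andP; split; first by rewrite divr_ge0 // -lerBlDl sub0r cos_geN1.
  have : cos d1 < cos 0.
    by rewrite ltr_cos ?in_itv /= ?lexx ?pi_ge0 // ?(ltW d10) ?(ltW d1pi).
  by rewrite cos0 /q; lra.
have Hq t : t \in `[0, 2 * pi] -> d1 <= `|t - pi| -> (1 - cos t) / 2 <= q.
  rewrite in_itv /= => /andP[t0 t2] dt; rewrite /q.
  have ce : cos t = - cos `|t - pi|.
    have -> : cos `|t - pi| = cos (t - pi) by case: (ger0P (t - pi)) => _ //; rewrite cosN.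
    by rewrite cosB cospi sinpi; ring.
  have : cos `|t - pi| <= cos d1.
    rewrite leNgt ltr_cos ?in_itv /=.
    - by rewrite -leNgt.
    - by rewrite normr_ge0 ler_norml; apply/andP; split; lra.
    - by rewrite (ltW d10) (ltW d1pi).
  by rewrite ce; lra.
have [M M0 HM] := circle_bounded cu.
have K0 : 0 < e / (M + e) by rewrite divr_gt0 // addr_gt0.
have [n Hn] := expr_decay q01 K0.
have cb := @continuous_bump n.
have cc (r : R) : continuous (fun _ : R => r) by move=> t; exact: cvg_cst.
have : circ_int (fun t => e * bump n t - (M + e) * q ^+ n) <= circ_int (fun t => bump n t * u t).
  apply: circ_int_le.
  - by apply: continuous_sub => //; exact: continuous_mul.
  - exact: continuous_mul.
  - move=> t tB; have b0 := bump_ge0 n t.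
    have qn0 : 0 <= q ^+ n by rewrite exprn_ge0 //; case/andP: q01.
    have Mt := HM t tB; rewrite ler_norml in Mt; case/andP: Mt => Mt1 Mt2.
    have [dt|dt] := ltP `|t - pi| d1.
      have ut := Hd t dt.
      have h1 : bump n t * e <= bump n t * u t by rewrite ler_wpM2l.
      have h2 : 0 <= (M + e) * q ^+ n by rewrite mulr_ge0 //; lra.
      lra.
    have bq : bump n t <= q ^+ n.
      rewrite /bump; apply: lerXn2r; last exact: Hq.
        by rewrite nnegrE divr_ge0 // subr_ge0 cos_le1.
      by rewrite nnegrE; case/andP: q01.
    have h1 : bump n t * - M <= bump n t * u t by rewrite ler_wpM2l.
    have h2 : (M + e) * bump n t <= (M + e) * q ^+ n by rewrite ler_wpM2l //; lra.
    lra.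
rewrite H circ_intB //; last exact: continuous_mul.
rewrite circ_intZ // circ_int_cst => K.
have Hb := bump_int n.
have n1 : 0 < n.+1%:R :> R by rewrite ltr0n.
have Me : 0 < M + e by rewrite addr_gt0.
rewrite ltr_pdivlMr // in Hn.
have pi0 := twopi_gt0 R.
have h3 : e * (2 * pi) <= n.+1%:R * (2 * pi * ((M + e) * q ^+ n)).
  have h4 : e * (2 * pi) <= e * (n.+1%:R * circ_int (bump n)) by rewrite ler_pM2l.
  have h5 : n.+1%:R * (e * circ_int (bump n)) <= n.+1%:R * (2 * pi * ((M + e) * q ^+ n)).
    by rewrite ler_pM2l //; lra.
  lra.
have h6 : n.+1%:R * q ^+ n * (M + e) * (2 * pi) < e * (2 * pi) by rewrite ltr_pM2r.
lra.
Qed.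

(** Multiplication by (1 - cos t)/2 only mixes neighbouring indices, so the moments against all
    kernels vanish by induction once the Fourier coefficients do. *)
Lemma em_cos w n t : (bump n.+1 t)%:C * em w t = 2^-1 * ((bump n t)%:C * em w t)
  - 4^-1 * ((bump n t)%:C * em (w - 1) t) - 4^-1 * ((bump n t)%:C * em (w + 1) t).
Proof.
have E1 : (w - 1)%:~R * t = w%:~R * t - t by rewrite intrB mulrBl mul1r.
have E2 : (w + 1)%:~R * t = w%:~R * t + t by rewrite intrD mulrDl mul1r.
have -> : (bump n.+1 t)%:C = (bump n t)%:C * ((1 - cos t) / 2)%:C.
  by rewrite -rmorphM /bump exprSr.
have -> : 2^-1 = (2^-1)%:C :> C by rewrite fmorphV rmorph_nat.
have -> : 4^-1 = (4^-1)%:C :> C by rewrite fmorphV rmorph_nat.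
rewrite /em E1 E2 cosB sinB cosD sinD.
by apply: ReIm_eq; rewrite /=; field.
Qed.

(** The kernels test the value at pi, that is at k exp(pi I), and these points exhaust the group.
    [peak] is one-sided and is applied to both signs of the real and imaginary parts. *)
Lemma fourier_unique f g : smoothC f -> (forall w g, fourier w f g = 0) -> f g = 0.
Proof.
move=> sf H.
suff K k : f (k * flow (vec R AI) pi)%g = 0.
  have -> : g = (g * (flow (vec R AI) pi)^-1 * flow (vec R AI) pi)%g by rewrite -mulgA mulVg mulg1.
  exact: K.
have cB n : ccont (fun t => (bump n t)%:C).
  by split; [exact: continuous_bump|move=> t; exact: cvg_cst].
have co := ccont_orbit k sf.
have Z n w : cint (fun t => (bump n t)%:C * em w t * f (k * flow (vec R AI) t)%g) = 0.
  elim: n w => [|n IH] w.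
    have := H w k; rewrite /fourier => /eqP; rewrite mulf_eq0 => /orP[|/eqP E].
      by rewrite fmorph_eq0 invr_eq0 gt_eqF // twopi_gt0.
    rewrite -[RHS]E /avg; congr cint; apply/funext => t.
    by rewrite /bump expr0 mul1r.
  have c v : ccont (fun t => (bump n t)%:C * em v t * f (k * flow (vec R AI) t)%g).
    by apply: ccontM => //; apply: ccontM => //; exact: ccont_em.
  have cz a v : ccont (fun t => a * ((bump n t)%:C * em v t * f (k * flow (vec R AI) t)%g)).
    by apply: ccontM => //; exact: ccont_cst.
  have -> : (fun t => (bump n.+1 t)%:C * em w t * f (k * flow (vec R AI) t)%g) =
    fun t => 2^-1 * ((bump n t)%:C * em w t * f (k * flow (vec R AI) t)%g) +
     (- 4^-1) * ((bump n t)%:C * em (w - 1) t * f (k * flow (vec R AI) t)%g) +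
     (- 4^-1) * ((bump n t)%:C * em (w + 1) t * f (k * flow (vec R AI) t)%g).
    by apply/funext => t; rewrite em_cos; ring.
  rewrite cintD //; last exact: ccontD.
  by rewrite cintD // !cintZ // !IH !mulr0 !addr0.
have Zr n : circ_int (fun t => bump n t * complex.Re (f (k * flow (vec R AI) t)%g)) = 0 /\
  circ_int (fun t => bump n t * complex.Im (f (k * flow (vec R AI) t)%g)) = 0.
  have := Z n 0; rewrite /cint => /eqP; rewrite eq_complex /= => /andP[/eqP h1 /eqP h2].
  have em0 t : em 0 t = 1 by rewrite /em mul0r cos0 sin0 oppr0.
  split; [rewrite -[RHS]h1|rewrite -[RHS]h2]; congr circ_int; apply/funext => t;
    by rewrite em0 mulr1 ?cReM ?cImM /=; ring.
have [c1 c2] := co.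
have N (u : R -> R) : continuous u -> continuous (fun t => - u t).
  by move=> cu t; exact: (cvgN (cu t)).
have ZN (u : R -> R) : continuous u -> (forall n, circ_int (fun t => bump n t * u t) = 0) -> u pi = 0.
  move=> cu Zu; apply/eqP; rewrite eq_le peak //=.
  rewrite -oppr_le0; apply: (@peak (fun t => - u t)) => [|n]; first exact: N.
  have -> : (fun t => bump n t * - u t) = fun t => -1 * (bump n t * u t).
    by apply/funext => t; ring.
  rewrite circ_intZ ?Zu ?mulr0 //; apply: continuous_mul => //; exact: continuous_bump.
apply: ReIm_eq.
  by apply: (ZN _ c1) => n; have [] := Zr n.
by apply: (ZN _ c2) => n; have [] := Zr n.
Qed.

End Fourier.

(** * The Dirac operator on pairs of functions *)

Section Spinors.
Variable R : realType.
Local Notation C := R[i].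
Local Notation G := (SU2 R).
Local Notation V := (G -> 'cV[C]_2).
Implicit Types (g : G) (f h : G -> C) (psi : V) (x : axis) (w : int) (i : 'I_2).

(** Reduces limits of complex column vectors, hence [lie_der] and [isCk], to the real calculus
    developed above. *)
Lemma cvg_cV2 (U : Type) (F : set_system U) (FF : Filter F) (phi : U -> 'cV[C]_2) (L : 'cV[C]_2) :
  phi t @[t --> F] --> L <-> forall i,
    (complex.Re (phi t i 0) @[t --> F] --> complex.Re (L i 0)) /\
    (complex.Im (phi t i 0) @[t --> F] --> complex.Im (L i 0)).
Proof.
split=> [H i|H].
  have K (r : C -> R) : (forall u v : C, (`|r u - r v|)%:C <= `|u - v|) ->
      r (phi t i 0) @[t --> F] --> r (L i 0).
    move=> Hr A /nbhs_ballP[e /= e0 eA].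
    have : nbhs L (ball L (e%:C : C)) by apply: nbhsx_ballx; rewrite ltcR.
    move=> /H; apply: (@filterS _ F FF) => t [_ /(_ i 0)].
    rewrite -ball_normE /= => Lt; apply: eA; rewrite -ball_normE /= -ltcR.
    exact: le_lt_trans (Hr _ _) Lt.
  split; apply: K => u v.
    by have := Re_norm_le (u - v); case: u v => ? ? [].
  by have := Im_norm_le (u - v); case: u v => ? ? [].
move=> A /nbhs_ballP[e /= e0 eA].
have [r r0 eE] := pos_complexE e0.
have r20 : 0 < r / 2 by rewrite divr_gt0.
have K i : F (fun t => ball (L i 0) e (phi t i 0)).
  have [/cvgrPdist_lt/(_ _ r20) H1 /cvgrPdist_lt/(_ _ r20) H2] := H i.
  have {}H1 : F (fun t => `|complex.Re (L i 0) - complex.Re (phi t i 0)| < r / 2) := H1.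
  have {}H2 : F (fun t => `|complex.Im (L i 0) - complex.Im (phi t i 0)| < r / 2) := H2.
  apply: (@filterS _ F FF _ _ _ (@filterI _ F FF _ _ H1 H2)) => t [h1 h2].
  rewrite -ball_normE /=; apply: le_lt_trans (complex_norm_le _) _.
  rewrite eE ltcR; case: (L i 0) (phi t i 0) h1 h2 => [a b] [c d] /=; lra.
apply: (@filterS _ F FF _ _ _ (@filterI _ F FF _ _ (K 0) (K 1))) => t [h0 h1].
by apply: eA; split => // i j; rewrite (ord1 j); case: (ord2 i) => ->.
Qed.

Lemma is_derive_quot (u : R -> R) (l : R) : is_derive (0 : R) 1 u l <->
  t^-1 * (u t - u 0) @[t --> 0^'] --> l.
Proof.
have E : (fun h : R => h^-1 *: ((u \o shift 0) (h *: 1) - u 0)) = (fun t => t^-1 * (u t - u 0)).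
  by apply/funext => h /=; rewrite scaler1 addr0.
split=> [[D <-]|H].
  by move: D; rewrite /derivable /derive E => D.
split; first by apply/cvg_ex; exists l; rewrite /= E.
by rewrite /derive E; exact: cvg_lim H.
Qed.

Definition entry i psi : G -> C := fun g => psi g i 0.

Lemma lie_quot_cvg a b c psi g (L : 'cV[C]_2) :
  lie_quot (su2v a b c) psi g t @[t --> 0^'] --> L <-> forall i,
    is_derive (0 : R) 1 (fun t => re (entry i psi) (g * flow (su2v a b c) t)%g) (complex.Re (L i 0)) /\
    is_derive (0 : R) 1 (fun t => im (entry i psi) (g * flow (su2v a b c) t)%g) (complex.Im (L i 0)).
Proof.
have E t i : lie_quot (su2v a b c) psi g t i 0 =
    (t^-1)%:C * (entry i psi (g * flow (su2v a b c) t)%g - entry i psi g).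
  by rewrite /lie_quot !mxE flow.unlock.
have Er t i : complex.Re (lie_quot (su2v a b c) psi g t i 0) =
    t^-1 * (re (entry i psi) (g * flow (su2v a b c) t)%g - re (entry i psi) (g * flow (su2v a b c) 0)%g).
  rewrite E flow0 mulg1 /re; case: (entry i psi _) (entry i psi g) => [? ?] [? ?] /=; ring.
have Ei t i : complex.Im (lie_quot (su2v a b c) psi g t i 0) =
    t^-1 * (im (entry i psi) (g * flow (su2v a b c) t)%g - im (entry i psi) (g * flow (su2v a b c) 0)%g).
  rewrite E flow0 mulg1 /im; case: (entry i psi _) (entry i psi g) => [? ?] [? ?] /=; ring.
split=> [/cvg_cV2 H i|H].
  have [H1 H2] := H i.
  split; apply/is_derive_quot; [move: H1|move: H2].
    by under eq_fun do rewrite Er.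
  by under eq_fun do rewrite Ei.
apply/cvg_cV2 => i; have [/is_derive_quot H1 /is_derive_quot H2] := H i.
split.
  by under eq_fun do rewrite Er.
by under eq_fun do rewrite Ei.
Qed.

Lemma vecE x : vec R x = match x with AI => mxI R | AJ => mxJ R | AK => mxK R end.
Proof. by rewrite /vec su2v.unlock; case: x => /=; rewrite !scale0r ?scale1r ?addr0 ?add0r. Qed.

Lemma vec_su2 x : vec R x \is su2 R.
Proof. by rewrite vecE; case: x; [exact: mxI_su2|exact: mxJ_su2|exact: mxK_su2]. Qed.

Lemma su2_su2v (X : 'M[C]_2) : X \is su2 R -> exists a b c, X = su2v a b c.
Proof. by move=> /su2P[a [b [c ->]]]; exists a, b, c; rewrite su2v.unlock. Qed.

Lemma lie_der_eq a b c psi (D : V) :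
  (forall g, lie_quot (su2v a b c) psi g t @[t --> 0^'] --> D g) ->
  lie_derivable (su2v a b c) psi /\ lie_der (su2v a b c) psi = D.
Proof.
move=> H; split=> [g|]; first by apply/cvg_ex; exists (D g).
by apply/funext => g; apply: cvg_lim => //; exact: H.
Qed.

Lemma continuous_spinor psi : continuous psi <->
  forall i, continuous (re (entry i psi)) /\ continuous (im (entry i psi)).
Proof.
split=> [H i|H g]; last first.
  by apply/(cvg_cV2 (nbhs_filter g)) => i; have [h1 h2] := H i; split; [exact: h1|exact: h2].
by split=> g; have /(cvg_cV2 (nbhs_filter g))/(_ i)[h1 h2] := H g; [exact: h1|exact: h2].
Qed.

Lemma lie_der_lin n a b c psi : (forall i, Ck n.+1 (entry i psi)) ->
  lie_derivable (su2v a b c) psi /\ forall i, entry i (lie_der (su2v a b c) psi) =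
   fun g => a%:C * fder AI (entry i psi) g + b%:C * fder AJ (entry i psi) g + c%:C * fder AK (entry i psi) g.
Proof.
move=> H.
have C1 (u : G -> R) : rC n.+1 u -> rC 1 u by elim: (n) => // m IH /rC_pred /IH.
pose D : V := fun g => \col_i (a%:C * fder AI (entry i psi) g +
  b%:C * fder AJ (entry i psi) g + c%:C * fder AK (entry i psi) g).
have HD g : lie_quot (su2v a b c) psi g t @[t --> 0^'] --> D g.
  apply/lie_quot_cvg => i; rewrite mxE.
  have [/C1 H1 /C1 H2] := H i.
  rewrite fder.unlock !cReD !cImD !cReM !cImM /= !mul0r !subr0 !addr0.
  by split; exact: is_derive_lin.
have [h1 h2] := lie_der_eq HD.
by split=> // i; rewrite h2; apply/funext => g; rewrite /entry mxE.
Qed.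

(** From left to right only the three axes are used; the converse must produce the derivatives along
    every X in su(2), which linearity supplies. *)
Lemma isCkP n psi : isCk n psi <-> forall i, Ck n (entry i psi).
Proof.
elim: n psi => [|n IH] psi.
  rewrite /= continuous_spinor; split=> H i; have := H i; first by case=> h1 h2; split; split.
  by case=> [[h1 _] [h2 _]].
split=> [[/continuous_spinor cpsi H] i|H].
  have [c1 c2] := cpsi i.
  have D x : [/\ rder x (re (entry i psi)) (re (entry i (lie_der (vec R x) psi))),
      rder x (im (entry i psi)) (im (entry i (lie_der (vec R x) psi))) &
      Ck n (entry i (lie_der (vec R x) psi))].
    have [hd /IH hC] := H _ (vec_su2 x).
    have E g : lie_quot (vec R x) psi g t @[t --> 0^'] --> lie_der (vec R x) psi g := hd g.
    by split=> [g|g|]; [have /lie_quot_cvg/(_ i)[] := E g|have /lie_quot_cvg/(_ i)[] := E g|exact: hC].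
  split.
    apply: (@rC_intro _ n _ (fun x => re (entry i (lie_der (vec R x) psi))) c1) => x.
    by have [d1 d2 [k1 k2]] := D x; split.
  apply: (@rC_intro _ n _ (fun x => im (entry i (lie_der (vec R x) psi))) c2) => x.
  by have [d1 d2 [k1 k2]] := D x; split.
split.
  by apply/continuous_spinor => i; have [h1 h2] := H i; split; [exact: (rC_cont h1)|exact: (rC_cont h2)].
move=> X /su2_su2v[a [b [c ->]]].
have [h1 h2] := lie_der_lin a b c H.
split=> //; apply/IH => i; rewrite h2.
have [[_ Hr] [_ Hi]] := H i.
have Cd x : Ck n (fder x (entry i psi)).
  by split; rewrite ?re_d ?im_d; [have [] := Hr x|have [] := Hi x].
by apply: CkD; [apply: CkD|]; apply: CkM => //; exact: Ck_cst.
Qed.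

Lemma smoothP psi : smooth psi <-> forall i, smoothC (entry i psi).
Proof.
split=> [H i|H n]; first by apply/smoothC_Ck => n; have /isCkP := H n.
by apply/isCkP => i; have /smoothC_Ck := H i.
Qed.

Lemma mx_row2 (A B K : 'M[C]_2) (p q r s : 'cV[C]_2) (c : C) i :
  (A *m p + B *m q + K *m r - c *: s) i 0 =
  (A i 0 * p 0 0 + A i 1 * p 1 0) + (B i 0 * q 0 0 + B i 1 * q 1 0) +
  (K i 0 * r 0 0 + K i 1 * r 1 0) - c * s i 0.
Proof.
have l1 : lift ord0 ord0 = 1 :> 'I_2 by apply/val_inj.
by rewrite !mxE !big_ord_recl !big_ord0 l1 !addr0.
Qed.

Lemma dirac_row0 (p q r s : 'cV[C]_2) (c e p0 q1 r1 : C) :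
  p 0 0 = c * p0 -> q 1 0 = q1 -> r 1 0 = r1 ->
  (mxI R *m p + mxJ R *m q + mxK R *m r - e *: s) 0 0 =
  ii R * c * p0 + (1 * q1 + ii R * r1) - e * s 0 0.
Proof. by move=> hp hq hr; rewrite mx_row2 !mxE /= hp hq hr -/(ii R); ring. Qed.

Lemma dirac_row1 (p q r s : 'cV[C]_2) (c e p1 q0 r0 : C) :
  p 1 0 = c * p1 -> q 0 0 = q0 -> r 0 0 = r0 ->
  (mxI R *m p + mxJ R *m q + mxK R *m r - e *: s) 1 0 =
  (- 1 * q0 + ii R * r0) - ii R * c * p1 - e * s 1 0.
Proof.
move=> hp hq hr; rewrite mx_row2 !mxE /= hp hq hr.
have -> : 0 +i* (-1) = - ii R by rewrite /ii; simpc.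
by rewrite -/(ii R); ring.
Qed.

Lemma DiracE T psi : (forall i, smoothC (entry i psi)) ->
  (forall g, Dirac T psi g 0 0 = ii R * (T^-1)%:C * fder AI (entry 0 psi) g + opA (entry 1 psi) g
     - (T / 2 + T^-1)%:C * entry 0 psi g) /\
  (forall g, Dirac T psi g 1 0 = opB (entry 0 psi) g - ii R * (T^-1)%:C * fder AI (entry 1 psi) g
     - (T / 2 + T^-1)%:C * entry 1 psi g).
Proof.
move=> H; have C1 i : Ck 1 (entry i psi) by have /smoothC_Ck := H i.
have DI i g : lie_der ((T^-1)%:C *: mxI R) psi g i 0 = (T^-1)%:C * fder AI (entry i psi) g.
  have -> : (T^-1)%:C *: mxI R = su2v (T^-1) 0 0 by rewrite su2v.unlock !scale0r !addr0.
  have [_ /(_ i) E] := lie_der_lin T^-1 0 0 C1.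
  by rewrite -[LHS]/(entry i _ g) E !rmorph0 !mul0r !addr0.
have DJ i g : lie_der (mxJ R) psi g i 0 = fder AJ (entry i psi) g.
  have [_ /(_ i) E] := lie_der_lin 0 1 0 C1.
  by rewrite -(vecE AJ) -[LHS]/(entry i _ g) E !rmorph0 !rmorph1 !mul0r mul1r addr0 add0r.
have DK i g : lie_der (mxK R) psi g i 0 = fder AK (entry i psi) g.
  have [_ /(_ i) E] := lie_der_lin 0 0 1 C1.
  by rewrite -(vecE AK) -[LHS]/(entry i _ g) E !rmorph0 !rmorph1 !mul0r mul1r !add0r.
split=> g.
  by rewrite -[LHS]/((_ *m _ + _ *m _ + _ *m _ - _ *: _) 0 0) (dirac_row0 _ _ (DI 0 g) (DJ 1 g) (DK 1 g)).
by rewrite -[LHS]/((_ *m _ + _ *m _ + _ *m _ - _ *: _) 1 0) (dirac_row1 _ _ (DI 1 g) (DJ 0 g) (DK 0 g)).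
Qed.

End Spinors.

Lemma has_dim_add (K : fieldType) (V : lmodType K) (A B E : set V) (m n : nat) :
  has_dim A m -> has_dim B n -> (forall x, A x -> B x -> x = 0) ->
  E = [set x + y | x in A & y in B] -> has_dim E (m + n).
Proof.
move=> [a [fa EA]] [b [fb EB]] AB ->.
pose ab (i : 'I_(m + n)) := match fintype.split i with inl j => a j | inr j => b j end.
have sE (c : 'I_(m + n) -> K) : \sum_i c i *: ab i =
    \sum_i c (lshift n i) *: a i + \sum_i c (rshift m i) *: b i.
  rewrite big_split_ord /=; congr (_ + _); apply: eq_bigr => i _; rewrite /ab.
    by rewrite (unsplitK (inl i)).
  by rewrite (unsplitK (inr i)).
exists ab; split=> [c|].
  rewrite sE => /eqP; rewrite addr_eq0 => /eqP e.
  have Az : A (\sum_i c (lshift n i) *: a i) by rewrite EA; exists (fun i => c (lshift n i)).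
  have Bz : B (\sum_i c (lshift n i) *: a i).
    rewrite e EB; exists (fun i => - c (rshift m i)) => //.
    by rewrite -sumrN; apply: eq_bigr => i _; rewrite scaleNr.
  have z := AB _ Az Bz; have z' := z; rewrite e in z'.
  move/eqP: z'; rewrite oppr_eq0 => /eqP z'.
  by move=> i; rewrite -(splitK i); case: (fintype.split i) => j /=; [exact: (fa _ z)|exact: (fb _ z')].
apply/seteqP; split=> v.
  rewrite EA EB => -[_ [c _ <-] [_ [c' _ <-] <-]].
  exists (fun i => match fintype.split i with inl j => c j | inr j => c' j end) => //.
  rewrite sE; congr (_ + _); apply: eq_bigr => i _.
    by rewrite (unsplitK (inl i)).
  by rewrite (unsplitK (inr i)).
move=> [c _ <-]; rewrite sE EA EB; eexists; first by exists (fun i => c (lshift n i)).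
by eexists; first by exists (fun i => c (rshift m i)).
Qed.

(** * Decomposition of the eigenspace by weight *)

Section Eigenspinors.
Variables (R : realType) (N : nat) (T : R) (lambda : R[i]).
Local Notation C := R[i].
Local Notation G := (SU2 R).
Local Notation V := (G -> 'cV[C]_2).
Implicit Types (g : G) (f h : G -> C) (psi phi : V) (w k : int) (i : 'I_2) (c : C).

Let theta : R := 2 * pi / N%:R.
Let tau : C := (T^-1)%:C.
Let mu : C := lambda + (T / 2 + T^-1)%:C.

Lemma ord2_all (P : 'I_2 -> Prop) : P 0 -> P 1 -> forall i, P i.
Proof. by move=> p0 p1 i; case: (ord2 i) => ->. Qed.

Lemma ZN_gen_flow : ZN_gen R N = flow (vec R AI) theta.
Proof.
have h : e1 R AI ^+ 2 + e2 R AI ^+ 2 + e3 R AI ^+ 2 = 1 by rewrite /=; ring.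
have [A0 A1 A2 A3] := flow_unit theta h.
apply: SU2_ext; rewrite ?A0 ?A1 ?A2 ?A3 ?q0.unlock ?q1.unlock ?q2.unlock ?q3.unlock
  /= !mxE /= ?mulr1 ?mulr0 //.
Qed.

Lemma ZN_gen_inv : SU2val (ZN_gen R N)^-1%g = mx22 (em 1 theta) 0 0 (em (-1) theta).
Proof.
have e : SU2val (ZN_gen R N) *m mx22 (em 1 theta) 0 0 (em (-1) theta) = 1%:M.
  have diagM (a b p q : C) : a * p = 1 -> b * q = 1 -> mx22 a 0 0 b *m mx22 p 0 0 q = 1%:M.
    move=> ap bq; apply: mx22P; rewrite !mxE !big_ord_recl !big_ord0 !mxE /=;
      by rewrite ?mul0r ?mulr0 ?addr0 ?add0r.
  have c2 := cos2Dsin2 theta.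
  rewrite /= /ZN_gen_mx -/theta /expi /em mulN1r mul1r cosN sinN.
  by apply: diagM; apply: ReIm_eq; rewrite ?cReM ?cImM /=; lra.
by rewrite -[LHS]mulmx1 -e mulmxA mulVmx ?mul1mx // SU2_unit.
Qed.

Lemma spinor_equivariance psi :
  (forall g gamma, ZN N gamma -> psi (g * gamma)%g = SU2val (gamma^-1)%g *m psi g) <->
  (forall g, entry 0 psi (g * ZN_gen R N)%g = em 1 theta * entry 0 psi g) /\
  (forall g, entry 1 psi (g * ZN_gen R N)%g = em (-1) theta * entry 1 psi g).
Proof.
have row (v : 'cV[C]_2) : (mx22 (em 1 theta) 0 0 (em (-1) theta) *m v) 0 0 = em 1 theta * v 0 0 /\
    (mx22 (em 1 theta) 0 0 (em (-1) theta) *m v) 1 0 = em (-1) theta * v 1 0.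
  have l1 : lift ord0 ord0 = 1 :> 'I_2 by apply/val_inj.
  by rewrite !mxE !big_ord_recl !big_ord0 l1 !mxE /= !mul0r !addr0 !add0r.
split=> [H|[H0 H1] g _ [n ->]].
  have Z1 : ZN N (ZN_gen R N) by exists 1%N.
  by split=> g; rewrite /entry (H g _ Z1) ZN_gen_inv; have [] := row (psi g).
elim: n g => [|n IH] g; first by rewrite expg0 invg1 mulg1 mul1mx.
rewrite expgS mulgA IH invgM /= -mulmxA; congr (_ *m _).
have -> : invmx (SU2val (ZN_gen R N)) = SU2val (ZN_gen R N)^-1%g by [].
rewrite ZN_gen_inv; have [r0 r1] := row (psi g).
apply/matrixP => i j; rewrite (ord1 j); case: (ord2 i) => ->.
  by rewrite r0; exact: H0.
by rewrite r1; exact: H1.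
Qed.

(* The two rows of D psi = lambda psi and the equivariance under the generator of
   Z_N, for psi = (f, h). *)
Definition eigen_system f h := [/\ smoothC f, smoothC h,
  (forall g, ii R * tau * fder AI f g + opA h g = mu * f g) /\
  (forall g, opB f g - ii R * tau * fder AI h g = mu * h g) &
  (forall g, f (g * ZN_gen R N)%g = em 1 theta * f g) /\
  (forall g, h (g * ZN_gen R N)%g = em (-1) theta * h g)].

Lemma eigenspinorsP psi : eigenspinors N T lambda psi <-> eigen_system (entry 0 psi) (entry 1 psi).
Proof.
have sP : smooth psi <-> smoothC (entry 0 psi) /\ smoothC (entry 1 psi).
  split=> [/smoothP H|[H0 H1]]; first by split.
  by apply/smoothP; exact: ord2_all.
split=> [[[/sP[s0 s1] /spinor_equivariance[Q0 Q1]] E]|[s0 s1 [E0 E1] Q]].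
  have [D0 D1] := @DiracE R T psi (ord2_all s0 s1).
  split=> //; split=> g.
    by have := D0 g; rewrite E mxE -/(entry 0 psi g) -/tau /mu => D; ring: D.
  by have := D1 g; rewrite E mxE -/(entry 1 psi g) -/tau /mu => D; ring: D.
have S : smooth psi by apply/sP.
have [D0 D1] := @DiracE R T psi (iffLR (smoothP psi) S).
split; first by split=> //; apply/spinor_equivariance.
apply/funext => g; apply/matrixP => i j; rewrite (ord1 j); case: (ord2 i) => ->.
  have -> : (lambda *: psi) g 0 0 = lambda * entry 0 psi g by rewrite mxE.
  by rewrite D0 -/tau (E0 g) /mu; ring.
have -> : (lambda *: psi) g 1 0 = lambda * entry 1 psi g by rewrite mxE.
by rewrite D1 -/tau (E1 g) /mu; ring.
Qed.

Lemma avg_mulr w f g (t : R) a : smoothC f -> (forall g, f (g * flow (vec R AI) t)%g = a * f g) ->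
  fourier w f (g * flow (vec R AI) t)%g = a * fourier w f g.
Proof.
move=> sf H; rewrite /fourier mulrCA; congr (_ * _); rewrite /avg -cintZ; last first.
  by apply: ccontM; [exact: ccont_em|exact: ccont_orbit].
congr cint; apply/funext => s; rewrite -mulgA /vec -flowD addrC flowD mulgA H; ring.
Qed.

(** A lowers the weight by 2 and B raises it by 2, so the indices k - 1 and k + 1 are exchanged by
    the system. The generator of the cyclic group lies on the flow of I, which commutes with the
    averaging, so equivariance is kept. *)
Lemma eigen_system_four k f h : eigen_system f h -> eigen_system (fourier (k - 1) f) (fourier (k + 1) h).
Proof.
move=> [sf sh [E1 E2] [Q1 Q2]]; rewrite ZN_gen_flow in Q1 Q2.
split; [exact: smoothC_fourier|exact: smoothC_fourier| |].
  split=> g.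
    rewrite fourier_dI // fourier_opA // (_ : k + 1 - 2 = k - 1); last by ring.
    have := @fourier_lin R (k - 1) (ii R * tau) 1 (fder AI f) (opA h) g (smoothC_d AI sf) (smoothCA sh).
    rewrite mul1r => <-; have := @fourier_lin R (k - 1) mu 0 f f g sf sf.
    rewrite mul0r addr0 => <-; congr (fourier _ _ g); apply/funext => g'.
    by rewrite mul1r E1 mul0r addr0.
  rewrite fourier_dI // fourier_opB // (_ : k - 1 + 2 = k + 1); last by ring.
  have := @fourier_lin R (k + 1) 1 (- (ii R * tau)) (opB f) (fder AI h) g (smoothCB sf) (smoothC_d AI sh).
  rewrite mul1r mulNr => <-; have := @fourier_lin R (k + 1) mu 0 h h g sh sh.
  rewrite mul0r addr0 => <-; congr (fourier _ _ g); apply/funext => g'.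
  by rewrite mul1r mulNr E2 mul0r addr0.
by split=> g; rewrite ZN_gen_flow; exact: avg_mulr.
Qed.

Lemma eigen_system_lin c f h f' h' : eigen_system f h -> eigen_system f' h' ->
  eigen_system (fun g => c * f g + f' g) (fun g => c * h g + h' g).
Proof.
move=> [sf sh [E1 E2] [Q1 Q2]] [sf' sh' [E1' E2'] [Q1' Q2']].
have F := smoothCZ c sf; have H := smoothCZ c sh.
split; [exact: smoothCD|exact: smoothCD| |].
  split=> g.
    rewrite dD // dZ // opAD // opAZ // mulrDr [mu * (_ + _)]mulrDr -E1' [mu * (c * _)]mulrCA -E1; ring.
  rewrite dD // dZ // opBD // opBZ // [mu * (_ + _)]mulrDr -E2' [mu * (c * _)]mulrCA -E2; ring.
by split=> g; rewrite ?Q1 ?Q1' ?Q2 ?Q2'; ring.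
Qed.

Lemma esys0 : eigen_system (fun=> 0) (fun=> 0).
Proof.
split; [exact: smoothC_cst|exact: smoothC_cst| |]; split=> g; rewrite ?opA0 ?opB0 ?d_cst; ring.
Qed.

Definition kw k i : int := if i == 0 then k - 1 else k + 1.

Definition wproj k psi : V := fun g => \col_i fourier (kw k i) (entry i psi) g.

Lemma entry_wproj k psi i : entry i (wproj k psi) = fourier (kw k i) (entry i psi).
Proof. by apply/funext => g; rewrite /entry mxE. Qed.

Lemma entry_lin c psi phi i : entry i (c *: psi + phi) = fun g => c * entry i psi g + entry i phi g.
Proof. by apply/funext => g; rewrite /entry !mxE. Qed.

Lemma spinor_ext psi phi : (forall i g, entry i psi g = entry i phi g) -> psi = phi.
Proof.
by move=> H; apply/funext => g; apply/matrixP => i j; rewrite (ord1 j); exact: H.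
Qed.

Local Notation E := (@eigenspinors R N T lambda).

Lemma E_smoothC psi i : E psi -> smoothC (entry i psi).
Proof. by move=> /eigenspinorsP[s0 s1 _ _]; move: i; exact: ord2_all. Qed.

Lemma E0 : E 0.
Proof.
apply/eigenspinorsP; have Z i : entry i 0 = fun=> 0 by apply/funext => g; rewrite /entry mxE.
by rewrite !Z; exact: esys0.
Qed.

Lemma E_lin c psi phi : E psi -> E phi -> E (c *: psi + phi).
Proof. by move=> /eigenspinorsP H /eigenspinorsP H'; apply/eigenspinorsP; rewrite !entry_lin; exact: eigen_system_lin. Qed.

Lemma E_wproj k psi : E psi -> E (wproj k psi).
Proof. by move=> /eigenspinorsP H; apply/eigenspinorsP; rewrite !entry_wproj; exact: eigen_system_four. Qed.

Lemma wproj_lin k c psi phi : E psi -> E phi -> wproj k (c *: psi + phi) = c *: wproj k psi + wproj k phi.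
Proof.
move=> H H'; apply: spinor_ext => i g; rewrite entry_lin !entry_wproj entry_lin.
have := @fourier_lin R (kw k i) c 1 _ _ g (E_smoothC i H) (E_smoothC i H'); rewrite mul1r => <-.
by congr (fourier _ _ g); apply/funext => g'; rewrite mul1r.
Qed.

Definition Ek k : set V := [set psi | E psi /\ forall i, wt (kw k i) (entry i psi)].

Lemma Ek_wproj k psi : E psi -> Ek k (wproj k psi).
Proof. by move=> H; split=> [|i]; [exact: E_wproj|rewrite entry_wproj; apply/wt_fourier/E_smoothC]. Qed.

Lemma wproj_id k psi : Ek k psi -> wproj k psi = psi.
Proof. by move=> [H W]; apply: spinor_ext => i g; rewrite entry_wproj fourier_id //; exact: E_smoothC. Qed.

Lemma wproj_neq k k' psi : Ek k psi -> k' != k -> wproj k' psi = 0.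
Proof.
move=> [H W] kk; apply: spinor_ext => i g; rewrite entry_wproj /entry mxE.
apply: fourier_neq (W i) _; first exact: E_smoothC.
by apply: contra_neq kk; rewrite /kw; case: ifP => _ /addIr.
Qed.

Lemma wproj_eq0 psi : E psi -> (forall k, wproj k psi = 0) -> psi = 0.
Proof.
move=> H P; apply: spinor_ext => i g; rewrite {2}/entry mxE.
apply: fourier_unique (E_smoothC i H) _ => w g'.
pose k : int := w + (if i == 0 then 1 else - 1).
have <- : kw k i = w by rewrite /kw /k; case: (i == 0); ring.
by rewrite -entry_wproj P /entry mxE.
Qed.

Lemma Ek0 k : Ek k 0.
Proof.
split=> [|i]; first exact: E0.
have -> : entry i 0 = fun=> 0 :> C by apply/funext => g; rewrite /entry mxE.
by move=> g; rewrite d_cst mulr0.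
Qed.

Lemma Ek_lin k c psi phi : Ek k psi -> Ek k phi -> Ek k (c *: psi + phi).
Proof.
move=> [H W] [H' W']; split=> [|i]; first exact: E_lin.
by rewrite entry_lin; apply: wtD => //; [exact/smoothCZ/E_smoothC|exact: E_smoothC|apply: wtZ => //; exact: E_smoothC].
Qed.

(** The weights listed are split off one at a time. A spinor all of whose projections vanish is 0 by
    uniqueness of Fourier components, which ends the induction and makes the sum exhaust the
    eigenspace. *)
Lemma eigen_dim (ls : seq (int * nat)) : uniq (map fst ls) ->
  (forall p, p \in ls -> has_dim (Ek p.1) p.2) ->
  (forall k, (exists psi, Ek k psi /\ psi <> 0) -> k \in map fst ls) ->
  has_dim E (\sum_(p <- ls) p.2)%N.
Proof.
move=> ul dl full.
pose ES (ks : seq int) : set V := [set psi | E psi /\ forall k, k \notin ks -> wproj k psi = 0].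
have -> : E = ES (map fst ls).
  apply/seteqP; split=> psi; last by case.
  move=> H; split=> // k nk; apply: contrapT => P; move/negP: nk; apply; apply: full.
  by exists (wproj k psi); split=> //; exact: Ek_wproj.
elim: ls ul dl {full} => [|[k dk] ls IH] /= => [_ _|/andP[kn ul] dl].
  rewrite big_nil; exists (fun=> 0); split=> [c _ []//|].
  apply/seteqP; split=> psi.
    move=> [H P]; exists (fun=> 0); rewrite // big_ord0.
    by rewrite (wproj_eq0 H) // => k; exact: P.
  move=> [c _ <-]; rewrite big_ord0; split=> [|k _]; first exact: E0.
  (* The zero spinor has every weight, in particular one different from k, so its projection to k
     vanishes. *)
  have [k' /eqP kk] : exists k', k' <> k by exists (k + 1); lia.
  by apply: wproj_neq (Ek0 k') _; rewrite eq_sym.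
rewrite big_cons /=; apply: (@has_dim_add _ _ (Ek k) (ES (map fst ls))).
- by apply: (dl (k, dk)); rewrite inE eqxx.
- by apply: IH => // p pl; apply: dl; rewrite inE pl orbT.
- by move=> psi Hx [_ /(_ k kn)]; rewrite (wproj_id Hx).
apply/seteqP; split=> psi.
  move=> [H P]; have Hk := Ek_wproj k H.
  exists (wproj k psi); first by [].
  have HE : E (- wproj k psi + psi) by rewrite -scaleN1r; apply: E_lin; [exact: Hk.1|].
  exists (- wproj k psi + psi); last by rewrite addrA subrr add0r.
  split=> // k' nk'; rewrite -scaleN1r wproj_lin //; last exact: Hk.1.
  have [->|kk] := eqVneq k' k; first by rewrite (wproj_id Hk) scaleN1r addNr.
  by rewrite (wproj_neq Hk kk) P ?scaler0 ?addr0 // inE negb_or kk.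
move=> [x Hx [y [Hy Py] <-]].
have -> : x + y = 1 *: x + y by rewrite scale1r.
split=> [|k']; first by apply: E_lin => //; exact: Hx.1.
rewrite inE negb_or => /andP[kk nk']; rewrite wproj_lin //; last exact: Hx.1.
by rewrite (wproj_neq Hx kk) Py ?scaler0 ?addr0.
Qed.

(* On weights (k - 1, k + 1) the eigenvalue equation reads A h = ak f, B f = bk h. *)
Definition ak k : C := lambda + (T / 2)%:C + k%:~R * tau.
Definition bk k : C := lambda + (T / 2)%:C - k%:~R * tau.

(** The offsets in the weights k - 1 and k + 1 contribute exactly the 1/T of the zeroth order term,
    which therefore disappears from a and b. *)
Lemma eigen_system_wt k f h g : wt (k - 1) f -> wt (k + 1) h ->
  (ii R * tau * fder AI f g + opA h g = mu * f g <-> opA h g = ak k * f g) /\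
  (opB f g - ii R * tau * fder AI h g = mu * h g <-> opB f g = bk k * h g).
Proof.
move=> wf wh; rewrite wf wh.
have muE : mu = lambda + (T / 2)%:C + tau by rewrite /mu rmorphD addrA.
have -> : ii R * tau * (ii R * (k - 1)%:~R * f g) = (mu - ak k) * f g.
  by rewrite muE /ak intrB; ring: (iiM R).
have -> : ii R * tau * (ii R * (k + 1)%:~R * h g) = (bk k - mu) * h g.
  by rewrite muE /bk intrD; ring: (iiM R).
split; split=> H.
- by rewrite -[LHS](addKr ((mu - ak k) * f g)) H; ring.
- by rewrite H; ring.
- by rewrite -[LHS](subrK ((bk k - mu) * h g)) H; ring.
- by rewrite H; ring.
Qed.

Lemma EkE k psi : Ek k psi -> let f := entry 0 psi in let h := entry 1 psi in
  [/\ smoothC f, smoothC h, wt (k - 1) f, wt (k + 1) h &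
    (forall g, opA h g = ak k * f g) /\ (forall g, opB f g = bk k * h g)].
Proof.
move=> [/eigenspinorsP[sf sh [E1 E2] _] W] f h.
have wf : wt (k - 1) f := W 0; have wh : wt (k + 1) h := W 1.
by split=> //; split=> g; have [e1 e2] := eigen_system_wt g wf wh; [apply/e1/E1|apply/e2/E2].
Qed.

Lemma emD v w (t : R) : em (v + w) t = em v t * em w t.
Proof.
rewrite /em intrD mulrDl cosD sinD; apply: ReIm_eq; rewrite ?cReM ?cImM /=; ring.
Qed.

Definition spinor_of f h : V := fun g => \col_i (if i == 0 then f g else h g).

Lemma entry_spinor_of f h : entry 0 (spinor_of f h) = f /\ entry 1 (spinor_of f h) = h.
Proof. by split; apply/funext => g; rewrite /entry mxE. Qed.

Hypothesis N0 : (0 < N)%N.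

Lemma em_theta k : em k theta = 1 <-> (N%:Z %| k)%Z.
Proof.
have NR : N%:R != 0 :> R by rewrite pnatr_eq0 -lt0n.
have per (q : int) : em (q * N) theta = 1.
  have [c1 s1] := trig_int R q.
  rewrite /em (_ : (q * N)%:~R * theta = q%:~R * (2 * pi)) ?c1 ?s1 ?oppr0 //.
  by rewrite intrM -pmulrn /theta; field.
split=> [|/dvdzP[q ->]//].
rewrite [k](divz_eq k N) emD per mul1r => /(congr1 (@complex.Re R)) /=.
set r := (k %% N)%Z; move=> cr.
suff -> : r = 0 by rewrite addr0 dvdz_mull.
have r0 : 0 <= r by rewrite modz_ge0 //; lia.
have rN : r < N%:Z by rewrite ltz_pmod.
apply: contrapT => rN0.
have rp : 0 < r by lia.
(* The half angle of the remainder lies strictly between 0 and pi, where sin y > 0 and hence cos 2y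
   = 1 - 2 sin^2 y < 1: the real part alone forces the remainder to vanish. *)
pose y : R := r%:~R * theta / 2.
have yE : r%:~R * theta = y *+ 2 by rewrite /y mulr2n; field.
have y0 : 0 < y by rewrite /y /theta !mulr_gt0 ?invr_gt0 ?ltr0z ?ltr0n ?pi_gt0.
have yp : y < pi.
  have -> : y = pi * (r%:~R / N%:R) by rewrite /y /theta; field.
  rewrite -[ltRHS]mulr1 ltr_pM2l ?pi_gt0 // ltr_pdivrMr ?ltr0n // mul1r -[N%:R]/((N%:Z)%:~R).
  by rewrite ltr_int.
have := @sin_gt0_pi R y; rewrite y0 yp => /(_ isT); rewrite yE cos_mulr2n in cr.
by have := cos2Dsin2 y; move: cr; nra.
Qed.

Lemma Ek_spinor_of k f h : smoothC f -> smoothC h -> wt (k - 1) f -> wt (k + 1) h ->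
  (forall g, opA h g = ak k * f g) -> (forall g, opB f g = bk k * h g) ->
  (N%:Z %| k)%Z -> Ek k (spinor_of f h).
Proof.
move=> sf sh wf wh A B /em_theta Nk; have [e0 e1] := entry_spinor_of f h.
split; last by apply: ord2_all; rewrite ?e0 ?e1.
apply/eigenspinorsP; rewrite e0 e1; split=> //.
  by split=> g; have [h1 h2] := eigen_system_wt g wf wh; [apply/h1|apply/h2].
split=> g; rewrite ZN_gen_flow.
  rewrite -[in RHS](wt_orbit g theta sf wf).
  by rewrite mulrA -emD (_ : 1 + (k - 1) = k) ?Nk ?mul1r //; ring.
rewrite -[in RHS](wt_orbit g theta sh wh).
by rewrite mulrA -emD (_ : - 1 + (k + 1) = k) ?Nk ?mul1r //; ring.
Qed.

Lemma Ek_neq0 k psi : Ek k psi -> psi <> 0 ->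
  (exists g, entry 0 psi g != 0) \/ (forall g, entry 0 psi g = 0) /\ (exists g, entry 1 psi g != 0).
Proof.
move=> H nz; case: (pselect (exists g, entry 0 psi g != 0)) => [|n0]; first by left.
have Z : forall g, entry 0 psi g = 0.
  by move=> g; apply: contrapT => /eqP ne; apply: n0; exists g.
right; split=> //; apply: contrapT => n1; apply: nz; apply: spinor_ext => i g.
have -> : entry i 0 g = 0 :> C by rewrite /entry mxE.
move: i; apply: ord2_all => //.
by apply: contrapT => /eqP ne; apply: n1; exists g.
Qed.

(** On weight k - 1 the generator multiplies f by exp(i(k - 1) theta), while equivariance demands
    exp(-i theta). For h the factors are exp(i(k + 1) theta) and exp(i theta). Either component, if
    nonzero, gives exp(ik theta) = 1. *)
Lemma Ek_dvd k psi : Ek k psi -> psi <> 0 -> (N%:Z %| k)%Z.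
Proof.
move=> H nz; have [sf sh wf wh _] := EkE H; apply/em_theta.
have [/eigenspinorsP[_ _ _ [Q0 Q1]] _] := H.
case: (Ek_neq0 H nz) => [[g ne]|[_ [g ne]]].
  have := wt_orbit g theta sf wf; rewrite -ZN_gen_flow Q0 mulrA -emD subrK => e.
  by apply: (mulIf ne); rewrite e mul1r.
have := wt_orbit g theta sh wh; rewrite -ZN_gen_flow Q1 mulrA -emD addrK => e.
by apply: (mulIf ne); rewrite e mul1r.
Qed.

Lemma Ek_dim k n (F : nat -> V) :
  (forall a, (a < n)%N -> Ek k (F a)) ->
  (forall psi, Ek k psi -> exists z : nat -> C, psi = \sum_(a < n) z a *: F a) ->
  (forall z : nat -> C, \sum_(a < n) z a *: F a = 0 -> forall a, (a < n)%N -> z a = 0) ->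
  has_dim (Ek k) n.
Proof.
move=> FE sp fr; exists (fun i : 'I_n => F i).
have ext (c : 'I_n -> C) : exists z : nat -> C, forall i : 'I_n, c i = z i.
  exists (fun a => if insub a is Some i then c i else 0) => i.
  by rewrite valK.
split=> [c e i|].
  have [z zE] := ext c; rewrite zE; apply: fr (ltn_ord i).
  by rewrite -[RHS]e; apply: eq_bigr => j _; rewrite zE.
apply/seteqP; split=> psi; first by move=> /sp[z ->]; exists (fun i : 'I_n => z i).
move=> [c _ <-]; elim/big_ind: _ => [|x y Hx Hy|i _].
- exact: Ek0.
- by rewrite -[x]scale1r; exact: Ek_lin.
- by rewrite -[_ *: _]addr0; apply: Ek_lin; [exact/FE/ltn_ord|exact: Ek0].
Qed.

Lemma Ek_AB k psi g : Ek k psi -> opA (opB (entry 0 psi)) g = ak k * bk k * entry 0 psi g.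
Proof.
move=> /EkE[sf sh wf wh [A B]].
have -> : opB (entry 0 psi) = fun g => bk k * entry 1 psi g by apply/funext => g'; rewrite B.
by rewrite opAZ // A; ring.
Qed.

Lemma opA_kernel_AB w h g : smoothC h -> wt w h -> (forall g, opA h g = 0) ->
  opA (opB h) g = - 4 * w%:~R * h g.
Proof.
move=> sh wh A0; have := opBA_wt g sh wh.
have -> : opA h = fun=> 0 by apply/funext.
by rewrite opB0 => /esym/eqP; rewrite addr_eq0 => /eqP ->; ring.
Qed.

(** The mirror image of [holomorphic_neg]: from BAh = 0 the commutator gives ABh = -4wh, and -4w +
    2w is negative for w > 0. *)
Lemma opA_kernel_eq0 w h : smoothC h -> wt w h -> (forall g, opA h g = 0) -> 0 < w ->
  forall g, h g = 0.
Proof.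
move=> sh wh A0 w0; apply: (@eigen_bound R h (- 4 * w%:~R) w sh wh).
  by move=> g; exact: opA_kernel_AB.
have -> : - 4 * w%:~R = ((- 4 * w%:~R : R))%:C :> C.
  by rewrite rmorphM /= rmorph_int rmorphN /= rmorph_nat.
by have : 0 < w%:~R :> R by [rewrite ltr0z]; rewrite /=; lra.
Qed.

Lemma entry_sum n (F : nat -> V) (z : nat -> C) i :
  entry i (\sum_(a < n) z a *: F a) = fun g => \sum_(a < n) z a * entry i (F a) g.
Proof.
apply/funext => g; rewrite /entry.
elim: n => [|n IH]; first by rewrite !big_ord0 mxE.
by rewrite !big_ord_recr /= -IH !mxE.
Qed.

Lemma entry_sum0 n (F : nat -> V) (z : nat -> C) : \sum_(a < n) z a *: F a = 0 ->
  forall i g, \sum_(a < n) z a * entry i (F a) g = 0.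
Proof.
move=> e i g; have := congr1 (fun psi => entry i psi g) e; rewrite entry_sum => ->.
by rewrite /entry mxE.
Qed.

(** Eigenvalue plus (weight + 1)^2 is (n + 1)^2, which determines n; the weight then determines
    j. *)
Lemma wvec_inj n j n' j' : (0 < j <= n)%N -> (j' <= n')%N ->
  n%:Z - (2 * j)%N%:Z = n'%:Z - (2 * j')%N%:Z -> casimir R n j = casimir R n' j' -> n = n' /\ j = j'.
Proof.
move=> jn jn' wE; rewrite !casimir_nat ?leqW //; last by case/andP: jn.
move=> /eqP; rewrite eqr_nat => /eqP.
have : (4 * j * (n.+1 - j))%:Z = (n%:Z + 1) ^+ 2 - (n%:Z - (2 * j)%N%:Z + 1) ^+ 2 by nia.
have : (4 * j' * (n'.+1 - j'))%:Z = (n'%:Z + 1) ^+ 2 - (n'%:Z - (2 * j')%N%:Z + 1) ^+ 2 by nia.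
rewrite wE => e e' e''.
have sq : (n%:Z + 1) ^+ 2 = (n'%:Z + 1) ^+ 2 by rewrite -[LHS](subrK ((n'%:Z - (2 * j')%N%:Z + 1) ^+ 2)) -e' e'' e subrK.
have nn : n = n' by move: sq; clear; nia.
by split=> //; move: wE; rewrite nn; clear; lia.
Qed.

(** As b is nonzero, h = Bf/b is determined by f, and Ah = ABf/b = af holds for every f in the span
    of the n + 1 vectors of weight k - 1. The classification of weight vectors leaves no other f. *)
Lemma Ek_dim_ab k n j : (0 < j <= n)%N -> k - 1 = n%:Z - (2 * j)%N%:Z ->
  ak k * bk k = casimir R n j -> (N%:Z %| k)%Z -> has_dim (Ek k) n.+1.
Proof.
move=> jn kE abE Nk; have jn' : (j <= n)%N by case/andP: jn.
have ab0 : ak k * bk k != 0 by rewrite abE casimir_neq0.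
have b0 : bk k != 0 by move: ab0; rewrite mulf_eq0 negb_or => /andP[].
have a0 : ak k != 0 by move: ab0; rewrite mulf_eq0 negb_or => /andP[].
pose F a := spinor_of (wvec n j a) (fun g => (bk k)^-1 * opB (wvec n j a) g).
have e0 a : entry 0 (F a) = wvec n j a by have [] := entry_spinor_of (wvec n j a) (fun g => (bk k)^-1 * opB (wvec n j a) g).
have e1 a : entry 1 (F a) = fun g => (bk k)^-1 * opB (wvec n j a) g.
  by have [] := entry_spinor_of (wvec n j a) (fun g => (bk k)^-1 * opB (wvec n j a) g).
apply: (@Ek_dim k n.+1 F).
- move=> a; rewrite ltnS => an; have sw := smoothC_wvec R n j a.
  have ww : wt (k - 1) (wvec (R := R) n j a) by rewrite kE; exact: wt_wvec.
  apply: Ek_spinor_of => //.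
  + exact/smoothCZ/smoothCB.
  + by apply: wtZ; [exact: smoothCB|rewrite (_ : k + 1 = k - 1 + 2); [exact: wtB|ring]].
  + by move=> g; rewrite opAZ ?opAB_wvec // -?abE; [field|exact: smoothCB].
  + by move=> g; rewrite mulVKf.
- move=> psi H; have [sf sh wf wh [A B]] := EkE H.
  have [z zE] : exists z : nat -> C, forall g, entry 0 psi g = \sum_(a < n.+1) z a * wvec n j a g.
    case: (pselect (exists g, entry 0 psi g != 0)) => [nz|n0].
      have [n' [j' [jn2 wE cE [z zE]]]] := weight_vector_span sf wf (fun g => Ek_AB g H) nz.
      have [nE jE] := wvec_inj jn jn2 (etrans (esym kE) wE) (etrans (esym abE) cE).
      by exists z; move: zE; rewrite -nE -jE.
    exists (fun=> 0) => g; rewrite big1 => [|a _]; last by rewrite mul0r.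
    by apply: contrapT => /eqP ne; apply: n0; exists g.
  exists z; apply: spinor_ext => i g; rewrite entry_sum; move: i; apply: ord2_all.
    by rewrite zE; apply: eq_bigr => a _; rewrite e0.
  have -> : entry 1 psi g = (bk k)^-1 * opB (entry 0 psi) g by rewrite B mulKf.
  have -> : entry 0 psi = fun g => \sum_(a < n.+1) z a * wvec n j a g by apply/funext.
  rewrite (@opB_sum R n.+1 (fun a g => z a * wvec n j a g)); last by move=> a; exact/smoothCZ/smoothC_wvec.
  rewrite mulr_sumr; apply: eq_bigr => a _.
  by rewrite e1 (opBZ _ _ (smoothC_wvec R n j a)) mulrCA.
- move=> z zF a; rewrite ltnS => an; apply: (@wvec_free R n j z jn' _ a an) => g.
  by rewrite -[RHS](entry_sum0 zF 0 g); apply: eq_bigr => b _; rewrite e0.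
Qed.

(** Here Ah = 0 with h of positive weight, so h = 0. Then Bf = 0, and f is a polynomial of degree k
    - 1 = n. *)
Lemma Ek_dim_a k n : k = n.+1 -> ak k = 0 -> bk k != 0 -> (N%:Z %| k)%Z -> has_dim (Ek k) n.+1.
Proof.
move=> kE a0 b0 Nk.
have [s0 w0] : smoothC (fun=> 0 : C) /\ wt (k + 1) (fun=> 0 : C).
  by split=> [|g]; [exact: smoothC_cst|rewrite d_cst mulr0].
have kn : k - 1 = n by lia.
pose F a := spinor_of (mono n a) (fun=> 0).
have e0 a : entry 0 (F a) = mono n a by have [] := entry_spinor_of (mono n a) (fun=> 0).
have e1 a : entry 1 (F a) = fun=> 0 by have [] := entry_spinor_of (mono n a) (fun=> 0).
apply: (@Ek_dim k n.+1 F).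
- move=> a; rewrite ltnS => an; apply: Ek_spinor_of => //.
  + exact: smoothC_mono.
  + by rewrite kn; exact: wt_mono.
  + by move=> g; rewrite opA0 a0 mul0r.
  + by move=> g; rewrite opB_mono mulr0.
- move=> psi H; have [sf sh wf wh [A B]] := EkE H.
  have h0 : forall g, entry 1 psi g = 0.
    apply: (opA_kernel_eq0 sh wh); last by lia.
    by move=> g; rewrite A a0 mul0r.
  rewrite kn in wf.
  have [z zE] := holomorphic_poly sf wf (fun g => etrans (B g) (etrans (congr1 (fun c => bk k * c) (h0 g)) (mulr0 _))).
  exists z; apply: spinor_ext => i g; rewrite entry_sum; move: i; apply: ord2_all.
    by rewrite zE; apply: eq_bigr => a _; rewrite e0.
  by rewrite h0 big1 // => a _; rewrite e1 mulr0.
- move=> z zF a; rewrite ltnS => an; apply: (@mono_free R n z _ a an) => g.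
  by rewrite -[RHS](entry_sum0 zF 0 g); apply: eq_bigr => b _; rewrite e0.
Qed.

(** One step below the lowest weight - n the eigenvalue of AB is 0 and the weight is negative, which
    [eigen_bound] excludes for a nonzero function. *)
Lemma opA_wvec_last n a g : (a <= n)%N -> opA (wvec (R := R) n n a) g = 0.
Proof.
move=> an; have ww := wt_wvec (R := R) n.+1 an.
apply: (@eigen_bound R (wvec n n.+1 a) 0 _ (smoothC_wvec R n n.+1 a) ww).
  by move=> g'; rewrite opAB_wvec // casimir_nat // subnn muln0.
by rewrite add0r pmulr_rlt0 // ltrz0; lia.
Qed.

(** Here Bf = 0 with f of negative weight, so f = 0. Then Ah = 0, and h is a lowest weight vector of
    weight k + 1 = - n. *)
Lemma Ek_dim_b k n : k = - (n.+1%:Z) -> bk k = 0 -> ak k != 0 -> (N%:Z %| k)%Z -> has_dim (Ek k) n.+1.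
Proof.
move=> kE b0 a0 Nk.
have [s0 w0] : smoothC (fun=> 0 : C) /\ wt (k - 1) (fun=> 0 : C).
  by split=> [|g]; [exact: smoothC_cst|rewrite d_cst mulr0].
have kn : k + 1 = n%:Z - (2 * n)%N%:Z by lia.
pose F a := spinor_of (fun=> 0) (wvec n n a).
have e0 a : entry 0 (F a) = fun=> 0 by have [] := entry_spinor_of (fun=> 0) (wvec n n a).
have e1 a : entry 1 (F a) = wvec n n a by have [] := entry_spinor_of (fun=> 0) (wvec n n a).
apply: (@Ek_dim k n.+1 F).
- move=> a; rewrite ltnS => an; apply: Ek_spinor_of => //.
  + exact: smoothC_wvec.
  + by rewrite kn; exact: wt_wvec.
  + by move=> g; rewrite opA_wvec_last // mulr0.
  + by move=> g; rewrite opB0 b0 mul0r.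
- move=> psi H; have [sf sh wf wh [A B]] := EkE H.
  have f0 : forall g, entry 0 psi g = 0.
    apply: (holomorphic_neg sf wf); last by lia.
    by move=> g; rewrite B b0 mul0r.
  have A0 g : opA (entry 1 psi) g = 0 by rewrite A f0 mulr0.
  have [z zE] : exists z : nat -> C, forall g, entry 1 psi g = \sum_(a < n.+1) z a * wvec n n a g.
    case: (pselect (exists g, entry 1 psi g != 0)) => [nz|n0].
      have [n' [j' [jn wE cE [z zE]]]] := weight_vector_span sh wh (fun g => opA_kernel_AB g sh wh A0) nz.
      suff [nE jE] : n = n' /\ n = j' by exists z; move: zE; rewrite -nE -jE.
      (* The eigenvalue is 4n and n' = 2j' - n by the weight, so j'(j' + 1 - n) = n. This factors as
         (j' - n)(j' + 1) = 0, whence j' = n and n' = n. *)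
      move: cE; rewrite casimir_nat ?leqW // => /(congr1 (@complex.Re R)).
      have -> : (4 * j' * (n'.+1 - j'))%:R = (((4 * j' * (n'.+1 - j'))%N%:Z)%:~R : C) by rewrite -pmulrn.
      have -> : - 4 * (k + 1)%:~R = ((- 4 * (k + 1))%:~R : C) by rewrite intrM.
      rewrite !ReZ_int => /eqP; rewrite eqr_int => /eqP.
      by nia.
    exists (fun=> 0) => g; rewrite big1 => [|a _]; last by rewrite mul0r.
    by apply: contrapT => /eqP ne; apply: n0; exists g.
  exists z; apply: spinor_ext => i g; rewrite entry_sum; move: i; apply: ord2_all.
    by rewrite f0 big1 // => a _; rewrite e0 mulr0.
  by rewrite zE; apply: eq_bigr => a _; rewrite e1.
- move=> z zF a; rewrite ltnS => an; apply: (@wvec_free R n n z (leqnn n) _ a an) => g.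
  by rewrite -[RHS](entry_sum0 zF 1 g); apply: eq_bigr => b _; rewrite e1.
Qed.

(** If f = 0, then bh = Bf = 0 gives b = 0, and Ah = 0 rules out k >= 0. Otherwise the
    classification of f has j > 0, or f is a highest weight vector with ab = 0 and k = n + 1. In the
    latter case a = 0: with a nonzero, b = 0 would give BAh = aBf = 0, hence h = 0 by the eigenvalue
    bound, and af = Ah = 0. *)
Lemma Ek_nonzero k psi : Ek k psi -> psi <> 0 -> [\/
  exists n j, [/\ (0 < j <= n)%N, k - 1 = n%:Z - (2 * j)%N%:Z & ak k * bk k = casimir R n j],
  0 < k /\ ak k = 0 | k < 0 /\ bk k = 0].
Proof.
move=> H nz; have [sf sh wf wh [A B]] := EkE H.
case: (Ek_neq0 H nz) => [n0|[f0 n1]]; last first.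
  apply: Or33; have b0 : bk k = 0.
    have [g ne] := n1; have := B g.
    have -> : entry 0 psi = fun=> 0 by apply/funext.
    by rewrite opB0 => /esym/eqP; rewrite mulf_eq0 (negbTE ne) orbF => /eqP.
  split=> //; rewrite ltNge; apply/negP => k0.
  have [g] := n1; rewrite (opA_kernel_eq0 sh wh) ?eqxx //; last by lia.
  by move=> g'; rewrite A f0 mulr0.
have [n [[|j] [jn wE cE _]]] := weight_vector_span sf wf (fun g => Ek_AB g H) n0; last first.
  by apply: Or31; exists n, j.+1; split.
apply: Or32; have k0 : 0 < k by lia.
split=> //; apply: contrapT => /eqP a0.
have b0 : bk k = 0.
  move: cE; rewrite casimir_nat // muln0 mul0n => /eqP.
  by rewrite mulf_eq0 (negbTE a0) => /eqP.
have B0 g : opB (entry 0 psi) g = 0 by rewrite B b0 mul0r.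
have h0 : forall g, entry 1 psi g = 0.
  apply: (@eigen_bound R _ (- 4 * (k + 1)%:~R) (k + 1) sh wh).
    move=> g; have := opBA_wt g sh wh.
    have -> : opA (entry 1 psi) = fun g => ak k * entry 0 psi g by apply/funext => g'; rewrite A.
    by rewrite opBZ // B0 mulr0 => /esym/eqP; rewrite addr_eq0 => /eqP ->; ring.
  have -> : - 4 * (k + 1)%:~R = ((- 4 * (k + 1))%:~R : C) by rewrite intrM.
  have -> : 2 * (k + 1)%:~R = (2 * (k + 1))%:~R :> R by rewrite intrM.
  by rewrite ReZ_int -intrD ltrz0; lia.
have [g] := n0; have := A g.
have -> : entry 1 psi = fun=> 0 by apply/funext.
by rewrite opA0 => /esym/eqP; rewrite mulf_eq0 (negbTE a0) => /eqP ->; rewrite eqxx.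
Qed.

(** * Matching the weights with the parameters of the two families *)

Hypotheses (oN : odd N) (T0 : 0 < T).

Let rho : C := lambda + (T / 2)%:C.
(** The radicand of the first family at k = mN: the equation ab = (n + 1)^2 - k^2 says that the
    square of [rho] is [D n k]. *)
Let D (n : nat) k : R := (n%:R + 1) ^+ 2 - k%:~R ^+ 2 + (k%:~R / T) ^+ 2.

Lemma ak_bk k : ak k * bk k = rho ^+ 2 - ((k%:~R / T) ^+ 2)%:C.
Proof.
have -> : ((k%:~R / T) ^+ 2)%:C = (k%:~R * tau) ^+ 2 :> C.
  by rewrite /tau !rmorphXn /= rmorphM /= rmorph_int.
by rewrite /ak /bk -/rho; ring.
Qed.

(** Strict positivity makes the square root real and nonzero, so that the two signs give different
    eigenvalues. *)
Lemma D_gt0 n k : - n%:Z <= k <= n%:Z -> 0 < D n k.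
Proof.
move=> /andP[k1 k2]; rewrite /D ltr_pwDl ?sqr_ge0 // subr_gt0.
have : k%:~R <= n%:R :> R by rewrite -[n%:R]/((n%:Z)%:~R) ler_int.
have : - n%:R <= k%:~R :> R by rewrite -[n%:R]/((n%:Z)%:~R) -intrN ler_int.
by move: (k%:~R : R) (n%:R : R) => x y; nra.
Qed.

Lemma params1P n m s : params1 N T lambda (n, m, s) <->
  admissible N n m /\ rho = ((-1) ^+ s * Num.sqrt (D n (m * N)))%:C.
Proof.
have -> : D n (m * N) = (1 + n%:R) ^+ 2 + m%:~R ^+ 2 * N%:R ^+ 2 * (T ^- 2 - 1).
  by rewrite /D intrM -pmulrn; field; rewrite gt_eqF.
rewrite /params1 /eigenvalue1 /=; split=> -[aN e]; split=> //.
  by rewrite /rho -e -rmorphD /=; congr (_%:C); ring.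
have lE : lambda = rho - (T / 2)%:C by rewrite /rho addrK.
by rewrite [RHS]lE e -rmorphB; congr (_%:C); ring.
Qed.

Lemma params2P m : params2 N T lambda m <-> rho = (- ((m * N)%:R / T))%:C.
Proof.
rewrite /params2 /eigenvalue2 /= natrM; split=> e.
  by rewrite /rho -e -rmorphD /=; congr (_%:C); ring.
have lE : lambda = rho - (T / 2)%:C by rewrite /rho addrK.
by rewrite [RHS]lE e -rmorphB; congr (_%:C); ring.
Qed.

(** For odd N the number mN has the parity of m, so the parity condition says that mN - 1 and n are
    congruent modulo 2. The strict upper bound excludes j = 0, the case of a highest weight vector
    f, where ab = 0. *)
Lemma admissibleP n m : admissible N n m <->
  exists2 j, (0 < j <= n)%N & m * N - 1 = n%:Z - (2 * j)%N%:Z.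
Proof.
have [M NE] : exists M : int, N%:Z = 2 * M + 1 by exists (N./2)%:Z; lia.
have parity : (exists q, m = 2 * q /\ (2 %| m)%Z = true) \/ (exists q, m = 2 * q + 1 /\ (2 %| m)%Z = false).
  by case: (boolP (2 %| m)%Z) => e; [left|right]; exists (m %/ 2)%Z; split=> //; lia.
rewrite /admissible; case: parity => -[q [mE ->]] /=.
  rewrite andbT andbF orbF.
  have -> : m * N = 2 * (q * N) by rewrite mE; ring.
  move: (q * N) => Q; split=> [/andP[on bd]|[j jn E]].
    by pose z : int := n./2%:Z + 1 - Q; exists (absz z); lia.
  by apply/andP; split; lia.
rewrite andbT andbF orFb.
have -> : m * N = 2 * (q * N + M) + 1 by rewrite mE mulrDl -mulrA mul1r NE; ring.
move: (q * N + M) => Q; split=> [/andP[on bd]|[j jn E]].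
  by pose z : int := n./2%:Z - Q; exists (absz z); lia.
by apply/andP; split; lia.
Qed.

Lemma params1_ab n m s : params1 N T lambda (n, m, s) ->
  ak (m * N) * bk (m * N) = ((n%:R + 1) ^+ 2 - (m * N)%:~R ^+ 2)%:C.
Proof.
move=> /params1P[/admissibleP[j jn kE] e].
have D0 : 0 < D n (m * N) by apply: D_gt0; lia.
rewrite ak_bk e -rmorphXn exprMn sqrr_sign mul1r sqr_sqrtr ?ltW // -rmorphB /D.
by congr (_%:C); ring.
Qed.

Lemma casimir_weight n j k : k - 1 = n%:Z - (2 * j)%N%:Z ->
  casimir R n j = ((n%:R + 1) ^+ 2 - k%:~R ^+ 2)%:C.
Proof.
move=> kE; rewrite /casimir rmorphB /= !rmorphXn /= rmorphD /= rmorph_nat rmorph1 rmorph_int.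
congr (_ - _ ^+ 2).
have -> : k = n%:Z - (2 * j)%N%:Z + 1 by rewrite -kE subrK.
by rewrite intrD intrB !natZC natrM.
Qed.

Lemma mul_tau k : k%:~R * tau = (k%:~R / T)%:C.
Proof. by rewrite /tau [RHS]rmorphM /= rmorph_int. Qed.

(** One parameter m of the second family serves two weights, mN and - mN; this is the factor 2 in
    its multiplicity. *)
Lemma params2_ab m : params2 N T lambda m ->
  ak (m * N)%:Z = 0 /\ bk (- (m * N)%:Z) = 0.
Proof.
move=> /params2P e.
have E : (m * N)%:Z%:~R * tau = ((m * N)%:R / T)%:C := mul_tau _.
by rewrite /ak /bk -/rho intrN mulNr opprK !E e -rmorphD addNr rmorph0.
Qed.

Lemma params2_neq0 m : params2 N T lambda m -> (0 < m)%N ->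
  bk (m * N)%:Z != 0 /\ ak (- (m * N)%:Z) != 0.
Proof.
move=> /params2P e m0.
have E : (m * N)%:Z%:~R * tau = ((m * N)%:R / T)%:C := mul_tau _.
have p : 0 < (m * N)%:R / T by rewrite divr_gt0 // ltr0n muln_gt0 m0.
rewrite /ak /bk -/rho intrN mulNr !E e -rmorphB.
have x0 : - ((m * N)%:R / T) - (m * N)%:R / T != 0 by rewrite lt_eqF //; lra.
by split; apply: contraNneq x0 => /(congr1 (@complex.Re R)) /= ->.
Qed.

(** For fixed [lambda] the weight determines n through ab = (n + 1)^2 - k^2, and then the sign
    because the square root is nonzero. Different parameters thus belong to different weights. *)
Lemma params1_inj p q : params1 N T lambda p -> params1 N T lambda q ->
  p.1.2 * N = q.1.2 * N -> p = q.
Proof.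
case: p q => [[n m] s] [[n' m'] s'] P Q /= kE.
have mm : m = m' by apply: (mulIf _ kE); lia.
have nn : n = n'.
  have := params1_ab P; rewrite mm (params1_ab Q) => /(congr1 (@complex.Re R)) /= /addIr/eqP.
  rewrite eqrXn2 ?addr_ge0 // => /eqP/addIr/eqP.
  by rewrite eqr_nat => /eqP.
have /params1P[/admissibleP[j jn jE] e] := P; have /params1P[_ e'] := Q.
have D0 : 0 < D n (m * N) by apply: D_gt0; lia.
have r0 : Num.sqrt (D n (m * N)) != 0 by rewrite gt_eqF // sqrtr_gt0.
move: e'; rewrite e -nn -mm => /(congr1 (@complex.Re R)) /= /(mulIf r0).
have neq : (-1 : R) != 1 by rewrite lt_eqF // ltrN10.
by case: s s' {P Q e} => -[] //= /eqP; rewrite ?[1 == _]eq_sym (negbTE neq).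
Qed.

Lemma finite_params2 : finite_set (params2 N T lambda).
Proof.
case: (pselect (exists m, params2 N T lambda m)) => [[m Pm]|n0]; last first.
  suff -> : params2 N T lambda = set0 by [].
  by apply/seteqP; split=> // m Pm; apply: n0; exists m.
apply: (@sub_finite_set _ _ [set m]) => [m' Pm'|]; last exact: finite_set1.
have /params2P e := Pm; have /params2P := Pm'; rewrite e => /(congr1 (@complex.Re R)) /=.
move=> /oppr_inj/(mulIf (invr_neq0 (lt0r_neq0 T0)))/eqP.
by rewrite eqr_nat eqn_pmul2r // => /eqP.
Qed.

Lemma finite_params1 : finite_set (params1 N T lambda).
Proof.
(* The factor 1 + T^2 removes the dependence on k: with r^2 = D one has r^2 T^2 = ((n + 1)^2 - k^2)
   T^2 + k^2, so r^2 (1 + T^2) >= (n + 1)^2. This bounds n, and n bounds |m|. *)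
pose r := complex.Re rho; pose B := Num.bound (r ^+ 2 * (1 + T ^+ 2)).
have bound n m s : params1 N T lambda (n, m, s) -> (n < B)%N /\ - n%:Z <= m <= n%:Z.
  move=> /params1P[/admissibleP[j jn jE] e]; split; last by nia.
  have k2 : - n%:Z <= m * N <= n%:Z by lia.
  have D0 := D_gt0 k2.
  have rD : r ^+ 2 = D n (m * N).
    by rewrite /r e /= exprMn sqrr_sign mul1r sqr_sqrtr // ltW.
  have : r ^+ 2 * (1 + T ^+ 2) < B%:R.
    by apply: archi_boundP; rewrite mulr_ge0 ?sqr_ge0 // addr_ge0 ?sqr_ge0.
  rewrite -(ltr_nat R); apply: le_lt_trans.
  have : n%:R <= (n%:R + 1) ^+ 2 :> R by have := ler0n R n; move: (n%:R : R) => x; nra.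
  move=> /le_trans; apply.
  have kn : (m * N)%:~R ^+ 2 <= (n%:R + 1) ^+ 2 :> R.
    case/andP: k2 => k1 k2.
    have : (m * N)%:~R <= n%:R :> R by rewrite -[n%:R]/((n%:Z)%:~R) ler_int.
    have : - n%:R <= (m * N)%:~R :> R by rewrite -[n%:R]/((n%:Z)%:~R) -intrN ler_int.
    by move: ((m * N)%:~R : R) (n%:R : R) => x y; nra.
  have rT : r ^+ 2 * T ^+ 2 = ((n%:R + 1) ^+ 2 - (m * N)%:~R ^+ 2) * T ^+ 2 + (m * N)%:~R ^+ 2.
    by rewrite rD /D; field; rewrite gt_eqF.
  rewrite mulrDr mulr1 rT rD /D.
  have x0 := sqr_ge0 (T : R); have y0 := sqr_ge0 ((m * N)%:~R / T).
  move: ((m * N)%:~R ^+ 2 : R) ((n%:R + 1) ^+ 2 : R) (T ^+ 2) ((_ / T) ^+ 2) kn x0 y0 => x y t u.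
  by move=> xy t0 u0; have : 0 <= (y - x) * t by [rewrite mulr_ge0 ?subr_ge0]; lra.
(* The shift by B encodes the integers m between -B and B by natural numbers. *)
pose F (p : nat * nat * bool) : nat * int * bool := (p.1.1, p.1.2%:Z - B%:Z, p.2).
apply: (@sub_finite_set _ _ (F @` ((`I_B `*` `I_(B + B)) `*` [set: bool]))).
  move=> [[n m] s] P; have [nB mn] := bound _ _ _ P.
  exists (n, absz (m + B%:Z), s); first by split=> //; split=> //=; lia.
  by rewrite /F /=; congr (_, _, _); lia.
apply: finite_image; apply: finite_setX; first by apply: finite_setX; exact: finite_II.
exact: finite_finset.
Qed.

(** The list [ls] records the occurring weights with their dimensions. A weight cannot come from
    both families, since ab is nonzero in the first and zero in the second. *)
Lemma eigenspinors_dim : has_dim E (spectral_multiplicity N T lambda).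
Proof.
have F1 := finite_params1; have F2 := finite_params2.
pose s1 : seq (nat * int * bool) := finmap.enum_fset (fset_set (params1 N T lambda)).
pose s2 : seq nat := finmap.enum_fset (fset_set (params2 N T lambda)).
have in1 p : p \in s1 <-> params1 N T lambda p
  by have e : (p \in s1) = (p \in params1 N T lambda) := in_fset_set F1 p; rewrite e inE.
have in2 m : m \in s2 <-> params2 N T lambda m
  by have e : (m \in s2) = (m \in params2 N T lambda) := in_fset_set F2 m; rewrite e inE.
(* The value m = 0 contributes dimension 0, but its weights 0 and -0 would coincide and spoil
   distinctness. *)
pose s2' := [seq m <- s2 | (0 < m)%N].
pose ls := [seq (p.1.2 * N%:Z, p.1.1.+1) | p <- s1] ++
  ([seq ((m * N)%:Z, (m * N)%N) | m <- s2'] ++ [seq (- (m * N)%:Z, (m * N)%N) | m <- s2']).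
have -> : spectral_multiplicity N T lambda = (\sum_(p <- ls) p.2)%N.
  rewrite /spectral_multiplicity !fsbig_finite //= /ls !big_cat !big_map /=; congr (_ + _)%N.
  rewrite -big_split /= /s2' big_filter [RHS]big_mkcond /=.
  by apply: eq_bigr => -[|m] _ //=; lia.
have i2 m : m \in s2' -> params2 N T lambda m /\ (0 < m)%N.
  by rewrite mem_filter => /andP[-> /in2].
apply: eigen_dim.
- rewrite /ls !map_cat -!map_comp !cat_uniq; apply/and3P; split.
  + rewrite map_inj_in_uniq ?finmap.fset_uniq // => p q /in1 P /in1 Q /=; exact: params1_inj.
  + apply/hasPn => k; rewrite mem_cat => kin; apply/negP => /mapP[[[n m] s] /in1 P /= kE].
    have : ak k * bk k = 0.
      case/orP: kin => /mapP[m' /i2[/params2_ab[a0 b0] _] /= ->].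
        by rewrite a0 mul0r.
      by rewrite b0 mulr0.
    have /params1P[/admissibleP[j jn jE] _] := P.
    rewrite kE (params1_ab P) -(casimir_weight jE) => /eqP.
    by rewrite (negbTE (casimir_neq0 R jn)).
  + have u2 : uniq s2' by rewrite filter_uniq // finmap.fset_uniq.
    apply/and3P; split.
    * rewrite map_inj_in_uniq // => m m' _ _ /= [/eqP]; rewrite eqn_pmul2r // => /eqP //.
    * apply/hasPn => _ /mapP[m /i2[_ m0] ->]; apply/negP => /mapP[m' _ /=].
      by nia.
    * rewrite map_inj_in_uniq // => m m' _ _ /= /oppr_inj[/eqP]; rewrite eqn_pmul2r // => /eqP //.
- move=> p; rewrite !mem_cat => /or3P[] /mapP.
  + move=> [[[n m] s] /in1 P ->] /=; have /params1P[/admissibleP[j jn jE] _] := P.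
    apply: (Ek_dim_ab jn jE); last exact: dvdz_mull.
    by rewrite (params1_ab P) (casimir_weight jE).
  + move=> [m /i2[P m0] ->] /=; have [a0 _] := params2_ab P; have [b0 _] := params2_neq0 P m0.
    have mN : ((m * N).-1.+1 = m * N)%N by rewrite prednK // muln_gt0 m0.
    by rewrite -[X in has_dim _ X]mN; apply: Ek_dim_a; rewrite ?mN // PoszM dvdz_mull.
  + move=> [m /i2[P m0] ->] /=; have [_ b0] := params2_ab P; have [_ a0] := params2_neq0 P m0.
    have mN : ((m * N).-1.+1 = m * N)%N by rewrite prednK // muln_gt0 m0.
    by rewrite -[X in has_dim _ X]mN; apply: Ek_dim_b; rewrite ?mN // PoszM -mulNr dvdz_mull.
- move=> k [psi [H nz]]; have /dvdzP[m kE] := Ek_dvd H nz.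
  rewrite /ls !map_cat !mem_cat -!map_comp; apply/or3P.
  case: (Ek_nonzero H nz) => [[n [j [jn jE abE]]]|[k0 a0]|[k0 b0]].
  + apply: Or31.
    have aN : admissible N n m by apply/admissibleP; exists j; rewrite -?kE.
    have D0 : 0 < D n k by apply: D_gt0; lia.
    (* A complex number whose square is the square of a positive real is that real up to sign: this
       is where [lambda] turns out to be real, and the sign is the boolean of the parameter. *)
    have r2 : rho ^+ 2 = ((Num.sqrt (D n k))%:C) ^+ 2.
      move: abE; rewrite ak_bk (casimir_weight jE) => /eqP; rewrite subr_eq => /eqP ->.
      by rewrite -[RHS]rmorphXn /= sqr_sqrtr ?ltW // -rmorphD.
    have [s sE] : exists s : bool, rho = ((-1) ^+ s * Num.sqrt (D n (m * N)))%:C.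
      rewrite -kE; move/eqP: r2; rewrite eqf_sqr => /orP[] /eqP ->.
        by exists false; rewrite expr0 mul1r.
      by exists true; rewrite expr1 mulN1r rmorphN.
    by apply/mapP; exists (n, m, s); rewrite ?kE //; apply/in1/params1P.
  + apply: Or32; apply/mapP; exists (absz m); last by rewrite /= kE; nia.
    rewrite mem_filter; apply/andP; split; first by nia.
    apply/in2/params2P; have mE : (absz m * N)%:Z = k by rewrite kE; nia.
    by rewrite pmulrn mE; move/eqP: a0; rewrite /ak -/rho mul_tau addr_eq0 -rmorphN => /eqP.
  + apply: Or33; apply/mapP; exists (absz m); last by rewrite /= kE; nia.
    rewrite mem_filter; apply/andP; split; first by nia.
    apply/in2/params2P; have mE : (absz m * N)%:Z = - k by rewrite kE; nia.
    rewrite pmulrn mE intrN mulNr opprK.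
    by move/eqP: b0; rewrite /bk -/rho mul_tau subr_eq0 => /eqP.
Qed.

End Eigenspinors.

Theorem theorem4p2 (R : realType) (N : nat) (T : R) :
  odd N -> 0 < T ->
  forall lambda : R[i],
    [/\ finite_set (params1 N T lambda),
        finite_set (params2 N T lambda) &
        has_dim (eigenspinors N T lambda) (spectral_multiplicity N T lambda)].
Proof.
move=> oN T0 lambda; have N0 : (0 < N)%N by case: (N) oN.
split; [exact: finite_params1|exact: finite_params2|exact: eigenspinors_dim].
Qed.
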